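(* For the partially observed system $x_{t+1}=Ax_t+B_ww_t$, $y_t=Cx_t+D_vv_t$ and the $H$-step predictor $\hat G^{SS}_N$ ($H\ge1$) obtained by autoregressive rollout of the single-step least-squares model defined in the context, the irreducible error $B(\hat G_N^{SS})=\lim_{N\to\infty}\mathbf{E}\,L(\hat G_N^{SS})$ is given by $$B(\hat G_N^{SS})=\operatorname{tr}\left((\Phi+MC)\Sigma_{\hat x}(\Phi+MC)^\top\right)+\operatorname{tr}\left(MD_eD_e^\top M^\top\right)+\|\Gamma_e\|_F^2,$$ where $$M=G^\star-\begin{bmatrix}CA\Sigma_xC^\top\Sigma_y^{-1}\\(CA\Sigma_xC^\top\Sigma_y^{-1})^2\\\vdots\\(CA\Sigma_xC^\top\Sigma_y^{-1})^{H}\end{bmatrix}$$ and $\Sigma_x$ is the stationary covariance of $x_t$.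
   Context: System: $x_{t+1}=Ax_t+B_ww_t$, $y_t=Cx_t+D_vv_t$, with $x_t\in\mathbb{R}^{d_x}$, $y_t\in\mathbb{R}^{d_y}$, $x_0=0$, and $w_t\sim\mathcal N(0,I_{d_x})$, $v_t\sim\mathcal N(0,I_{d_y})$ i.i.d. and mutually independent (there are no inputs). Standing assumptions: $\rho(A)<1$ (spectral radius), $(A,C)$ observable, $(A,B_w)$ controllable, $D_vD_v^\top\succ0$. Dataset: $y_1,\dots,y_N$ from one rollout. For a sequence $a$, $a_{s:r}$ denotes the stacked vector of $a_s,\dots,a_r$. Single-step predictor: $\hat G_y=\arg\min_{G_y\in\mathbb{R}^{d_y\times d_y}}\sum_{t=1}^{N-1}\|y_{t+1}-G_yy_t\|^2$ ($N$ large enough that the minimizer is almost surely unique), and $\hat G^{SS}_N\in\mathbb{R}^{Hd_y\times d_y}$ is the stack of $\hat G_y,\hat G_y^2,\dots,\hat G_y^H$. Loss: for a matrix $G\in\mathbb{R}^{Hd_y\times d_y}$, $L(G)=\lim_{T\to\infty}\mathbf{E}\frac1T\sum_{t=0}^T\|y_{t+1:t+H}-Gy_t\|^2$, the expectation being over an evaluation rollout of the system independent of the dataset; equivalently, the expectation under the stationary distribution of the system. In $\mathbf{E}\,L(\hat G_N)$ the outer expectation is over the dataset. Innovations form: let $S$ be the stabilizing solution of the Riccati equation $S=ASA^\top-ASC^\top(CSC^\top+D_vD_v^\top)^{-1}CSA^\top+B_wB_w^\top$, let $K=ASC^\top(CSC^\top+D_vD_v^\top)^{-1}$ be the Kalman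 gain, and $D_e=(CSC^\top+D_vD_v^\top)^{1/2}$. In stationarity, $\hat x_{t+1}=A\hat x_t+KD_ee_t$, $y_t=C\hat x_t+D_ee_t$, with $e_t$ i.i.d. standard normal. $\Sigma_{\hat x}$ is the stationary covariance of $\hat x_t$ (so $\Sigma_{\hat x}=A\Sigma_{\hat x}A^\top+KD_eD_e^\top K^\top$), $\Sigma_x$ satisfies $\Sigma_x=A\Sigma_xA^\top+B_wB_w^\top$, and $\Sigma_y=C\Sigma_xC^\top+D_vD_v^\top$ is the stationary covariance of $y_t$. $\Phi\in\mathbb{R}^{Hd_y\times d_x}$ has $i$-th block row $CA^{i-1}(A-KC)$ and $G^\star\in\mathbb{R}^{Hd_y\times d_y}$ has $i$-th block row $CA^{i-1}K$, $1\le i\le H$. $\Gamma_e\in\mathbb{R}^{Hd_y\times Hd_y}$ is block lower triangular with diagonal blocks $D_e$ and $(i,j)$ block $CA^{i-j-1}KD_e$ for $i>j$. $\|\cdot\|_F$ is the Frobenius norm. *)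

(* Defs.v *)
From HB Require Import structures.
From mathcomp Require Import all_boot all_order all_algebra.
From mathcomp Require Import finmap complex.
From mathcomp Require Import all_classical all_reals all_analysis.
Import Order.TTheory GRing.Theory Num.Theory.
Import numFieldNormedType.Exports.

Set Implicit Arguments.
Unset Strict Implicit.
Unset Printing Implicit Defensive.

Local Open Scope classical_set_scope.
Local Open Scope ring_scope.

(* Vectors of R^n are columns 'cV[R]_n.  The block index i of the text runs
   over 1..H, whereas i : 'I_H below runs over 0..H-1; exponents are shifted
   accordingly. *)

Section LinearAlgebra.
Variable R : realType.

Definition frobenius_norm m n (A : 'M[R]_(m, n)) : R :=
  Num.sqrt (\sum_i \sum_j A i j ^+ 2).

(* A vector is a one-column matrix, so its Euclidean norm is its Frobenius
   norm. *)
Definition euclidean_norm n (x : 'cV[R]_n) : R := frobenius_norm x.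

Definition posdef n (A : 'M[R]_n) : Prop :=
  A^T = A /\ forall x : 'cV[R]_n, x != 0 -> 0 < (x^T *m A *m x) 0 0.

Definition possemidef n (A : 'M[R]_n) : Prop :=
  A^T = A /\ forall x : 'cV[R]_n, 0 <= (x^T *m A *m x) 0 0.

Definition is_psd_sqrt n (Q A : 'M[R]_n) : Prop :=
  possemidef Q /\ Q *m Q = A.

(* The eigenvalues are the complex ones.  For n = 0 there are none, and the
   supremum of the empty set is 0. *)
Definition spectral_radius n (A : 'M[R]_n) : R :=
  sup [set Normc.normc z |
        z in [set z : R[i] | eigenvalue (map_mx (real_complex R) A) z]].

Definition observable n p (A : 'M[R]_n) (C : 'M[R]_(p, n)) : Prop :=
  \rank (\mxcol_(i < n) (C *m A ^+ i)) = n.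

Definition controllable n m (A : 'M[R]_n) (B : 'M[R]_(n, m)) : Prop :=
  \rank (\mxrow_(i < n) (A ^+ i *m B)) = n.

(* Covariance equation of the stationary solution of z_{t+1} = A z_t + B u_t
   with u_t white of identity covariance; it has exactly one solution when the
   spectral radius of A is less than 1. *)
Definition stationary_cov n m (A : 'M[R]_n) (B : 'M[R]_(n, m))
    (Sigma : 'M[R]_n) : Prop :=
  Sigma = A *m Sigma *m A^T + B *m B^T.

End LinearAlgebra.

Section Noise.
Context {d : measure_display} {T : measurableType d} {R : realType}.
Variable P : probability T R.

Definition random_vector n (X : T -> 'cV[R]_n) : Prop :=
  forall i, measurable_fun [set: T] (fun om => X om i 0).

(* The law N(0, I_n) is the n-fold product of N(0, 1); as the rectangles
   generate the Borel sets of R^n and are stable under intersection, it is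
   enough to prescribe it on them. *)
Definition std_gaussian n (X : T -> 'cV[R]_n) : Prop :=
  random_vector X /\
  forall B : 'I_n -> set R, (forall i, measurable (B i)) ->
    P [set om | forall i, B i (X om i 0)] =
    (\prod_(i < n) normal_prob 0 1 (B i))%E.

Definition sigma_vec n (X : T -> 'cV[R]_n) : set (set T) :=
  <<s [set E | exists i (B : set R),
         measurable B /\ E = [set om | B (X om i 0)]] >>.

Definition mutually_independent (I : choiceType) (F : I -> set (set T)) : Prop :=
  forall (J : {fset I}) (E : I -> set T),
    (forall j, j \in J -> F j (E j)) ->
    P (\bigcap_(j in [set` J]) E j) = (\prod_(j <- J) P (E j))%E.

Definition iid_std_gaussian_noises n p
    (w : nat -> T -> 'cV[R]_n) (v : nat -> T -> 'cV[R]_p) : Prop :=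
  [/\ forall t, std_gaussian (w t),
      forall t, std_gaussian (v t) &
      mutually_independent (fun k : nat + nat =>
        match k with inl t => sigma_vec (w t) | inr t => sigma_vec (v t) end)].

End Noise.

Section System.
Context {R : realType} {dx dy : nat}.
Variables (A Bw : 'M[R]_dx) (C : 'M[R]_(dy, dx)) (Dv : 'M[R]_dy).

Fixpoint state {T : Type} (w : nat -> T -> 'cV[R]_dx) (t : nat) (om : T)
    : 'cV[R]_dx :=
  if t is s.+1 then A *m state w s om + Bw *m w s om else 0.

Definition output {T : Type} (w : nat -> T -> 'cV[R]_dx)
    (v : nat -> T -> 'cV[R]_dy) (t : nat) (om : T) : 'cV[R]_dy :=
  C *m state w t om + Dv *m v t om.

Definition innovation_cov (S : 'M[R]_dx) : 'M[R]_dy :=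
  C *m S *m C^T + Dv *m Dv^T.

Definition kalman_gain (S : 'M[R]_dx) : 'M[R]_(dx, dy) :=
  A *m S *m C^T *m invmx (innovation_cov S).

Definition stabilizing_riccati (S : 'M[R]_dx) : Prop :=
  [/\ S^T = S,
      innovation_cov S \in unitmx,
      S = A *m S *m A^T
          - A *m S *m C^T *m invmx (innovation_cov S) *m C *m S *m A^T
          + Bw *m Bw^T &
      spectral_radius (A - kalman_gain S *m C) < 1].

Definition Phi_mx (H : nat) (K : 'M[R]_(dx, dy)) :
    'M[R]_(\sum_(i < H) dy, dx) :=
  \mxcol_(i < H) (C *m A ^+ i *m (A - K *m C)).

Definition Gstar_mx (H : nat) (K : 'M[R]_(dx, dy)) :
    'M[R]_(\sum_(i < H) dy, dy) :=
  \mxcol_(i < H) (C *m A ^+ i *m K).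

Definition Gamma_mx (H : nat) (K : 'M[R]_(dx, dy)) (De : 'M[R]_dy) :
    'M[R]_(\sum_(i < H) dy, \sum_(j < H) dy) :=
  \mxblock_(i < H, j < H)
    (if (j < i)%N then C *m A ^+ (i - j - 1) *m K *m De
     else if i == j then De else 0).

End System.

Section Prediction.
Context {R : realType} {dy : nat}.

Definition power_stack (H : nat) (F : 'M[R]_dy) :
    'M[R]_(\sum_(i < H) dy, dy) :=
  \mxcol_(i < H) (F ^+ i.+1).

Definition lsq_cost (y : nat -> 'cV[R]_dy) (N : nat) (F : 'M[R]_dy) : R :=
  \sum_(1 <= t < N) euclidean_norm (y t.+1 - F *m y t) ^+ 2.

Definition lsq_minimizer (y : nat -> 'cV[R]_dy) (N : nat) (F : 'M[R]_dy) :
    Prop :=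
  forall F' : 'M[R]_dy, lsq_cost y N F <= lsq_cost y N F'.

Definition future {T : Type} (y : nat -> T -> 'cV[R]_dy) (H t : nat) (om : T) :
    'cV[R]_(\sum_(i < H) dy) :=
  \mxcol_(i < H) y (t + i.+1)%N om.

(* The term n = 0 of the sequence is 0 since 0^-1 = 0; it does not affect the
   limit. *)
Definition loss {d : measure_display} {T : measurableType d}
    (P : probability T R) (y : nat -> T -> 'cV[R]_dy) (H : nat)
    (G : 'M[R]_(\sum_(i < H) dy, dy)) : \bar R :=
  limn (fun n : nat =>
    'E_P[fun om => (n%:R^-1 *
      \sum_(0 <= t < n.+1)
        euclidean_norm (future y H t om - G *m y t om) ^+ 2)%R])%E.

End Prediction.

(* Main.v *)
(* The loss of an H-step predictor G is an explicit quadratic function of G, and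
   rewriting it in the innovations form gives the right-hand side for
   the stack of powers of F = C A Sigma_x C^T Sigma_y^-1.  It remains to see that
   the least-squares matrix converges to F strongly enough for the losses, which
   are polynomials in it, to converge in mean.  With E_n the average of
   (y_(t+1) - F y_t) y_t^T and lambda_n a lower bound for the empirical Gram
   matrix, minimality gives |Ghat - F| <= const |E_n| / lambda_n.  As F makes
   (y_(t+1) - F y_t) y_t^T centred under the stationary law, E_n tends to 0 in
   mean square with bounded moments of all orders.  All moments of 1 / lambda_n
   stay bounded: cut the data into L blocks of d_y consecutive outputs; as every
   noise entry has a bounded density conditionally on the others, the product
   over the blocks of |det|^(-1/2) has expectation at most c^(d_y L), and the
   arithmetic-geometric mean inequality turns this into a moment bound for the
   inverse of the average of the squared determinants, of an order proportional
   to L.  Ghat need not be measurable, so its loss is squeezed between measurable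
   functions. *)
Require Import Defs.
From mathcomp Require Import all_boot all_order all_algebra.
From mathcomp Require Import finmap complex.
From mathcomp Require Import all_classical all_reals all_analysis.
From mathcomp Require Import measurable_realfun.
From mathcomp Require Import ring lra.
Import Order.TTheory GRing.Theory Num.Theory.
Import numFieldNormedType.Exports.

Set Implicit Arguments.
Unset Strict Implicit.
Unset Printing Implicit Defensive.

Local Open Scope classical_set_scope.
Local Open Scope ring_scope.

(** * Powers of a matrix of spectral radius less than one *)

(** The losses have degree [2H] in an unbounded estimator, so convergence in probability would not
    control their means; this is what calls for inverse moments of every order. A single block gives
    little: conditionally on the other entries its determinant is affine in one noise entry, and
    |x|^(-s) is integrable near 0 only for s < 1, whence the exponent 1/2. Integrating out the
    corner entry of a leading minor of order j + 1 leaves the minor of order j and a constant factor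
    c, hence c^(d_y L) for L blocks; high orders come from letting L grow with N. The entries
    integrated out belong to v, after multiplying the outputs by [Dv^-1]: the states do not involve
    v, so the blocks can be peeled off one after the other. Stability enters as summability of the
    powers of A in an entrywise norm. It yields a perturbation bound for the Lyapunov equation
    which, applied outcome by outcome to the empirical state covariance, takes the place of an
    ergodic theorem and copes with the non-stationary start at 0. *)

Section entry_sum_norm.
Variable K : numDomainType.

(** The scalars are a general numeric domain because powers are first bounded over the complex
    numbers, where the characteristic polynomial splits, and only then over the reals. *)
Definition nm m n (A : 'M[K]_(m, n)) : K := \sum_i \sum_j `|A i j|.

Lemma nm_ge0 m n (A : 'M[K]_(m, n)) : 0 <= nm A.
Proof. by apply: sumr_ge0 => i _; apply: sumr_ge0. Qed.

Lemma nm0 m n : nm (0 : 'M[K]_(m, n)) = 0.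
Proof. by rewrite /nm big1// => i _; rewrite big1// => j _; rewrite mxE normr0. Qed.

Lemma ler_nm m n (A : 'M[K]_(m, n)) i j : `|A i j| <= nm A.
Proof.
rewrite /nm (bigD1 i)//= (bigD1 j)//= -addrA lerDl addr_ge0//; apply: sumr_ge0 => // *.
by apply: sumr_ge0.
Qed.

Lemma ler_nmD m n (A B : 'M[K]_(m, n)) : nm (A + B) <= nm A + nm B.
Proof.
rewrite /nm -big_split; apply: ler_sum => i _; rewrite -big_split.
by apply: ler_sum => j _; rewrite mxE ler_normD.
Qed.

Lemma nmN m n (A : 'M[K]_(m, n)) : nm (- A) = nm A.
Proof. by apply: eq_bigr => i _; apply: eq_bigr => j _; rewrite mxE normrN. Qed.

Lemma nmZ m n a (A : 'M[K]_(m, n)) : nm (a *: A) = `|a| * nm A.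
Proof.
rewrite /nm mulr_sumr; apply: eq_bigr => i _; rewrite mulr_sumr.
by apply: eq_bigr => j _; rewrite mxE normrM.
Qed.

Lemma nm_tr m n (A : 'M[K]_(m, n)) : nm A^T = nm A.
Proof.
rewrite /nm exchange_big; apply: eq_bigr => i _; apply: eq_bigr => j _.
by rewrite mxE.
Qed.

Lemma ler_nm_sum (I : Type) (r : seq I) (P : pred I) m n (F : I -> 'M[K]_(m, n)) :
  nm (\sum_(i <- r | P i) F i) <= \sum_(i <- r | P i) nm (F i).
Proof.
elim/big_ind2: _ => [|A a B b ? ?|//]; first by rewrite nm0.
by rewrite (le_trans (ler_nmD _ _))// lerD.
Qed.

Lemma ler_nmM m n p (A : 'M[K]_(m, n)) (B : 'M[K]_(n, p)) :
  nm (A *m B) <= nm A * nm B.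
Proof.
rewrite /nm mulr_suml; apply: ler_sum => i _.
apply: (@le_trans _ _ (\sum_j \sum_k `|A i k| * `|B k j|)).
  apply: ler_sum => j _; rewrite mxE (le_trans (ler_norm_sum _ _ _))//.
  by apply: ler_sum => k _; rewrite normrM.
rewrite exchange_big mulr_suml; apply: ler_sum => k _.
rewrite -mulr_sumr ler_wpM2l//= [leRHS](bigD1 k)//= lerDl.
by apply: sumr_ge0 => *; apply: sumr_ge0.
Qed.

Lemma ler_mxtrace_nm n (A : 'M[K]_n) : `|\tr A| <= nm A.
Proof.
rewrite /mxtrace /nm (le_trans (ler_norm_sum _ _ _))//; apply: ler_sum => i _.
by rewrite (bigD1 i)//= lerDl; apply: sumr_ge0.
Qed.

End entry_sum_norm.

Section power_summability.

(* [M_z = (A - z) Q] satisfies [A ^ k.+1 Q = A ^ k M_z + z A ^ k Q], so that a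
   factor [X - z] with [|z| < 1] can be removed from an annihilating polynomial
   at the cost of a factor [1 / (1 - |z|)]. *)
Lemma split_annihilator_power_bound (K : numFieldType) n (A Q : 'M[K]_n.+1)
    (s : seq K) :
  all (fun z => `|z| < 1) s ->
  horner_mx A (\prod_(z <- s) ('X - z%:P)) *m Q = 0 ->
  exists S : K, forall k, \sum_(i < k) nm (A ^+ i *m Q) <= S.
Proof.
elim: s Q => [|z s IHs] Q /=.
  move=> _; rewrite big_nil rmorph1 mul1mx => ->; exists 0 => k.
  by rewrite big1// => i _; rewrite mulmx0 nm0.
move=> /andP[z1 s1]; rewrite big_cons mulrC rmorphM/= -mulmxE -mulmxA.
move=> /(IHs _ s1)[S' S'P].
set Q' := horner_mx A ('X - z%:P) *m Q in S'P.
have Q'E i : A ^+ i.+1 *m Q = A ^+ i *m Q' + z *: (A ^+ i *m Q).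
  rewrite /Q' rmorphB/= horner_mx_X horner_mx_C mulmxBl mulmxBr.
  by rewrite mul_scalar_mx -scalemxAr subrK mulmxA exprSr.
have z1' : 0 < 1 - `|z| by rewrite subr_gt0.
exists ((nm Q + S') / (1 - `|z|)).
have S'0 : 0 <= S' by have := S'P 0%N; rewrite big_ord0.
elim=> [|k IHk]; first by rewrite big_ord0 divr_ge0 ?(ltW z1')// addr_ge0 ?nm_ge0.
rewrite big_ord_recl/= expr0 mul1mx.
have -> : (nm Q + S') / (1 - `|z|) =
    nm Q + (S' + `|z| * ((nm Q + S') / (1 - `|z|))).
  set t := _ / _; have tE : t * (1 - `|z|) = nm Q + S' by rewrite divfK ?gt_eqF.
  by rewrite addrA -tE mulrBr mulr1 (mulrC t `|z|) subrK.
rewrite lerD2l; apply: le_trans (lerD (S'P k) (ler_wpM2l (normr_ge0 z) IHk)).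
rewrite mulr_sumr -big_split; apply: ler_sum => i _ /=.
by rewrite -nmZ (Q'E i) ler_nmD.
Qed.

Variable R : realType.

(** By Cayley-Hamilton the complex characteristic polynomial annihilates the matrix, and its roots
    are the eigenvalues, all of modulus below 1. This bound on partial sums is the only form in
    which the stability of [A] is used later. *)
Lemma spectral_radius_power_bound n (A : 'M[R]_n) : spectral_radius A < 1 ->
  exists S : R, forall k, \sum_(i < k) nm (A ^+ i) <= S.
Proof.
case: n A => [|n] A rA.
  by exists 0 => k; rewrite big1// => i _; rewrite /nm big_ord0.
pose B := map_mx (real_complex R) A.
have [s sE] := closed_field_poly_normal (char_poly B).
rewrite (monicP (char_poly_monic B)) scale1r in sE.
have s1 : all (fun z => `|z| < 1) s.
  apply/allP => z zs.
  have ez w : eigenvalue B w = (w \in s).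
    by rewrite eigenvalue_root_char sE root_prod_XsubC.
  suff : Normc.normc z < 1.
    by move=> z1; rewrite normc_def; move: z1; case: (z) => a b /=; rewrite ltcR.
  apply: le_lt_trans rA; apply: ub_le_sup; last by exists z => //=; rewrite ez.
  have nge0 w : 0 <= Normc.normc w :> R by case: (w) => a b; exact: sqrtr_ge0.
  (* The supremum dominates its elements only for a bounded set; the sum of the moduli of all roots
     is a bound. *)
  exists (\sum_(w <- s) Normc.normc w) => y [w /=]; rewrite ez => ws <-.
  by rewrite (big_rem w)//= lerDl; apply: sumr_ge0.
have H0 : horner_mx B (\prod_(z <- s) ('X - z%:P)) *m 1%:M = 0.
  by rewrite -sE Cayley_Hamilton mul0mx.
have [S SP] := split_annihilator_power_bound s1 H0.
exists (complex.Re S) => k; have := SP k.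
rewrite (eq_bigr (fun i : 'I_k => (nm (A ^+ i))%:C%C)) => [|i _]; last first.
  rewrite mulmx1 /B -rmorphXn /nm rmorph_sum; apply: eq_bigr => a _.
  rewrite rmorph_sum; apply: eq_bigr => b _; rewrite mxE.
  by rewrite normc_def /= expr0n addr0 sqrtr_sqr.
by rewrite -rmorph_sum /=; case: (S) => a b; rewrite lecE /= => /andP[].
Qed.

End power_summability.

(** * Gaussian integrals *)

Section normal_density.
Context {R : realType}.
Local Notation mu := (@lebesgue_measure R).
Local Open Scope ereal_scope.

Import HBNNSimple.

(** Indicators are covered by the definition of the normal law, simple functions follow by
    linearity, and monotone convergence on both sides gives [f]. *)
Lemma ge0_integral_normal (m s : R) (f : measurableTypeR R -> \bar R) :
  measurable_fun setT f -> (forall x, 0 <= f x) ->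
  \int[normal_prob m s]_x f x = \int[mu]_x (f x * (normal_pdf m s x)%:E).
Proof.
move=> mf f0.
have mpdf := measurable_normal_pdf m s.
have pdf0 x : (0 <= (normal_pdf m s x)%:E) by rewrite lee_fin normal_pdf_ge0.
pose g := nnsfun_approx measurableT mf.
have gf x : (fun n => (g n x)%:E) @ \oo --> f x by exact: cvg_nnsfun_approx.
have g_nd x : {homo (fun n => (g n x)%:E) : a b / (a <= b)%N >-> a <= b}.
  by move=> a b ab; rewrite lee_fin; exact/lefP/nd_nnsfun_approx.
have term0 n y x : 0 <= y%:E * (\1_(g n @^-1` [set y]) x)%:E.
  rewrite indicE; case: (boolP (x \in _)) => [|_]; last by rewrite mule0.
  by rewrite inE => /= <-; rewrite mule1 lee_fin fun_ge0.
have gE n : \int[normal_prob m s]_x (g n x)%:E =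
    \int[mu]_x ((g n x)%:E * (normal_pdf m s x)%:E).
  rewrite integralT_nnsfun sintegralE.
  transitivity (\int[mu]_x (\sum_(y \in range (g n))
      (y%:E * (\1_(g n @^-1` [set y]) x)%:E * (normal_pdf m s x)%:E))).
    rewrite ge0_integral_fsum//; last 2 first.
      move=> y; apply: emeasurable_funM; last exact/measurable_EFinP.
      apply: emeasurable_funM => //; apply/measurable_EFinP.
      exact: measurable_indic.
      by move=> y x _; rewrite mule_ge0// term0.
    apply: eq_fsbigr => y; rewrite inE => -[t _ tE].
    rewrite /normal_prob -ge0_integralZl//; last 2 first.
      by apply: measurable_funTS; exact/measurable_EFinP.
      by rewrite -tE lee_fin fun_ge0.
    rewrite [LHS]integral_mkcond.
    apply: eq_integral => x _; rewrite patchE indicE -muleA.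
    by case: ifPn => _; rewrite ?mul1e// mul0e mule0.
  apply: eq_integral => x _.
  rewrite -ge0_mule_fsuml; last by move=> y; exact: term0.
  by congr (_ * _); rewrite fsumEFin// -fimfunE.
transitivity (limn (fun n => \int[normal_prob m s]_x (g n x)%:E)).
  rewrite -monotone_convergence//.
  - by apply: eq_integral => x _; apply/esym/cvg_lim.
  - by move=> n; exact/measurable_EFinP.
  - by move=> n x _; rewrite lee_fin fun_ge0.
rewrite [X in limn X](_ : _ = fun n =>
    \int[mu]_x ((g n x)%:E * (normal_pdf m s x)%:E)); last exact/funext.
rewrite -monotone_convergence//.
- apply: eq_integral => x _; apply/cvg_lim => //; apply: cvgeZr => //.
- by move=> n; apply: emeasurable_funM; exact/measurable_EFinP.
- by move=> n x _; rewrite mule_ge0// lee_fin fun_ge0.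
- by move=> x _ a b ab; rewrite lee_wpmul2r// g_nd.
Qed.

End normal_density.

Section normal_moments.
Context {R : realType}.
Local Notation gam := (@normal_prob R 0 1).
Local Notation mR := (measurableTypeR R).

Let normal_pdf01 x : normal_pdf 0 1 x = normal_peak 1 * expR (- x ^+ 2 / 2) :> R.
Proof. by rewrite normal_pdfE ?oner_eq0// /normal_fun subr0 expr1n. Qed.

Let mpdf m s : measurable_fun [set: mR] (normal_pdf m s : mR -> R).
Proof. exact: measurable_normal_pdf. Qed.

Let mexpr n : measurable_fun [set: mR] (fun x : mR => x ^+ n : R).
Proof. exact: exprn_measurable. Qed.

Let mexpR (h : R) : measurable_fun [set: mR] (fun x : mR => expR (h * x) : R).
Proof. by apply: measurableT_comp => //; exact: mulrl_measurable. Qed.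

Let mexpR2 (k : R) :
  measurable_fun [set: mR] (fun x : mR => expR (k * x ^+ 2) : R).
Proof. by apply: measurableT_comp => //; apply: measurable_funM => //; exact: mexpr. Qed.

(** Completing the square: the integrand times the standard density is [expR (h ^+ 2 / 2)] times the
    density of mean [h] and variance 1. *)
Lemma integral_expR_normal (h : R) :
  (\int[gam]_x (expR (h * x))%:E = (expR (h ^+ 2 / 2))%:E)%E.
Proof.
rewrite ge0_integral_normal; last 2 first.
- apply/measurable_EFinP; apply: measurableT_comp => //.
- by move=> x; rewrite lee_fin expR_ge0.
under eq_integral => x _.
  rewrite -EFinM normal_pdf01.
  rewrite (_ : expR _ * _ = expR (h ^+ 2 / 2) * normal_pdf h 1 x); last first.
    rewrite normal_pdfE ?oner_eq0//= /normal_fun [LHS]mulrCA [RHS]mulrCA -!expRD.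
    by congr (_ * expR _); rewrite expr1n; field.
  rewrite EFinM; over.
rewrite ge0_integralZl_EFin//; first by rewrite integral_normal_pdf mule1.
- by move=> x _; rewrite lee_fin normal_pdf_ge0.
- by apply/measurable_EFinP; exact: mpdf.
Qed.

(** The integrand times the standard density is [r^-1] times the centred normal density of standard
    deviation [r^-1]. *)
Lemma integral_expR_sqr_normal (r : R) : 0 < r ->
  (\int[gam]_x (expR ((1 - r ^+ 2) / 2 * x ^+ 2))%:E = r^-1%:E)%E.
Proof.
move=> r0; rewrite ge0_integral_normal; last 2 first.
- apply/measurable_EFinP; apply: measurableT_comp => //.
  by apply: measurable_funM => //; exact: (mexpr _).
- by move=> x; rewrite lee_fin expR_ge0.
have r'0 : r^-1 != 0 by rewrite invr_eq0 gt_eqF.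
under eq_integral => x _.
  rewrite -EFinM normal_pdf01.
  rewrite (_ : expR _ * _ = r^-1 * normal_pdf 0 r^-1 x); last first.
    rewrite normal_pdfE//= /normal_fun [LHS]mulrCA -expRD [RHS]mulrA; congr (_ * expR _).
      rewrite /normal_peak expr1n mul1r -mulrnAr sqrtrM ?sqr_ge0// sqrtr_sqr.
      by rewrite invfM ger0_norm ?invr_ge0 ?ltW// invrK mulKf ?gt_eqF.
    by field; rewrite gt_eqF.
  rewrite EFinM; over.
rewrite ge0_integralZl_EFin//; first by rewrite integral_normal_pdf mule1.
- by move=> x _; rewrite lee_fin normal_pdf_ge0.
- by apply/measurable_EFinP; exact: mpdf.
- by rewrite invr_ge0 ltW.
Qed.

Lemma exprn_le_expRD (x : R) n : `|x| ^+ n <= n`!%:R * (expR x + expR (- x)).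
Proof.
have xn : `|x| ^+ n <= n`!%:R * expR `|x|.
  case: n => [|n]; first by rewrite expr0 mul1r -[leLHS]expR0 ler_expR.
  rewrite mulrC -ler_pdivrMr ?ltr0n ?fact_gt0//.
  by rewrite (le_trans _ (expR_ge1Dxn n (normr_ge0 x)))// lerDr.
apply: le_trans xn _; rewrite ler_wpM2l//.
by case: (ger0P x) => _; rewrite ?lerDl ?lerDr expR_ge0.
Qed.

Lemma normal_integrable_exprn n :
  gam.-integrable setT (fun x : mR => (x ^+ n)%:E).
Proof.
apply/integrableP; split; first by apply/measurable_EFinP; exact: (mexpr _).
apply: (@le_lt_trans _ _ (\int[gam]_x
    (n`!%:R%:E * ((expR (1 * x))%:E + (expR (-1 * x))%:E)))%E).
  apply: ge0_le_integral => //=.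
  - by apply/measurable_EFinP; exact: (measurableT_comp _ (mexpr n)).
  - by apply: emeasurable_funM => //; apply: emeasurable_funD;
      apply/measurable_EFinP; exact: mexpR.
  - by move=> x _; rewrite -EFinD -EFinM lee_fin normrX mul1r mulN1r exprn_le_expRD.
rewrite ge0_integralZl_EFin//; last 2 first.
- by move=> x _; rewrite adde_ge0// lee_fin expR_ge0.
- by apply: emeasurable_funD; apply/measurable_EFinP; exact: mexpR.
rewrite ge0_integralD//.
- by rewrite !integral_expR_normal -EFinD -EFinM ltry.
- by apply/measurable_EFinP; exact: mexpR.
- by apply/measurable_EFinP; exact: mexpR.
Qed.

(** The mean and the variance are extracted from the two exponential integrals by integrating 1 + y
    <= exp y, without differentiating under the integral sign. *)
Let normal_expr_le (n : nat) (k : R) (f : R -> R) (c : R) :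
  (forall x, 1 + k * x ^+ n <= f x) -> (forall x, 0 <= f x) ->
  measurable_fun [set: mR] (f : mR -> R) -> (\int[gam]_x (f x)%:E = c%:E)%E ->
  1 + k * fine (\int[gam]_x (x ^+ n)%:E)%E <= c.
Proof.
move=> kf f0 mf fE.
have ik : gam.-integrable setT (fun x : mR => (k * x ^+ n)%:E).
  exact: integrableZl (normal_integrable_exprn n).
have i1 : gam.-integrable setT (fun x : mR => (1 : R)%:E).
  exact: finite_measure_integrable_cst.
have if_ : gam.-integrable setT (fun x : mR => (f x)%:E).
  apply/integrableP; split; first exact/measurable_EFinP.
  by under eq_integral do rewrite gee0_abs ?lee_fin//; rewrite fE ltry.
rewrite -lee_fin -fE EFinD EFinM fineK; last first.
  exact: integrable_fin_num (normal_integrable_exprn n).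
rewrite -(integralZl _ (normal_integrable_exprn n))//.
have {1}-> : 1%:E = (\int[gam]_x (1:R)%:E)%E :> \bar R.
  by rewrite integral_cst//= probability_setT mule1.
rewrite -integralD//; apply: le_integral => //; first exact: integrableD.
by move=> x _; rewrite -EFinD lee_fin.
Qed.

Lemma normal_mean : (\int[gam]_x x%:E = 0)%E.
Proof.
have mfin : (\int[gam]_x x%:E)%E \is a fin_num.
  exact: integrable_fin_num (normal_integrable_exprn 1).
rewrite -(fineK mfin); congr _%:E; set m := fine _.
have mh h : 1 + h * m <= expR (h ^+ 2 / 2).
  apply: (normal_expr_le (n := 1) _ _ _ (integral_expR_normal h)) => [x|x|].
  - exact: expR_ge1Dx.
  - exact: expR_ge0.
  - by apply: measurableT_comp => //; exact: measurable_funM.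
(* [exp y <= 1 / (1 - y)] turns [mh], at a small multiple [t] of [m], into a
   polynomial inequality which forces [m ^ 2 = 0] *)
pose t := (1 + m ^+ 2)^-1.
have d0 : 0 < 1 + m ^+ 2 by rewrite ltr_pwDl// sqr_ge0.
have t0 : 0 < t by rewrite invr_gt0.
have tE : t * (1 + m ^+ 2) = 1 by rewrite mulVf// gt_eqF.
pose u := t * m ^+ 2.
have u0 : 0 <= u by rewrite mulr_ge0 ?sqr_ge0// ltW.
have tu : t = 1 - u by rewrite /u -tE; ring.
have yE : (t * m) ^+ 2 / 2 = (1 - u) * u / 2 by rewrite -tu /u; ring.
have := mh (t * m); rewrite yE -(mulrA t m m) -/u; set y := _ / 2 => mhy.
have y1 : 0 < 1 - y by rewrite /y; nra.
have : (1 + u) * (1 - y) <= 1.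
  apply: le_trans (ler_wpM2r (ltW y1) mhy) _.
  rewrite -[leRHS](expRxMexpNx_1 y) ler_wpM2l ?expR_ge0//.
  exact: expR_ge1Dx.
rewrite /y => H; have {H} ule0 : u <= 0 by nra.
have /eqP : u = 0 by apply/eqP; rewrite eq_le ule0.
by rewrite mulf_eq0 gt_eqF//= sqrf_eq0 => /eqP.
Qed.

(** Taking y = (1 - r^2) x^2 / 2 in 1 + y <= exp y and clearing denominators gives (1 - r)(1 + r) r
    q <= 2 (1 - r) for the second moment q. Values of r just below 1 bound q from above, values just
    above 1 from below. *)
Lemma normal_variance : (\int[gam]_x (x ^+ 2)%:E = 1)%E.
Proof.
have qfin : (\int[gam]_x (x ^+ 2)%:E)%E \is a fin_num.
  exact: integrable_fin_num (normal_integrable_exprn 2).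
rewrite -(fineK qfin); congr _%:E; set q := fine _.
have q0 : 0 <= q.
  by apply: fine_ge0; apply: integral_ge0 => x _; rewrite lee_fin sqr_ge0.
have qr r : 0 < r -> 1 + (1 - r ^+ 2) / 2 * q <= r^-1.
  move=> r0.
  apply: (normal_expr_le (n := 2) _ _ _ (integral_expR_sqr_normal r0)) => [x|x|].
  - exact: expR_ge1Dx.
  - exact: expR_ge0.
  - exact: mexpR2.
have {}qr r : 0 < r -> (1 - r) * ((1 + r) * r * q) <= (1 - r) * 2.
  move=> r0; have := qr r r0; rewrite -(ler_pM2l r0) mulfV ?gt_eqF// => H; nra.
apply/eqP; rewrite eq_le; apply/andP; split; apply/ler_addgt0Pr => e e0.
- pose d := e / (3 * (1 + e)).
  have e1 : 0 < 1 + e by lra.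
  have dE : d * (1 + e) = e / 3 by rewrite /d invfM mulrA mulfVK// gt_eqF.
  have d0 : 0 < d by rewrite divr_gt0// mulr_gt0.
  have d1 : d < 1 / 3 by nra.
  have r0 : 0 < 1 - d by lra.
  have := qr _ r0; rewrite opprB addrCA subrr addr0 ler_pM2l// => H.
  rewrite leNgt; apply/negP => qe.
  have : (2 - 3 * d) * q <= 2.
    by apply: le_trans H; rewrite ler_wpM2r//; nra.
  by rewrite leNgt => /negP; apply; nra.
- pose d := e / 4; have d0 : 0 < d by rewrite divr_gt0.
  rewrite leNgt; apply/negP => qe.
  have r0 : 0 < 1 + d by rewrite ltr_pwDl// ltW.
  have := qr _ r0; rewrite opprD addrA subrr sub0r !mulNr lerN2 ler_pM2l// => H.
  have d1 : d < 1 / 4 by rewrite /d; lra.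
  have : 2 <= (2 + 4 * d) * q.
    by apply: le_trans H _; rewrite ler_wpM2r//; nra.
  by rewrite leNgt => /negP; apply; rewrite /d; nra.
Qed.

(** Centredness and variance of [h] are packed into one Pythagorean identity valid for all [u] and
    [a]; it is the hypothesis that the conditioning and martingale lemmas put on [h]. *)
Lemma integral_normal_sqrD (h : R -> R) (s u a : R) :
  gam.-integrable setT (fun x : mR => (h x)%:E) ->
  gam.-integrable setT (fun x : mR => (h x ^+ 2)%:E) ->
  (\int[gam]_x (h x)%:E = 0)%E -> (\int[gam]_x (h x ^+ 2)%:E = s%:E)%E ->
  (\int[gam]_x ((u + a * h x) ^+ 2)%:E = (u ^+ 2 + a ^+ 2 * s)%:E)%E.
Proof.
move=> ih ih2 h0 hs.
under eq_integral => x _.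
  rewrite (_ : _ ^+ 2 = (u ^+ 2 + (u * a *+ 2) * h x) + a ^+ 2 * h x ^+ 2); last ring.
  rewrite EFinD EFinD (EFinM _ (h x)) (EFinM _ (_ ^+ 2)); over.
have iu : gam.-integrable setT (fun x : mR => (u ^+ 2)%:E).
  exact: finite_measure_integrable_cst.
have i1 k : gam.-integrable setT (fun x : mR => k%:E * (h x)%:E)%E.
  exact: integrableZl.
have i2 k : gam.-integrable setT (fun x : mR => k%:E * (h x ^+ 2)%:E)%E.
  exact: integrableZl.
rewrite integralD//; last exact: integrableD.
rewrite integralD// !integralZl// h0 hs mule0 adde0 integral_cst//=.
by rewrite probability_setT mule1.
Qed.

(** Here [s] is the variance of the square of a standard normal variable. The diagonal entries of
    the empirical noise covariance need this identity, as the others need the one for [x] itself. *)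
Lemma normal_centred_sqr : exists s : R, forall u a : R,
  (\int[gam]_x ((u + a * (x ^+ 2 - 1)) ^+ 2)%:E = (u ^+ 2 + a ^+ 2 * s)%:E)%E.
Proof.
have i1 : gam.-integrable setT (fun x : mR => (1 : R)%:E).
  exact: finite_measure_integrable_cst.
have ih2 : gam.-integrable setT (fun x : mR => ((x ^+ 2 - 1) ^+ 2)%:E).
  rewrite (_ : (fun _ => _) = (fun x : mR => (x ^+ 4)%:E +
      ((- (2 : R))%:E * (x ^+ 2)%:E + 1%:E))%E); last first.
    by apply/funext => x; rewrite -EFinM -!EFinD; congr _%:E; ring.
  apply: integrableD => //; first exact: (normal_integrable_exprn 4).
  apply: integrableD => //; apply: integrableZl => //.
  exact: (normal_integrable_exprn 2).
exists (fine (\int[gam]_x ((x ^+ 2 - 1) ^+ 2)%:E)%E) => u a.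
have ih : gam.-integrable setT (fun x : mR => (x ^+ 2 - 1)%:E).
  under eq_fun do rewrite EFinB.
  by apply: integrableB => //; exact: (normal_integrable_exprn 2).
apply: integral_normal_sqrD => //; last first.
  by rewrite fineK//; exact: integrable_fin_num ih2.
under eq_integral do rewrite EFinB.
rewrite integralB//; last exact: (normal_integrable_exprn 2).
by rewrite normal_variance integral_cst//= probability_setT mule1 subee.
Qed.

Lemma integral_normal_sqr_affine (u a : R) :
  (\int[gam]_x ((u + a * x) ^+ 2)%:E = (u ^+ 2 + a ^+ 2)%:E)%E.
Proof.
rewrite -[a ^+ 2]mulr1; apply: (@integral_normal_sqrD id).
- exact: (normal_integrable_exprn 1).
- exact: (normal_integrable_exprn 2).
- exact: normal_mean.
- exact: normal_variance.
Qed.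

End normal_moments.

(** * Integrability of inverse square roots under the normal law *)

Section inverse_square_root.
Context {R : realType}.
Local Notation gam := (@normal_prob R 0 1).
Local Notation mR := (measurableTypeR R).

(** The value at 0 is infinite, unlike that of [^-1], so that a finite integral forces the argument
    to be almost surely nonzero. *)
Definition invsqrt (u : R) : \bar R :=
  if u == 0 then +oo%E else ((Num.sqrt `|u|)^-1)%:E.

Lemma invsqrt_ge0 u : (0 <= invsqrt u)%E.
Proof. by rewrite /invsqrt; case: ifP => // _; rewrite lee_fin invr_ge0. Qed.

Lemma invsqrt1 : invsqrt 1 = 1%E.
Proof. by rewrite /invsqrt oner_eq0 normr1 sqrtr1 invr1. Qed.

Lemma invsqrtM u v : v != 0 -> invsqrt (u * v) = (invsqrt u * invsqrt v)%E.
Proof.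
move=> v0; rewrite /invsqrt mulf_eq0 (negPf v0) orbF.
have sv : (0 < (Num.sqrt `|v|)^-1) by rewrite invr_gt0 sqrtr_gt0 normr_gt0.
by case: ifP => u0; [rewrite gt0_mulye | rewrite normrM sqrtrM// invfM].
Qed.

Lemma measurable_invsqrt : measurable_fun [set: R] invsqrt.
Proof.
apply: measurable_fun_ifT => //.
  by apply: measurable_fun_eqr.
apply/measurable_EFinP.
rewrite (_ : (fun _ => _) = (@powR R) ^~ (- 2^-1) \o (fun x : R => `|x|)); last first.
  by apply/funext => x /=; rewrite powRN powR12_sqrt.
apply: measurableT_comp => //; exact: measurable_powR.
Qed.

(** Dyadic layers: on 4^-(k+1) < |u| <= 4^-k the inverse square root is at most 2^(k+1). They reduce
    its integral to probabilities of short intervals. *)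
Let term (k : nat) (u : R) : \bar R :=
  ((2 : R) ^+ k.+1 * \1_[set y : R | `|y| <= 4 ^- k] u)%:E.

Let term_ge0 k u : (0 <= term k u)%E.
Proof. by rewrite lee_fin mulr_ge0. Qed.

Let term_eq k u : `|u| <= 4 ^- k -> term k u = (2 ^+ k.+1)%:E.
Proof. by move=> uk; rewrite /term indicE mem_set// mulr1. Qed.

Let invsqrt_le_series u : (invsqrt u <= 1 + \sum_(0 <= k <oo) term k u)%E.
Proof.
have le1 k : (term k u <= 1 + \sum_(0 <= k <oo) term k u)%E.
  rewrite (@le_trans _ _ (\sum_(0 <= k <oo) term k u)%E)//; last first.
    by rewrite leeDr// lee_fin.
  rewrite (@nneseriesD1 _ _ k xpredT)// leeDl//.
  by apply: nneseries_ge0 => *; exact: term_ge0.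
rewrite /invsqrt; case: ifPn => [/eqP u0|u0].
  rewrite leye_eq; apply/eqP/eqyP => A A0.
  pose k := (Num.trunc A).+1.
  apply: le_trans (le1 k); rewrite term_eq ?u0 ?normr0 ?invr_ge0 ?exprn_ge0//.
  rewrite lee_fin ltW// (lt_le_trans (truncnS_gt _))//.
  rewrite -natrX ler_nat.
  by apply: (leq_trans (ltn_expl _ (isT : (1 < 2)%N))); rewrite leq_pexp2l// /k !leqW.
have [u1|u1] := lerP 1 `|u|.
  rewrite (@le_trans _ _ 1%E)// ?leeDl//; last first.
    by apply: nneseries_ge0 => *; exact: term_ge0.
  by rewrite lee_fin invf_le1 ?sqrtr_gt0 ?normr_gt0// -sqrtr1 ler_sqrt.
have ex : exists k, 4 ^- k.+1 < `|u|.
  exists (Num.trunc `|u|^-1); rewrite invf_plt ?posrE ?exprn_gt0 ?normr_gt0//.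
  rewrite (lt_le_trans (truncnS_gt _))// -natrX ler_nat.
  by apply: (leq_trans (ltn_expl _ (isT : (1 < 4)%N))); rewrite leq_pexp2l.
(* Minimality places [|u|] between 4^-(k+1) and 4^-k, so that the single term [k] suffices. *)
have [k ku kmin] := ex_minnP ex.
apply: le_trans (le1 k); rewrite term_eq; last first.
  case: k ku kmin => [|k] ku kmin; first by rewrite expr0 invr1 ltW.
  by rewrite leNgt; apply/negP => /kmin; rewrite ltnn.
rewrite lee_fin invf_ple ?posrE ?exprn_gt0 ?sqrtr_gt0 ?normr_gt0//.
rewrite -(@ler_pXn2r _ 2)// ?nnegrE ?invr_ge0 ?exprn_ge0 ?sqrtr_ge0//.
rewrite sqr_sqrtr// exprVn -exprM mulnC exprM ltW//.
by move: ku; rewrite (_ : 2 ^+ 2 = 4 :> R)// -natrX.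
Qed.

Lemma normal_prob_interval (c e : R) : 0 <= e ->
  (gam [set x : mR | `|(x + c)%R| <= e]%R <= (normal_peak 1 * (e *+ 2))%:E)%E.
Proof.
move=> e0.
have -> : [set x : mR | `|(x + c)%R| <= e]%R = `[- e - c, e - c]%classic.
  apply/seteqP; split => x /=; rewrite in_itv/= ler_norml.
    by move=> /andP[? ?]; apply/andP; split; lra.
  by move=> /andP[? ?]; apply/andP; split; lra.
rewrite /normal_prob.
apply: (@le_trans _ _ (\int[lebesgue_measure]_(x in `[(- e - c)%R, (e - c)%R])
    (normal_peak 1)%:E)%E).
  apply: ge0_le_integral => //=.
  - by move=> x _; rewrite lee_fin normal_pdf_ge0.
  - by apply/measurable_EFinP; apply: measurable_funTS; exact: measurable_normal_pdf.
  - by move=> x _; rewrite lee_fin normal_pdf_ub// oner_eq0.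
rewrite integral_cst//= lebesgue_measure_itv/= lte_fin; case: ifP => _.
  by rewrite -EFinB -EFinM lee_fin ler_wpM2l ?normal_peak_ge0// mulr2n; lra.
by rewrite mule0 lee_fin mulr_ge0 ?normal_peak_ge0// mulrn_wge0.
Qed.

(** The density bound gives the k-th layer at most 2^(k+1) * 2 * 4^-k = 4 * 2^-k times the peak,
    which sums to 8 times the peak; the summand 1 accounts for arguments of modulus at least 1. The
    bound does not depend on the shift. *)
Let integral_invsqrt_shift (c : R) :
  (\int[gam]_x invsqrt (x + c) <= (1 + 8 * normal_peak 1)%:E)%E.
Proof.
have mc : measurable_fun [set: mR] (fun x : mR => x + c : R).
  exact: measurable_funD.
have mterm k : measurable_fun [set: mR] (fun x : mR => term k (x + c)).
  apply/measurable_EFinP; apply: measurable_funM => //.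
  apply: (measurableT_comp _ mc); apply: measurable_indic.
  rewrite (_ : [set _ | _] = `[- 4 ^- k, 4 ^- k]%classic)//.
  by apply/seteqP; split => x /=; rewrite in_itv/= ler_norml.
apply: (@le_trans _ _
    (\int[gam]_x (1 + \sum_(0 <= k <oo) term k (x + c)%R))%E).
  apply: ge0_le_integral => //=.
  - by move=> x _; exact: invsqrt_ge0.
  - exact: (measurableT_comp measurable_invsqrt mc).
  - by apply: emeasurable_funD => //; apply: ge0_emeasurable_sum.
rewrite ge0_integralD//; last 2 first.
- by move=> x _; apply: nneseries_ge0 => *; exact: term_ge0.
- by apply: ge0_emeasurable_sum.
rewrite integral_cst//= probability_setT mule1 EFinD leeD2l//.
rewrite integral_nneseries//.
have := cvg_lim (@ereal_hausdorff R)
  (@cvg_geometric_eseries_half R (8 * normal_peak 1) 0).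
rewrite expr0 divr1 => <-; apply: lee_nneseries => [k _ _|k _].
  by apply: integral_ge0 => x _; exact: term_ge0.
have mA : measurable [set x : mR | `|(x + c)%R| <= 4 ^- k]%R.
  rewrite (_ : [set _ | _] = `[- 4 ^- k - c, 4 ^- k - c]%classic)//.
  apply/seteqP; split => x /=; rewrite in_itv/= ler_norml.
    by move=> /andP[? ?]; apply/andP; split; lra.
  by move=> /andP[? ?]; apply/andP; split; lra.
have indE : (fun x : mR => (\1_[set y : R | `|y| <= 4 ^- k] (x + c) : R)%:E) =
   fun x : mR => (\1_[set x : mR | `|(x + c)%R| <= 4 ^- k]%R x : R)%:E.
  by rewrite funeqE => x; rewrite !indicE; congr (_%:R)%:E.
rewrite /term; under eq_integral do rewrite EFinM.
rewrite ge0_integralZl_EFin ?exprn_ge0//; last first.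
  by rewrite indE; apply/measurable_EFinP; exact: measurable_indic.
rewrite indE.
rewrite integral_indic// setIT.
apply: le_trans (lee_wpmul2l _ (normal_prob_interval c _)) _.
- by rewrite lee_fin exprn_ge0.
- by rewrite invr_ge0 exprn_ge0.
rewrite -EFinM lee_fin le_eqVlt; apply/orP; left; apply/eqP.
have -> : (4 : R) ^+ k = 2 ^+ k * 2 ^+ k by rewrite -exprMn -natrM.
have -> : (2 ^ (k + 1))%:R = 2 * 2 ^+ k :> R by rewrite addn1 natrX exprS.
have k0 : (2 : R) ^+ k != 0 by rewrite expf_neq0.
by rewrite exprS; field.
Qed.

(** Factoring out [a] reduces to slope 1 and an arbitrary shift. For [a = 0] the right-hand side is
    infinite. *)
Lemma integral_normal_invsqrt (a b : R) :
  (\int[gam]_x invsqrt (a * x + b) <= (1 + 8 * normal_peak 1)%:E * invsqrt a)%E.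
Proof.
have [->|a0] := eqVneq a 0.
  rewrite {2}/invsqrt eqxx gt0_muley ?leey// lte_fin ltr_pwDl// mulr_ge0//.
  exact: normal_peak_ge0.
under eq_integral => x _.
  rewrite (_ : _ + _ = (x + b / a) * a); last by field.
  rewrite invsqrtM// muleC; over.
rewrite ge0_integralZl//; last 3 first.
- apply: (measurableT_comp measurable_invsqrt); exact: measurable_funD.
- by move=> x _; exact: invsqrt_ge0.
- exact: invsqrt_ge0.
by rewrite muleC lee_wpmul2r ?invsqrt_ge0.
Qed.

End inverse_square_root.

(** * Conditioning on all noise entries but one *)

Section freezing.
Context d (T : measurableType d) (R : realType) (P : probability T R).
Context (I : choiceType) (xi : I -> T -> R).
Local Notation gam := (@normal_prob R 0 1).
Local Notation mR := (measurableTypeR R).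

Definition iid_normal : Prop :=
  (forall k, measurable_fun setT (xi k)) /\
  forall (J : {fset I}) (B : I -> set R), (forall j, measurable (B j)) ->
    P (\bigcap_(j in [set` J]) xi j @^-1` B j) = (\prod_(j <- J) gam (B j))%E.

Definition off_cylinder (k : I) : set (set T) :=
  [set E | exists (J : {fset I}) (B : I -> set R),
    [/\ k \notin J, forall j, measurable (B j) &
        E = \bigcap_(j in [set` J]) xi j @^-1` B j]].

(* [T] with the sigma-algebra generated by the variables other than [xi k] *)
Definition off (k : I) := g_sigma_algebraType (off_cylinder k).

Hypothesis xiP : iid_normal.

Lemma off_cylinder_setI k : setI_closed (off_cylinder k).
Proof.
move=> _ _ [J1 [B1 [k1 m1 ->]]] [J2 [B2 [k2 m2 ->]]].
exists (J1 `|` J2)%fset, (fun j => (if j \in J1 then B1 j else setT) `&`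
  (if j \in J2 then B2 j else setT)); split.
- by rewrite in_fsetU negb_or k1.
- by move=> j; apply: measurableI; case: ifP.
- apply/seteqP; split => [om [H1 H2] j /= _|om H].
    by split; case: ifP => // jJ; [apply: H1 | apply: H2].
  split=> j /= jJ.
    by have [] := H j; rewrite /= ?in_fsetU ?jJ.
  by have [] := H j; rewrite /= ?in_fsetU ?jJ ?orbT.
Qed.

Lemma off_cylinder_setT k : off_cylinder k setT.
Proof.
exists fset0, (fun=> setT); split => //; apply/seteqP; split => // om _ j.
Qed.

Lemma off_cylinder_measurable k : off_cylinder k `<=` measurable.
Proof.
move=> _ [J [B [_ mB ->]]]; apply: fin_bigcap_measurable => [|j _].
  exact: finite_fset.
by rewrite -[X in measurable X]setTI; apply: (xiP.1 j).
Qed.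

Lemma measurable_off_id k : measurable_fun [set: T] (fun om : T => om : off k).
Proof.
apply: (@measurability _ _ _ (off k) _ _ (off_cylinder k)) => // _ [A kA <-].
by rewrite setTI; exact: off_cylinder_measurable kA.
Qed.

Lemma measurable_off_measurable k d' (U : measurableType d') (f : T -> U) :
  measurable_fun [set: off k] f -> measurable_fun [set: T] f.
Proof. by move=> mf; have := measurableT_comp mf (@measurable_off_id k). Qed.

Lemma measurable_off k j : j != k -> measurable_fun [set: off k] (xi j).
Proof.
move=> jk _ B mB; apply: sub_sigma_algebra; rewrite setTI.
exists [fset j]%fset, (fun=> B); split => //.
  by rewrite in_fset1 eq_sym.
apply/seteqP; split => [om Bom i /=|om /(_ j)]; first by rewrite in_fset1 => /eqP ->.
by apply; rewrite /= in_fset1.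
Qed.

(** Both sides are finite measures in [A]. They agree on the cylinders that do not constrain [k], by
    the product formula for the index set enlarged by [k]; those cylinders are stable under
    intersection and generate the sigma-algebra. *)
Lemma off_indep k (A : set T) (B : set R) : <<s off_cylinder k >> A ->
  measurable B -> P (A `&` xi k @^-1` B) = (P A * gam B)%E.
Proof.
move=> kA mB.
have mX : measurable (xi k @^-1` B).
  by rewrite -[X in measurable X]setTI; apply: (xiP.1 k).
have gfin : gam B \is a fin_num by exact: fin_num_measure.
have g0 : 0 <= fine (gam B) by apply: fine_ge0; exact: measure_ge0.
pose m1 : {measure set T -> \bar R} := mrestr P mX.
pose m2 : {measure set T -> \bar R} := mscale (NngNum g0) P.
have m2E A' : m2 A' = (gam B * P A')%E.
  by transitivity ((fine (gam B))%:E * P A')%E => //; rewrite fineK.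
rewrite muleC -m2E.
change (m1 A = m2 A).
apply: (@g_sigma_algebra_measure_unique _ _ _ (off_cylinder k) _ (fun=> setT)) => //.
- exact: off_cylinder_measurable.
- by move=> _; exact: off_cylinder_setT.
- by rewrite bigcup_const.
- exact: off_cylinder_setI.
- move=> _ [J [B' [kJ mB' ->]]].
  rewrite m2E /m1 /= /mrestr.
  pose B1 j := if j == k then B else B' j.
  have mB1 j : measurable (B1 j) by rewrite /B1; case: ifP.
  rewrite (xiP.2 J)// -(_ : \bigcap_(j in [set` (k |` J)%fset]) xi j @^-1` B1 j =
    \bigcap_(j in [set` J]) xi j @^-1` B' j `&` xi k @^-1` B).
    rewrite (xiP.2 (k |` J)%fset)// big_fsetU1//= {1}/B1 eqxx; congr (_ * _)%E.
    rewrite big_seq [RHS]big_seq; apply: eq_bigr => j jJ; rewrite /B1.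
    by case: eqP => // jk; rewrite -jk jJ in kJ.
  apply/seteqP; split => [om H|om [H1 H2] j /=].
    split=> [j /= jJ|].
      have := H j; rewrite /= in_fset1U jJ orbT => /(_ isT); rewrite /B1.
      by case: eqP => // jk; rewrite -jk jJ in kJ.
    by have := H k; rewrite /= fset1U1 /B1 eqxx; apply.
  rewrite in_fset1U /B1 => /orP[/eqP ->|jJ]; first by rewrite eqxx.
  by case: eqP => [jk|_]; [rewrite -jk jJ in kJ | exact: H1].
- by move=> _; rewrite /m1 /mrestr/= (le_lt_trans (probability_le1 _ _)) ?ltry//; exact: measurableI.
Qed.

(** By [off_indep] the pair formed by the outcome seen in [off k] and by [xi k] has a product law,
    so Tonelli applies. Being independent of the entry [k] is expressed throughout as measurability
    on [off k]. *)
Lemma freezing k (h : off k * mR -> \bar R) :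
  measurable_fun setT h -> (forall z, 0 <= h z)%E ->
  (\int[P]_om h (om, xi k om) = \int[P]_om \int[gam]_x h (om, x))%E.
Proof.
move=> mh h0.
have mxi : measurable_fun [set: T] (fun om => xi k om : mR) by exact: (xiP.1 k).
have mphi : measurable_fun setT (fun om : T => (om, xi k om) : off k * mR).
  by apply: measurable_fun_pair => //; exact: measurable_off_id.
pose phi : {mfun T >-> (off k * mR)%type} := mfun_Sub (mem_set mphi).
pose X : {mfun T >-> off k} := mfun_Sub (mem_set (@measurable_off_id k)).
transitivity (\int[distribution P phi]_z h z)%E.
  by rewrite ge0_integral_distribution.
rewrite -(@eq_measure_integral _ _ _ _ _ (distribution P X \x gam)%E); last first.
  move=> A mA _; apply: product_measure_unique => // A1 B mA1 mB.
  exact: off_indep.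
rewrite fubini_tonelli1// ge0_integral_distribution//.
- exact: measurable_fun_fubini_tonelli_F.
- by move=> om; apply: integral_ge0.
Qed.

End freezing.

Section freezing_consequences.
Context d (T : measurableType d) (R : realType) (P : probability T R).
Context (I : choiceType) (xi : I -> T -> R).
Local Notation gam := (@normal_prob R 0 1).
Local Notation mR := (measurableTypeR R).
Hypothesis xiP : iid_normal P xi.

Lemma integral_off_sqr k (f g : off xi k -> R) (h : R -> R) (s : R) :
  measurable_fun setT f -> measurable_fun setT g -> measurable_fun setT h ->
  (forall u a, \int[gam]_x ((u + a * h x) ^+ 2)%:E = (u ^+ 2 + a ^+ 2 * s)%:E)%E ->
  (\int[P]_om ((f om + g om * h (xi k om)) ^+ 2)%:E =
   \int[P]_om (f om ^+ 2 + g om ^+ 2 * s)%:E)%E.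
Proof.
move=> mf mg mh hs.
pose H (z : off xi k * mR) : \bar R := ((f z.1 + g z.1 * h z.2) ^+ 2)%:E.
rewrite (freezing xiP (h := H)) /H/=; first by under eq_integral do rewrite hs.
  apply/measurable_EFinP; apply: measurable_funX; apply: measurable_funD.
    exact: measurableT_comp.
  apply: measurable_funM; first exact: measurableT_comp.
  have mh' : measurable_fun [set: mR] (h : mR -> R) by exact: mh.
  exact: measurableT_comp.
by move=> z; rewrite lee_fin sqr_ge0.
Qed.

(** Slope and intercept are random but free of the entry [k], hence constants once the others are
    frozen. The factor [F] will carry the blocks already present. *)
Lemma integral_off_invsqrt k (F : off xi k -> \bar R) (a b : off xi k -> R) :
  measurable_fun setT F -> (forall om, 0 <= F om)%E ->
  measurable_fun setT a -> measurable_fun setT b ->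
  (\int[P]_om (F om * invsqrt (a om * xi k om + b om)) <=
   (1 + 8 * normal_peak 1)%:E * \int[P]_om (F om * invsqrt (a om)))%E.
Proof.
move=> mF F0 ma mb.
pose H (z : off xi k * mR) : \bar R := (F z.1 * invsqrt (a z.1 * z.2 + b z.1))%E.
have mR' : measurable_fun [set: mR] (fun x : mR => x : R).
  exact: (@measurable_id _ R setT).
have mH : measurable_fun setT H.
  apply: emeasurable_funM; first exact: measurableT_comp.
  apply: (measurableT_comp measurable_invsqrt); apply: measurable_funD.
    apply: measurable_funM; first exact: measurableT_comp.
    exact: (measurableT_comp mR' measurable_snd).
  exact: measurableT_comp.
have H0 z : (0 <= H z)%E by rewrite mule_ge0// invsqrt_ge0.
have mTF := measurable_off_measurable xiP mF.
have mTa := measurable_off_measurable xiP ma.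
have miT : measurable_fun [set: T] (fun om => invsqrt (a om)).
  exact: (measurableT_comp measurable_invsqrt).
rewrite (freezing xiP mH H0) /H/= -ge0_integralZl_EFin//; first last.
- by rewrite addr_ge0// mulr_ge0// normal_peak_ge0.
- exact: emeasurable_funM.
- by move=> om _; rewrite mule_ge0// invsqrt_ge0.
have mG : measurable_fun [set: T] (fun om => \int[gam]_x H (om, x))%E.
  have := @measurable_fun_fubini_tonelli_F _ _ _ _ _ gam H mH H0.
  by move=> /(measurable_off_measurable xiP).
apply: ge0_le_integral => //.
- by move=> om _; apply: integral_ge0 => x _; exact: (H0 (om, x)).
- by apply: emeasurable_funM => //; exact: emeasurable_funM.
- move=> om _; rewrite ge0_integralZl//; last 2 first.
  - apply: (measurableT_comp measurable_invsqrt); apply: measurable_funD => //.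
  - by move=> x _; exact: invsqrt_ge0.
  rewrite muleCA; apply: lee_wpmul2l => //; exact: integral_normal_invsqrt.
Qed.

Lemma integral_off_sqr_sum (J : eqType) (s : seq J) (kk : J -> I) (a : J -> R)
    (f : T -> R) : uniq s -> injective kk ->
  (forall j, measurable_fun [set: off xi (kk j)] (f : off xi (kk j) -> R)) ->
  measurable_fun setT f ->
  (\int[P]_om ((f om + \sum_(j <- s) a j * xi (kk j) om) ^+ 2)%:E =
   \int[P]_om (f om ^+ 2)%:E + (\sum_(j <- s) a j ^+ 2)%:E)%E.
Proof.
move=> us kkI mf mfT; elim: s us => [|x s IHs] /=.
  by move=> _; under eq_integral do rewrite big_nil addr0; rewrite big_nil adde0.
move=> /andP[xs us]; rewrite big_cons EFinD addeCA -IHs// addeC.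
pose g (om : off xi (kk x)) := f om + \sum_(j <- s) a j * xi (kk j) om.
have mg : measurable_fun setT g.
  (* Measurability of a sum is proved for every index, so the index [x], absent from [s], is given a
     zero summand. *)
  rewrite /g (_ : (fun _ => _) = fun om => f om +
    \sum_(j <- s) (if j == x then cst 0 else fun om => a j * xi (kk j) om) om); last first.
    apply/funext => om; congr (_ + _); apply: eq_big_seq => j js.
    by case: eqP => // jx; rewrite jx (negPf xs) in js.
  apply: measurable_funD => //; apply: measurable_sum => j.
  case: eqP => // jx; apply: measurable_funM => //.
  by apply: measurable_off => //; apply/eqP => /kkI.
under eq_integral => om _.
  rewrite big_cons addrCA addrC; over.
rewrite (@integral_off_sqr (kk x) g (cst (a x)) id 1)//; last first.
  by move=> u b; rewrite mulr1 integral_normal_sqr_affine.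
under eq_integral do rewrite mulr1 EFinD.
rewrite ge0_integralD//=.
- by rewrite integral_cst//= probability_setT mule1.
- by move=> om _; rewrite lee_fin sqr_ge0.
- apply/measurable_EFinP; apply: measurable_funX.
  exact: (measurable_off_measurable xiP mg).
- by move=> om _; rewrite lee_fin sqr_ge0.
Qed.

End freezing_consequences.

(** * Uniform moment bounds and vanishing sequences *)

Section jensen.
Variable R : realFieldType.

(** Expand the nonnegative sum of a_i (y_i - Y / S)^2. Centring at Y / S instead of the weighted
    mean lets [S] be an upper bound of the total weight. *)
Lemma sqr_weighted_sum_le (I : Type) (r : seq I) (a y : I -> R) (S : R) :
  0 < S -> (forall i, 0 <= a i) -> \sum_(i <- r) a i <= S ->
  (\sum_(i <- r) a i * y i) ^+ 2 <= S * \sum_(i <- r) a i * y i ^+ 2.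
Proof.
move=> S0 a0 aS; set Y := \sum_(i <- r) a i * y i; set A := \sum_(i <- r) _ in aS.
set Q := \sum_(i <- r) a i * y i ^+ 2.
have : 0 <= \sum_(i <- r) a i * (y i - Y / S) ^+ 2.
  by apply: sumr_ge0 => i _; rewrite mulr_ge0// sqr_ge0.
have -> : \sum_(i <- r) a i * (y i - Y / S) ^+ 2 =
    Q - Y * ((Y / S) *+ 2) + A * (Y / S) ^+ 2.
  rewrite /Q /Y /A !mulr_suml -sumrB -big_split; apply: eq_bigr => i _ /=; ring.
set t := Y / S; have Yt : Y = t * S by rewrite /t divfK// gt_eqF.
have : A * t ^+ 2 <= S * t ^+ 2 by rewrite ler_wpM2r// sqr_ge0.
rewrite Yt mulr2n => H1 H2; have {H1 H2} H : S * t ^+ 2 <= Q by lra.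
have -> : (t * S) ^+ 2 = S * (S * t ^+ 2) by ring.
by rewrite ler_wpM2l// ltW.
Qed.

(** The power mean inequality by repeated squaring. Each squaring doubles the exponent, which is the
    reason for tracking moments of dyadic order. *)
Lemma pow2_weighted_sum_le (I : Type) (r : seq I) (a x : I -> R) (S : R) p :
  0 < S -> \sum_(i <- r) `|a i| <= S ->
  `|\sum_(i <- r) a i * x i| ^+ (2 ^ p) <=
    S ^+ (2 ^ p).-1 * \sum_(i <- r) `|a i| * `|x i| ^+ (2 ^ p).
Proof.
move=> S0 aS; elim: p => [|p IHp].
  rewrite expr1 mul1r (le_trans (ler_norm_sum _ _ _))//.
  by apply: ler_sum => i _; rewrite normrM expr1.
rewrite expnSr exprM.
apply: (@le_trans _ _ ((S ^+ (2 ^ p).-1 * \sum_(i <- r) `|a i| * `|x i| ^+ (2 ^ p)) ^+ 2)).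
  by rewrite ler_pXn2r// nnegrE ?exprn_ge0// (le_trans _ IHp)// exprn_ge0.
rewrite exprMn -exprM (_ : (2 ^ p * 2).-1 = ((2 ^ p).-1 * 2).+1)%N; last first.
  by case: (2 ^ p)%N (expn_gt0 2 p) => // k _; rewrite /= mulSn.
rewrite [S ^+ _.+1]exprSr -mulrA ler_wpM2l ?exprn_ge0 ?(ltW S0)//.
have -> : \sum_(i <- r) `|a i| * `|x i| ^+ (2 ^ p * 2) =
    \sum_(i <- r) `|a i| * (`|x i| ^+ (2 ^ p)) ^+ 2.
  by apply: eq_bigr => i _; rewrite exprM.
exact: sqr_weighted_sum_le.
Qed.

End jensen.

Section moment_bounds.
Context d (T : measurableType d) (R : realType) (P : probability T R).
Context (J : Type) (F : set_system J) {FF : Filter F}.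
Implicit Types f g : J -> T -> R.

(* all absolute moments are bounded along [F]; dyadic exponents suffice *)
Definition moment_bounded f : Prop :=
  (forall j, measurable_fun setT (f j)) /\
  forall p, exists c : R, \forall j \near F,
    (\int[P]_om (`|f j om| ^+ (2 ^ p))%:E <= c%:E)%E.

(** Mean-square convergence alone is not stable under products; together with bounds on all moments
    it is. The filter is [\oo] for limits in time, and [globally] of the full set for bounds uniform
    in time. *)
Definition vanishing f : Prop :=
  moment_bounded f /\
  forall e : R, 0 < e -> \forall j \near F, (\int[P]_om (f j om ^+ 2)%:E <= e%:E)%E.

Lemma measurable_abs_expr (f : T -> R) n : measurable_fun setT f ->
  measurable_fun setT (fun om => (`|f om| ^+ n)%:E).
Proof.
move=> mf; apply/measurable_EFinP; apply: measurable_funX.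
exact: measurableT_comp.
Qed.

Let measurable_sqr (f : T -> R) : measurable_fun setT f ->
  measurable_fun setT (fun om => (f om ^+ 2)%:E).
Proof. by move=> mf; apply/measurable_EFinP; exact: measurable_funX. Qed.

(* monotonicity and additivity packaged for integrands of the form
   [k u + l v] *)
Lemma ge0_le_integral_lincomb (f u v : T -> R) (k l a b : R) :
  measurable_fun setT f -> measurable_fun setT u -> measurable_fun setT v ->
  (forall om, 0 <= f om) -> (forall om, 0 <= u om) -> (forall om, 0 <= v om) ->
  0 <= k -> 0 <= l ->
  (forall om, f om <= k * u om + l * v om) ->
  (\int[P]_om (u om)%:E <= a%:E)%E -> (\int[P]_om (v om)%:E <= b%:E)%E ->
  (\int[P]_om (f om)%:E <= (k * a + l * b)%:E)%E.
Proof.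
move=> mf mu mv f0 u0 v0 k0 l0 fuv ua vb.
apply: (@le_trans _ _ (\int[P]_om (k%:E * (u om)%:E + l%:E * (v om)%:E))%E).
  apply: ge0_le_integral => //.
  - by move=> om _; rewrite lee_fin.
  - exact/measurable_EFinP.
  - by apply: emeasurable_funD; apply: emeasurable_funM => //; exact/measurable_EFinP.
  - by move=> om _; rewrite -!EFinM -EFinD lee_fin.
rewrite ge0_integralD//; last 4 first.
- by move=> om _; rewrite mule_ge0 ?lee_fin.
- by apply: emeasurable_funM => //; exact/measurable_EFinP.
- by move=> om _; rewrite mule_ge0 ?lee_fin.
- by apply: emeasurable_funM => //; exact/measurable_EFinP.
have eu : forall om, setT om -> (0 <= (u om)%:E)%E by move=> om _; rewrite lee_fin.
have ev : forall om, setT om -> (0 <= (v om)%:E)%E by move=> om _; rewrite lee_fin.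
rewrite !ge0_integralZl_EFin//; try exact/measurable_EFinP.
by rewrite EFinD !EFinM; apply: leeD; apply: lee_wpmul2l.
Qed.

Lemma moment_bounded_cst (c : R) : moment_bounded (fun _ => cst c).
Proof.
split=> // p; exists (`|c| ^+ (2 ^ p)); apply: nearW => j /=.
by rewrite integral_cst//= probability_setT mule1.
Qed.

Lemma moment_boundedM f g : moment_bounded f -> moment_bounded g ->
  moment_bounded (fun j om => f j om * g j om).
Proof.
move=> [mf bf] [mg bg]; split=> [j|p]; first exact: measurable_funM.
have [a fa] := bf p.+1; have [b gb] := bg p.+1.
exists (1 * a + 1 * b); near=> j.
apply: (@ge0_le_integral_lincomb _ (fun om => `|f j om| ^+ (2 ^ p.+1))
  (fun om => `|g j om| ^+ (2 ^ p.+1))) => //.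
- apply: measurable_funX; apply: measurableT_comp => //; exact: measurable_funM.
- by apply: measurable_funX; exact: measurableT_comp.
- by apply: measurable_funX; exact: measurableT_comp.
- move=> om; rewrite normrM exprMn expnSr !exprM.
  set x := _ ^+ (2 ^ p); set y := `|g j om| ^+ (2 ^ p).
  have := sqr_ge0 (x - y); rewrite sqrrB.
  have := sqr_ge0 x; have := sqr_ge0 y; nra.
- by near: j.
- by near: j.
Unshelve. all: by end_near. Qed.

Lemma moment_boundedD f g : moment_bounded f -> moment_bounded g ->
  moment_bounded (fun j om => f j om + g j om).
Proof.
move=> [mf bf] [mg bg]; split=> [j|p]; first exact: measurable_funD.
have [a fa] := bf p; have [b gb] := bg p.
exists (2 ^+ (2 ^ p).-1 * a + 2 ^+ (2 ^ p).-1 * b); near=> j.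
apply: (@ge0_le_integral_lincomb _ (fun om => `|f j om| ^+ (2 ^ p))
  (fun om => `|g j om| ^+ (2 ^ p))) => //.
- by apply: measurable_funX; apply: measurableT_comp => //; exact: measurable_funD.
- by apply: measurable_funX; exact: measurableT_comp.
- by apply: measurable_funX; exact: measurableT_comp.
- move=> om; have := @pow2_weighted_sum_le R bool [:: true; false] (fun=> 1)
    (fun b : bool => if b then f j om else g j om) 2 p.
  rewrite !big_cons !big_nil !addr0 normr1 !mul1r mulrDr; exact.
- by near: j.
- by near: j.
Unshelve. all: by end_near. Qed.

Lemma moment_bounded_le f g : (forall j, measurable_fun setT (g j)) ->
  moment_bounded f -> (forall j om, `|g j om| <= `|f j om|) -> moment_bounded g.
Proof.
move=> mg [mf bf] gf; split=> // p; have [c fc] := bf p; exists c.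
near=> j; apply: (@le_trans _ _ (\int[P]_om (`|f j om| ^+ (2 ^ p))%:E)%E).
  apply: ge0_le_integral => //.
  - exact: measurable_abs_expr.
  - exact: measurable_abs_expr.
  - by move=> om _; rewrite lee_fin lerXn2r ?nnegrE.
by near: j.
Unshelve. all: by end_near. Qed.

Lemma moment_bounded_norm f : moment_bounded f ->
  moment_bounded (fun j om => `|f j om|).
Proof.
move=> bf; apply: (moment_bounded_le _ bf) => [j|j om]; last by rewrite normr_id.
by apply: measurableT_comp => //; exact: bf.1.
Qed.

Lemma moment_bounded_sum (K : Type) (r : seq K) (f : K -> J -> T -> R) :
  (forall k, moment_bounded (f k)) ->
  moment_bounded (fun j om => \sum_(k <- r) f k j om).
Proof.
move=> bf; elim: r => [|k r IHr].
  rewrite (_ : (fun _ _ => _) = fun=> cst 0); first exact: moment_bounded_cst.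
  by apply/funext => j; apply/funext => om; rewrite big_nil.
rewrite (_ : (fun _ _ => _) = fun j om => f k j om + \sum_(i <- r) f i j om).
  exact: moment_boundedD.
by apply/funext => j; apply/funext => om; rewrite big_cons.
Qed.

Lemma moment_boundedX f n : moment_bounded f ->
  moment_bounded (fun j om => f j om ^+ n).
Proof.
move=> bf; elim: n => [|n IHn]; first exact: moment_bounded_cst.
rewrite (_ : (fun _ _ => _) = fun j om => f j om * f j om ^+ n).
  exact: moment_boundedM.
by apply/funext => j; apply/funext => om; rewrite exprS.
Qed.

Lemma moment_bounded_sqr f : moment_bounded f ->
  exists c : R, 0 < c /\ \forall j \near F, (\int[P]_om (f j om ^+ 2)%:E <= c%:E)%E.
Proof.
move=> [mf bf]; have [c fc] := bf 1%N; exists (`|c| + 1); split.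
  by rewrite ltr_wpDl.
near=> j; under eq_integral do rewrite -real_normK ?num_real//.
apply: (@le_trans _ _ c%:E); first by near: j.
by rewrite lee_fin (le_trans (ler_norm c))// lerDl.
Unshelve. all: by end_near. Qed.

Lemma vanishingD f g : vanishing f -> vanishing g ->
  vanishing (fun j om => f j om + g j om).
Proof.
move=> [bf vf] [bg vg]; split; first exact: moment_boundedD.
move=> e e0; have e4 : 0 < e / 4 by rewrite divr_gt0.
near=> j.
have -> : e = 2 * (e / 4) + 2 * (e / 4) by field.
apply: (@ge0_le_integral_lincomb _ (fun om => f j om ^+ 2) (fun om => g j om ^+ 2)).
- by apply: measurable_funX; apply: measurable_funD; [exact: bf.1|exact: bg.1].
- by apply: measurable_funX; exact: bf.1.
- by apply: measurable_funX; exact: bg.1.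
- by move=> om; rewrite sqr_ge0.
- by move=> om; rewrite sqr_ge0.
- by move=> om; rewrite sqr_ge0.
- by [].
- by [].
- by move=> om; have := sqr_ge0 (f j om - g j om); nra.
- by near: j; exact: vf.
- by near: j; exact: vg.
Unshelve. all: by end_near. Qed.

(* [2 |f h| <= k f ^ 2 + h ^ 2 / k] with [h] bounded in mean square and [k] large *)
Let vanishing_integralM f g : vanishing f -> moment_bounded g -> forall e : R, 0 < e ->
  \forall j \near F, (\int[P]_om (`|f j om * g j om|)%:E <= e%:E)%E.
Proof.
move=> [bf vf] bg e e0; have [c [c0 gc]] := moment_bounded_sqr bg.
pose k := e / (2 * c).
have k0 : 0 < k by rewrite divr_gt0// mulr_gt0.
have ke : 0 < e * k / 2 by rewrite divr_gt0// mulr_gt0.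
near=> j.
have -> : e = k^-1 * (e * k / 2) + k * c.
  by rewrite /k; field; rewrite !gt_eqF.
apply: (@ge0_le_integral_lincomb _ (fun om => f j om ^+ 2) (fun om => g j om ^+ 2)).
- by apply: measurableT_comp => //; apply: measurable_funM; [exact: bf.1|exact: bg.1].
- by apply: measurable_funX; exact: bf.1.
- by apply: measurable_funX; exact: bg.1.
- by [].
- by move=> om; rewrite sqr_ge0.
- by move=> om; rewrite sqr_ge0.
- by rewrite invr_ge0 ltW.
- exact: ltW.
- move=> om; rewrite -(ler_pM2l k0) mulrDr mulrA mulfV ?gt_eqF// mul1r.
  rewrite -(real_normK (num_real (f j om))) -(real_normK (num_real (g j om))) normrM.
  set x := `|f j om|; set y := `|g j om|.
  have x0 : 0 <= x by exact: normr_ge0. have y0 : 0 <= y by exact: normr_ge0.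
  have := sqr_ge0 (x - k * y); have := mulr_ge0 (ltW k0) (mulr_ge0 x0 y0); nra.
- by near: j; exact: vf.
- by near: j.
Unshelve. all: by end_near. Qed.

(** (f g)^2 = f (f g^2), where f g^2 has bounded moments: the mean square of the product is a mean
    of a vanishing factor against a bounded one. *)
Lemma vanishingM f g : vanishing f -> moment_bounded g ->
  vanishing (fun j om => f j om * g j om).
Proof.
move=> vf bg; split; first exact: moment_boundedM vf.1 bg.
move=> e e0.
have bh := moment_boundedM vf.1 (moment_boundedM bg bg).
apply: filterS (vanishing_integralM vf bh e0) => j.
under eq_integral => om _.
  rewrite (_ : `|_| = (f j om * g j om) ^+ 2); last first.
    by rewrite ger0_norm; [ring|rewrite (_ : _ * _ = (f j om * g j om) ^+ 2) ?sqr_ge0//; ring].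
  over.
by [].
Qed.

Lemma vanishing_sum (K : Type) (r : seq K) (f : K -> J -> T -> R) :
  (forall k, vanishing (f k)) ->
  vanishing (fun j om => \sum_(k <- r) f k j om).
Proof.
move=> bf; elim: r => [|k r IHr].
  rewrite (_ : (fun _ _ => _) = fun=> cst 0); last first.
    by apply/funext => j; apply/funext => om; rewrite big_nil.
  split; first exact: moment_bounded_cst.
  move=> e e0; apply: nearW => j; under eq_integral do rewrite expr0n.
  by rewrite integral0 lee_fin ltW.
rewrite (_ : (fun _ _ => _) = fun j om => f k j om + \sum_(i <- r) f i j om).
  exact: vanishingD.
by apply/funext => j; apply/funext => om; rewrite big_cons.
Qed.

Lemma vanishing_norm f : vanishing f -> vanishing (fun j om => `|f j om|).
Proof.
move=> [bf vf]; split; first exact: moment_bounded_norm.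
move=> e e0; apply: filterS (vf e e0) => j.
by under [in X in _ -> X]eq_integral do rewrite real_normK ?num_real//.
Qed.

Lemma vanishing_integral f : vanishing f -> forall e : R, 0 < e ->
  \forall j \near F, (\int[P]_om (`|f j om|)%:E <= e%:E)%E.
Proof.
move=> vf e e0; have := vanishing_integralM vf (moment_bounded_cst 1) e0.
by apply: filterS => j; under eq_integral do rewrite /= mulr1.
Qed.

End moment_bounds.

Section uniform_moment_bounds.
Context d (T : measurableType d) (R : realType) (P : probability T R).

Lemma uniform_moment_bounded (J : Type) (F : set_system J) (FF : Filter F)
    (f : J -> T -> R) :
  moment_bounded P (globally [set: J]) f -> moment_bounded P F f.
Proof.
move=> [mf bf]; split=> // p; have [c fc] := bf p; exists c.
by apply: nearW => j; exact: fc.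
Qed.

Lemma moment_bounded_reindex (J K : Type) (f : K -> T -> R) (k : J -> K) :
  moment_bounded P (globally [set: K]) f ->
  moment_bounded P (globally [set: J]) (fun j => f (k j)).
Proof.
move=> [mf bf]; split=> // p; have [c fc] := bf p; exists c => j _.
exact: fc.
Qed.

(** The estimate depends on the weights only through [S], so the number of terms may grow with [j].
    This covers time averages and the convolution formula for the state. *)
Lemma moment_bounded_weighted_sum (J : Type) (K : Type) (f : K -> T -> R)
    (r : J -> seq K) (a : J -> K -> R) (S : R) :
  moment_bounded P (globally [set: K]) f ->
  (forall j, \sum_(i <- r j) `|a j i| <= S) ->
  moment_bounded P (globally [set: J])
    (fun j om => \sum_(i <- r j) a j i * f i om).
Proof.
move=> [mf bf] aS; split=> [j|p].
  by apply: measurable_sum => i; exact: measurable_funM.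
have [c fc] := bf p; pose S1 := `|S| + 1.
have S0 : 0 < S1 by rewrite ltr_wpDl.
have aS1 j : \sum_(i <- r j) `|a j i| <= S1.
  by rewrite (le_trans (aS j))// (le_trans (ler_norm _))// lerDl.
exists (S1 ^+ (2 ^ p).-1 * (S1 * `|c|)) => j _.
have mterm i : measurable_fun setT (fun om => (`|a j i| * `|f i om| ^+ (2 ^ p))%:E).
  apply/measurable_EFinP; apply: measurable_funM => //.
  by apply: measurable_funX; exact: measurableT_comp.
have msum : measurable_fun setT
    (fun om => (\sum_(i <- r j) `|a j i| * `|f i om| ^+ (2 ^ p))%:E).
  apply/measurable_EFinP; apply: measurable_sum => i.
  by apply/measurable_EFinP; exact: mterm.
have t0 i om : (0 <= (`|a j i| * `|f i om| ^+ (2 ^ p))%:E)%E.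
  by rewrite lee_fin mulr_ge0.
apply: (@le_trans _ _ (\int[P]_om ((S1 ^+ (2 ^ p).-1)%:E *
   (\sum_(i <- r j) `|a j i| * `|f i om| ^+ (2 ^ p))%:E))%E).
  apply: ge0_le_integral => //.
  - apply: measurable_abs_expr; apply: measurable_sum => i; exact: measurable_funM.
  - exact: emeasurable_funM.
  - by move=> om _; rewrite -EFinM lee_fin pow2_weighted_sum_le.
rewrite ge0_integralZl_EFin//; last 2 first.
- by move=> om _; rewrite lee_fin sumr_ge0// => i _; rewrite mulr_ge0.
- by rewrite exprn_ge0// ltW.
rewrite EFinM lee_wpmul2l ?lee_fin ?exprn_ge0 ?(ltW S0)//.
under eq_integral do rewrite -sumEFin.
rewrite ge0_integral_sum//.
apply: (@le_trans _ _ (\sum_(i <- r j) (`|a j i| * `|c|)%:E)%E).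
  apply: lee_sum => i _; under eq_integral do rewrite EFinM.
  rewrite ge0_integralZl_EFin//; last exact: measurable_abs_expr.
  rewrite EFinM lee_wpmul2l// (le_trans (fc i _))// lee_fin; exact: ler_norm.
by rewrite sumEFin lee_fin -mulr_suml ler_wpM2r.
Qed.

End uniform_moment_bounds.

(** * The scalar noise entries as one independent normal family *)

Section scalar_noise.
Context d (T : measurableType d) (R : realType) (P : probability T R) (n p : nat).
Variables (w : nat -> T -> 'cV[R]_n) (v : nat -> T -> 'cV[R]_p).
Local Notation gam := (@normal_prob R 0 1).

Definition noise_index : choiceType := ((nat * 'I_n) + (nat * 'I_p))%type.

Definition noise (k : noise_index) (om : T) : R :=
  match k with inl (t, i) => w t om i 0 | inr (t, i) => v t om i 0 end.

Definition noise_time (k : noise_index) : nat :=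
  match k with inl (t, _) => t | inr (t, _) => t end.

Let blocks m : seq (nat + nat) := [seq inl t | t <- iota 0 m] ++ [seq inr t | t <- iota 0 m].

Let coords m : seq noise_index :=
  [seq inl (t, i) | t <- iota 0 m, i <- enum 'I_n] ++
  [seq inr (t, i) | t <- iota 0 m, i <- enum 'I_p].

Let uniq_blocks m : uniq (blocks m).
Proof.
rewrite cat_uniq !map_inj_uniq ?iota_uniq ?andbT//=; try by move=> ? ? [].
by apply/hasPn => _ /mapP[t _ ->]; apply/mapP => -[].
Qed.

Let uniq_coords m : uniq (coords m).
Proof.
rewrite cat_uniq; apply/and3P; split.
- by apply: allpairs_uniq; rewrite ?iota_uniq ?enum_uniq// => -[? ?] [? ?] _ _ [-> ->].
- by apply/hasPn => _ /allpairsP[[t i] [_ _ ->]]; apply/allpairsP => -[[? ?] []].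
- by apply: allpairs_uniq; rewrite ?iota_uniq ?enum_uniq// => -[? ?] [? ?] _ _ [-> ->].
Qed.

Let mem_coords m k : (k \in coords m) = (noise_time k < m)%N.
Proof.
rewrite mem_cat; case: k => [[t i]|[t i]] /=.
- apply/orP/idP => [[/allpairsP[[t' i'] /= [tm _ [-> _]]]|/allpairsP[[? ?] [? ?]]//]|tm].
    by move: tm; rewrite mem_iota.
  by left; apply/allpairsP; exists (t, i); rewrite mem_iota mem_enum.
- apply/orP/idP => [[/allpairsP[[? ?] [? ?]]//|/allpairsP[[t' i'] /= [tm _ [-> _]]]]|tm].
    by move: tm; rewrite mem_iota.
  by right; apply/allpairsP; exists (t, i); rewrite mem_iota mem_enum.
Qed.

Let sigma_vec_box q (X : T -> 'cV[R]_q) (B : 'I_q -> set R) :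
  (forall i, measurable (B i)) -> sigma_vec X [set om | forall i, B i (X om i 0)].
Proof.
move=> mB; pose G : set (set T) := [set E | exists i (B : set R),
  measurable B /\ E = [set om | B (X om i 0)]].
have -> : [set om | forall i, B i (X om i 0)] =
    \bigcap_(i in [set: 'I_q]) [set om | B i (X om i 0)].
  by apply/seteqP; split => [om H i _|om H i]; [exact: H | exact: (H i I)].
apply: (@fin_bigcap_measurable _ (g_sigma_algebraType G)); first exact: finite_finset.
by move=> i _; apply: sub_sigma_algebra; exists i, (B i).
Qed.

(** Independence is given between vectors and the product law inside each vector. A finite set of
    entries is therefore enlarged to all entries before some time [m], with the full line as
    constraint on the added ones, so that each vector lies in a complete box. *)
Lemma noise_iid_normal : iid_std_gaussian_noises P w v -> iid_normal P noise.
Proof.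
move=> [wG vG wv]; split=> [[[t i]|[t i]]|J B mB].
- exact: (wG t).1.
- exact: (vG t).1.
have [m mP] : exists m, forall j, j \in J -> (noise_time j < m)%N.
  exists (\max_(j <- J) noise_time j).+1 => j jJ; rewrite ltnS.
  exact: leq_bigmax_seq.
have Jm j : j \in J -> j \in coords m by move=> /mP; rewrite mem_coords.
pose B' j := if j \in J then B j else setT.
have mB' j : measurable (B' j) by rewrite /B'; case: ifP.
have mblk (s : seq (nat + nat)) k : k \in s -> [set` [fset k in s]%fset] k.
  by move=> ks /=; rewrite inE.
pose E (k : (nat + nat)%type) : set T := match k with
  | inl t => [set om | forall i, B' (inl (t, i)) (w t om i 0)]
  | inr t => [set om | forall i, B' (inr (t, i)) (v t om i 0)] end.
have -> : \bigcap_(j in [set` J]) noise j @^-1` B j =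
    \bigcap_(k in [set` [fset k in blocks m]%fset]) E k.
  apply/seteqP; split => om H.
    by move=> [t|t] _ i /=; rewrite /B'; case: ifPn => // /H.
  move=> j /= jJ; have := mP j jJ.
  case: j jJ => [[t i]|[t i]] jJ tm.
    have tb : inl t \in blocks m by rewrite mem_cat map_f ?mem_iota.
    have HE : E (inl t) om by apply: H; exact: mblk.
    by have := HE i; rewrite /B' jJ.
  have tb : inr t \in blocks m by rewrite mem_cat map_f ?orbT ?mem_iota.
  have HE : E (inr t) om by apply: H; exact: mblk.
  by have := HE i; rewrite /B' jJ.
rewrite wv; last first.
  move=> [t|t] _.
    by apply: (@sigma_vec_box _ (w t) (fun i => B' (inl (t, i)))).
  by apply: (@sigma_vec_box _ (v t) (fun i => B' (inr (t, i)))).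
have -> : (\prod_(j <- J) gam (B j) = \prod_(j <- coords m) gam (B' j))%E.
  rewrite [RHS](eq_bigr (fun j => if j \in J then gam (B j) else 1%E)); last first.
    by move=> j _; rewrite /B'; case: ifP => //; rewrite probability_setT.
  rewrite -big_mkcond -big_filter; apply: perm_big; apply: uniq_perm.
  - exact: fset_uniq.
  - by rewrite filter_uniq.
  - move=> j; rewrite mem_filter; apply/idP/andP => [jJ|[]//].
    by split => //; exact: Jm.
rewrite (perm_big (blocks m)); last first.
  apply: uniq_perm => [|//|k]; first exact: fset_uniq.
  by move: (blocks m) => s; rewrite inE.
rewrite /blocks /coords !big_cat !big_allpairs_dep !big_map; congr (_ * _)%E.
- apply: eq_bigr => t _; rewrite big_enum/=.
  exact: (wG t).2 (fun i => B' (inl (t, i))) (fun i => mB' _).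
- apply: eq_bigr => t _; rewrite big_enum/=.
  exact: (vG t).2 (fun i => B' (inr (t, i))) (fun i => mB' _).
Qed.

End scalar_noise.

(** * Stationary covariances and the loss of a predictor *)

Section squared_frobenius.
Variable R : realType.

Definition fsq m n (A : 'M[R]_(m, n)) : R := \sum_i \sum_j A i j ^+ 2.

Lemma fsq_ge0 m n (A : 'M[R]_(m, n)) : 0 <= fsq A.
Proof. by apply: sumr_ge0 => i _; apply: sumr_ge0 => j _; exact: sqr_ge0. Qed.

Lemma frobenius_normE m n (A : 'M[R]_(m, n)) : frobenius_norm A ^+ 2 = fsq A.
Proof. by rewrite sqr_sqrtr ?fsq_ge0. Qed.

Lemma fsq_mxtrace m n (A : 'M[R]_(m, n)) : fsq A = \tr (A *m A^T).
Proof.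
apply: eq_bigr => i _; rewrite mxE; apply: eq_bigr => j _.
by rewrite mxE expr2.
Qed.

Lemma fsq_tr m n (A : 'M[R]_(m, n)) : fsq A^T = fsq A.
Proof. by rewrite !fsq_mxtrace mxtrace_mulC trmxK. Qed.

Lemma fsqN m n (A : 'M[R]_(m, n)) : fsq (- A) = fsq A.
Proof. by apply: eq_bigr => i _; apply: eq_bigr => j _; rewrite mxE sqrrN. Qed.

Lemma fsq_row_sum m n (A : 'M[R]_(m, n)) : \sum_i fsq (row i A) = fsq A.
Proof.
by apply: eq_bigr => i _; rewrite /fsq big_ord1; apply: eq_bigr => j _; rewrite mxE.
Qed.

Lemma fsq_mxcol m n p (A : 'I_m -> 'M[R]_(n, p)) :
  fsq (\mxcol_i A i) = \sum_i fsq (A i).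
Proof.
rewrite -fsq_tr fsq_mxtrace trmxK tr_mxcol mul_mxrow_mxcol raddf_sum.
by apply: eq_bigr => i _; rewrite -fsq_tr fsq_mxtrace trmxK.
Qed.

Lemma fsq_mxblock m n p q (A : 'I_m -> 'I_n -> 'M[R]_(p, q)) :
  fsq (\mxblock_(i, j) A i j) = \sum_i \sum_j fsq (A i j).
Proof.
rewrite mxblockEv fsq_mxcol; apply: eq_bigr => i _.
by rewrite -fsq_tr tr_mxrow fsq_mxcol; apply: eq_bigr => j _; rewrite fsq_tr.
Qed.

Lemma mxtrace_mxcol m n p (A : 'I_m -> 'M[R]_(n, p)) (B : 'M[R]_p) :
  \tr ((\mxcol_i A i) *m B *m (\mxcol_i A i)^T) = \sum_i \tr (A i *m B *m (A i)^T).
Proof.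
rewrite mxcol_mul tr_mxcol mul_mxcol_mxrow mxtrace_mxblock.
by apply: eq_bigr.
Qed.

End squared_frobenius.

Section lyapunov.
Variables (R : realType) (n : nat) (A : 'M[R]_n) (S : R).
Hypothesis AS : forall k, \sum_(i < k) nm (A ^+ i) <= S.

Lemma power_bound_ge0 : 0 <= S.
Proof. by have := AS 0; rewrite big_ord0. Qed.

Lemma nm_power_le k : nm (A ^+ k) <= S.
Proof.
apply: le_trans (AS k.+1); rewrite big_ord_recr lerDr; apply: sumr_ge0 => i _.
exact: nm_ge0.
Qed.

(** If all powers had norm above [e], slightly more than [S / e] of them would already sum to more
    than [S]. *)
Lemma nm_power_small (e : R) : 0 < e -> exists k, nm (A ^+ k) <= e.
Proof.
move=> e0; apply: contrapT => /forallNP H.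
pose k := (Num.trunc (S / e)).+1.
have : e * k%:R <= S.
  apply: le_trans (AS k); rewrite mulr_natr -[in leLHS](card_ord k) -sumr_const.
  by apply: ler_sum => i _; rewrite leNgt; apply/negP => /ltW; exact: H.
by rewrite leNgt -ltr_pdivrMl// mulrC truncnS_gt.
Qed.

Lemma sum_nm_power_sqr_le k : \sum_(i < k) nm (A ^+ i) ^+ 2 <= S ^+ 2.
Proof.
apply: (@le_trans _ _ (S * \sum_(i < k) nm (A ^+ i))).
  rewrite mulr_sumr; apply: ler_sum => i _.
  by rewrite expr2 ler_wpM2r ?nm_ge0 ?nm_power_le.
by rewrite expr2 ler_wpM2l ?power_bound_ge0.
Qed.

Lemma lyapunov_iter (X E : 'M[R]_n) k : X = A *m X *m A^T + E ->
  X = A ^+ k *m X *m (A ^+ k)^T + \sum_(i < k) A ^+ i *m E *m (A ^+ i)^T.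
Proof.
move=> XE; elim: k => [|k IHk].
  by rewrite big_ord0 expr0 trmx1 mulmx1 mul1mx addr0.
have step : A ^+ k *m X *m (A ^+ k)^T =
    A ^+ k.+1 *m X *m (A ^+ k.+1)^T + A ^+ k *m E *m (A ^+ k)^T.
  rewrite {1}XE mulmxDr mulmxDl exprSr -mulmxE trmx_mul; congr (_ + _).
  by rewrite !mulmxA.
by rewrite {1}IHk step big_ord_recr/= -addrA [_ + \sum_(_ < _) _]addrC.
Qed.

Lemma nm_sandwich_le k (X : 'M[R]_n) :
  nm (A ^+ k *m X *m (A ^+ k)^T) <= nm (A ^+ k) ^+ 2 * nm X.
Proof.
rewrite (le_trans (ler_nmM _ _))// nm_tr.
rewrite (le_trans (ler_wpM2r (nm_ge0 _) (ler_nmM _ _)))//.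
by rewrite mulrAC expr2.
Qed.

(** Iterating until [A ^ k] is small absorbs the leading term into the left-hand side. With [E = 0]
    this is uniqueness; with a random [E] it controls the empirical state covariance. *)
Lemma lyapunov_nm_le (X E : 'M[R]_n) : X = A *m X *m A^T + E ->
  nm X <= 2 * S ^+ 2 * nm E.
Proof.
move=> XE; have [|k Ak] := @nm_power_small (1 / 2); first by [].
have : nm X <= 1 / 2 * nm X + S ^+ 2 * nm E.
  rewrite {1}(lyapunov_iter k XE) (le_trans (ler_nmD _ _))// lerD//.
    rewrite (le_trans (nm_sandwich_le _ _))// ler_wpM2r ?nm_ge0//.
    have := nm_ge0 (A ^+ k); nra.
  rewrite (le_trans (ler_nm_sum _ _ _))//.
  apply: le_trans (ler_wpM2r (nm_ge0 E) (sum_nm_power_sqr_le k)).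
  by rewrite mulr_suml; apply: ler_sum => i _; exact: nm_sandwich_le.
lra.
Qed.

Lemma lyapunov_unique m (B : 'M[R]_(n, m)) (X Y : 'M[R]_n) :
  stationary_cov A B X -> stationary_cov A B Y -> X = Y.
Proof.
move=> XE YE; apply/eqP; rewrite -subr_eq0; apply/eqP.
have D : X - Y = A *m (X - Y) *m A^T + 0.
  by rewrite {1}XE {1}YE mulmxBr mulmxBl addr0 opprD addrACA subrr addr0.
have := lyapunov_nm_le D; rewrite nm0 mulr0 => N0.
apply/matrixP => i j; rewrite [RHS]mxE; apply/eqP.
by rewrite -normr_le0 (le_trans (ler_nm _ _ _)).
Qed.

Lemma mx11_ge0_tr m (c : 'rV[R]_m) : 0 <= (c *m c^T) 0 0.
Proof. by rewrite mxE; apply: sumr_ge0 => i _; rewrite mxE -expr2 sqr_ge0. Qed.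

(** After [k] iterations the quadratic form is a sum of squares plus a remainder that tends to 0
    with [A ^ k]. *)
Lemma stationary_cov_psd m (B : 'M[R]_(n, m)) (X : 'M[R]_n) (c : 'rV[R]_n) :
  stationary_cov A B X -> 0 <= (c *m X *m c^T) 0 0.
Proof.
move=> XE; apply/ler_addgt0Pl => e e0; rewrite addrC.
pose a := nm c * (nm X * nm c).
have a0 : 0 <= a by rewrite !mulr_ge0 ?nm_ge0.
have [k Ak] : exists k, nm (A ^+ k) ^+ 2 * a <= e.
  (* The minimum with 1 lets the square of the norm be bounded by the norm itself. *)
  have [|k Ak] := @nm_power_small (Num.min 1 (e / (a + 1))).
    by rewrite lt_min ltr01 divr_gt0// ltr_wpDl.
  exists k; move: Ak; rewrite le_min => /andP[k1]; rewrite ler_pdivlMr ?ltr_wpDl//.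
  have := nm_ge0 (A ^+ k); set x := nm _ in k1 *; move=> x0 xe.
  have xa : x * (x * a) <= 1 * (x * a) by rewrite ler_wpM2r// mulr_ge0.
  by rewrite expr2 -mulrA; lra.
rewrite (lyapunov_iter k XE) mulmxDr mulmxDl mxE addrAC.
apply: addr_ge0.
  rewrite -lerBlDr sub0r lerNl.
  apply: le_trans Ak; apply: le_trans (ler_norm _) _; rewrite normrN.
  rewrite (le_trans (ler_nm _ _ _))// (le_trans (ler_nmM _ _))// nm_tr.
  rewrite (le_trans (ler_wpM2r (nm_ge0 _) (ler_nmM _ _)))//.
  rewrite (le_trans (ler_wpM2r (nm_ge0 _) (ler_wpM2l (nm_ge0 _) (nm_sandwich_le _ _))))//.
  by rewrite /a le_eqVlt; apply/orP; left; apply/eqP; ring.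
rewrite mulmx_sumr mulmx_suml summxE; apply: sumr_ge0 => i _.
rewrite (_ : c *m _ *m c^T = (c *m A ^+ i *m B) *m (c *m A ^+ i *m B)^T).
  exact: mx11_ge0_tr.
by rewrite !trmx_mul !mulmxA.
Qed.

End lyapunov.

Section stationary_loss.
Variables (R : realType) (dx dy : nat).
Variables (A Bw : 'M[R]_dx) (C : 'M[R]_(dy, dx)) (Dv : 'M[R]_dy) (X : 'M[R]_dx).

(* stationary mean square of [y_(t+i+1) - g y_t]; [X] is the state covariance *)
Definition block_loss (i : nat) (g : 'M[R]_dy) : R :=
  \sum_(k < i.+1) fsq (C *m A ^+ k *m Bw)
  + \tr ((C *m A ^+ i.+1 - g *m C) *m X *m (C *m A ^+ i.+1 - g *m C)^T)
  + fsq (g *m Dv) + fsq Dv.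

Definition stationary_loss (H : nat) (G : 'M[R]_(\sum_(i < H) dy, dy)) : R :=
  \sum_(i < H) block_loss i (submxcol G i).

(** The loss is quadratic in [g]: each of its two [g]-dependent traces contributes two cross terms
    and one square, and [c] adds up their six coefficients. *)
Lemma block_loss_perturb i (g : 'M[R]_dy) : exists2 c : R, 0 <= c &
  forall e, `|block_loss i (g + e) - block_loss i g| <= c * (nm e + nm e ^+ 2).
Proof.
pose W := C *m A ^+ i.+1 - g *m C.
pose c := nm C * nm X * nm W + nm W * nm X * nm C + nm C * nm X * nm C +
  (nm Dv * nm Dv * nm g + nm g * nm Dv * nm Dv + nm Dv * nm Dv).
exists c; first by rewrite /c !addr_ge0 ?mulr_ge0 ?nm_ge0.
move=> e; have WE : C *m A ^+ i.+1 - (g + e) *m C = W - e *m C.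
  by rewrite /W mulmxDl opprD addrA.
have trE (p q : nat) (a b : 'M[R]_(p, q)) (Y : 'M[R]_q) :
    \tr ((a + b) *m Y *m (a + b)^T) =
    \tr (a *m Y *m a^T) + \tr (a *m Y *m b^T) + \tr (b *m Y *m a^T) +
    \tr (b *m Y *m b^T).
  rewrite linearD/= !mulmxDl !mulmxDr !mxtraceD; lra.
have nm3 (p q : nat) (a b : 'M[R]_(p, q)) (Y : 'M[R]_q) :
    `|\tr (a *m Y *m b^T)| <= nm a * nm Y * nm b.
  rewrite (le_trans (ler_mxtrace_nm _))// (le_trans (ler_nmM _ _))// nm_tr.
  by rewrite ler_wpM2r ?nm_ge0 ?ler_nmM.
have fE (a : 'M[R]_dy) : fsq (a *m Dv) = \tr (a *m (Dv *m Dv^T) *m a^T).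
  by rewrite fsq_mxtrace trmx_mul !mulmxA.
rewrite /block_loss WE !fE -/W (trE _ _ W) (trE _ _ g).
have nD : nm (Dv *m Dv^T) <= nm Dv * nm Dv by rewrite -[X in _ <= _ * X](nm_tr Dv) ler_nmM.
have neC : nm (- (e *m C)) <= nm e * nm C by rewrite nmN ler_nmM.
have e0 := nm_ge0 e; have g0 := nm_ge0 g; have W0 := nm_ge0 W.
have X0 := nm_ge0 X; have C0 := nm_ge0 C; have Dv0 := nm_ge0 Dv.
have b1 : `|\tr (W *m X *m (- (e *m C))^T)| <= nm W * nm X * nm C * nm e.
  rewrite (le_trans (nm3 _ _ _ _ _))//.
  rewrite (_ : _ * nm e = nm W * nm X * (nm e * nm C)); last by ring.
  by rewrite ler_wpM2l ?mulr_ge0.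
have b2 : `|\tr (- (e *m C) *m X *m W^T)| <= nm C * nm X * nm W * nm e.
  rewrite (le_trans (nm3 _ _ _ _ _))//.
  rewrite (_ : _ * nm e = nm e * nm C * nm X * nm W); last by ring.
  by rewrite !ler_wpM2r.
have b3 : `|\tr (- (e *m C) *m X *m (- (e *m C))^T)| <=
    nm C * nm X * nm C * nm e ^+ 2.
  rewrite (le_trans (nm3 _ _ _ _ _))//.
  rewrite (_ : _ * nm e ^+ 2 = nm e * nm C * nm X * (nm e * nm C)); last by ring.
  by rewrite ler_pM ?mulr_ge0 ?nm_ge0// ler_wpM2r.
have b4 : `|\tr (g *m (Dv *m Dv^T) *m e^T)| <= nm g * nm Dv * nm Dv * nm e.
  rewrite (le_trans (nm3 _ _ _ _ _))// ler_wpM2r// -mulrA.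
  by rewrite ler_wpM2l.
have b5 : `|\tr (e *m (Dv *m Dv^T) *m g^T)| <= nm Dv * nm Dv * nm g * nm e.
  rewrite (le_trans (nm3 _ _ _ _ _))//.
  rewrite (_ : _ * nm e = nm e * (nm Dv * nm Dv) * nm g); last by ring.
  by rewrite ler_wpM2r// ler_wpM2l.
have b6 : `|\tr (e *m (Dv *m Dv^T) *m e^T)| <= nm Dv * nm Dv * nm e ^+ 2.
  rewrite (le_trans (nm3 _ _ _ _ _))//.
  rewrite (_ : _ * nm e ^+ 2 = nm e * (nm Dv * nm Dv) * nm e); last by ring.
  by rewrite ler_wpM2r// ler_wpM2l.
move: b1 b2 b3 b4 b5 b6; rewrite !ler_norml /c.
set c1 := nm W * nm X * nm C; set c2 := nm C * nm X * nm W.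
set c3 := nm C * nm X * nm C; set c4 := nm g * nm Dv * nm Dv.
set c5 := nm Dv * nm Dv * nm g; set c6 := nm Dv * nm Dv.
have [p1 p2 p3] : [/\ 0 <= c1 * nm e ^+ 2, 0 <= c2 * nm e ^+ 2 & 0 <= c3 * nm e].
  by rewrite !mulr_ge0 ?sqr_ge0.
have [p4 p5 p6] : [/\ 0 <= c4 * nm e ^+ 2, 0 <= c5 * nm e ^+ 2 & 0 <= c6 * nm e].
  by rewrite !mulr_ge0 ?sqr_ge0.
move=> /andP[? ?] /andP[? ?] /andP[? ?] /andP[? ?] /andP[? ?] /andP[? ?].
by apply/andP; split; lra.
Qed.

(** (F + e)^(k+1) - F^(k+1) = (F + e)((F + e)^k - F^k) + e F^k. The factor [(1 + nm e) ^+ k] keeps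
    the bound valid for large [e], as the estimation error is unbounded. *)
Lemma power_perturb (F : 'M[R]_dy) k : exists2 c : R, 0 <= c &
  forall e, nm ((F + e) ^+ k - F ^+ k) <= c * nm e * (1 + nm e) ^+ k.
Proof.
elim: k => [|k [c c0 IHk]]; first by exists 0 => // e; rewrite subrr nm0 !mul0r.
exists ((nm F + 1) * c + nm (F ^+ k)) => [|e].
  by rewrite addr_ge0 ?mulr_ge0 ?addr_ge0 ?nm_ge0.
have -> : (F + e) ^+ k.+1 - F ^+ k.+1 =
    (F + e) *m ((F + e) ^+ k - F ^+ k) + e *m F ^+ k.
  by rewrite !exprS -!mulmxE mulmxBr (mulmxDl F e (F ^+ k)) opprD addrA subrK.
have x0 := nm_ge0 e; have F0 := nm_ge0 F; have Fk0 := nm_ge0 (F ^+ k).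
set x := nm e in x0 *.
have pk1 : 1 <= (1 + x) ^+ k.+1 by rewrite exprn_ege1// lerDl.
have pk0 : 0 <= (1 + x) ^+ k by rewrite exprn_ge0// addr_ge0.
rewrite (le_trans (ler_nmD _ _))// mulrDl mulrDl lerD//.
  rewrite (le_trans (ler_nmM _ _))//.
  rewrite (le_trans (ler_pM (nm_ge0 _) (nm_ge0 _) (ler_nmD _ _) (IHk e)))//.
  rewrite -/x exprS.
  rewrite (_ : _ * c * x * _ = ((nm F + 1) * (1 + x)) * (c * x * (1 + x) ^+ k)); last by ring.
  rewrite ler_wpM2r ?mulr_ge0//; nra.
rewrite (le_trans (ler_nmM _ _))// -/x mulrC -[leLHS]mulr1.
by rewrite ler_wpM2l// mulr_ge0.
Qed.

(** The perturbation x (1 + x)^H of a power enters squared, as x^2 (1 + x)^(2H); one x is absorbed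
    in 1 + x, whence the exponent 2H + 1. The remaining factor x will vanish, the polynomial one
    will only be bounded in moments. *)
Lemma stationary_loss_perturb H (F : 'M[R]_dy) : exists2 c : R, 0 <= c &
  forall e, `|stationary_loss (power_stack H (F + e)) -
              stationary_loss (power_stack H F)| <=
    c * nm e * (1 + nm e) ^+ (2 * H).+1.
Proof.
have block i : exists2 c : R, 0 <= c & forall e, (i < H)%N ->
    `|block_loss i ((F + e) ^+ i.+1) - block_loss i (F ^+ i.+1)| <=
    c * nm e * (1 + nm e) ^+ (2 * H).+1.
  have [a a0 aP] := power_perturb F i.+1.
  have [b b0 bP] := block_loss_perturb i (F ^+ i.+1).
  exists (b * (a + a ^+ 2)) => [|e iH]; first by rewrite mulr_ge0// addr_ge0// sqr_ge0.
  have := bP ((F + e) ^+ i.+1 - F ^+ i.+1).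
  rewrite [F ^+ i.+1 + _]addrC subrK => /le_trans; apply.
  have x0 := nm_ge0 e; set x := nm e in x0 *.
  set D := nm (_ - _); have D0 : 0 <= D by exact: nm_ge0.
  have Dle : D <= a * x * (1 + x) ^+ H.
    rewrite (le_trans (aP e))// ler_wpM2l ?mulr_ge0//.
    by rewrite ler_weXn2l// lerDl.
  rewrite -2!mulrA ler_wpM2l// mulrDl lerD//.
    apply: le_trans Dle _; rewrite -mulrA ler_wpM2l// ler_wpM2l//.
    by rewrite ler_weXn2l ?lerDl// mul2n -addnn leqW// leq_addl.
  apply: (@le_trans _ _ ((a * x * (1 + x) ^+ H) ^+ 2)).
    by rewrite lerXn2r// nnegrE// (le_trans D0).
  have -> : (a * x * (1 + x) ^+ H) ^+ 2 = a ^+ 2 * (x * (x * ((1 + x) ^+ H) ^+ 2)).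
    by ring.
  rewrite ler_wpM2l ?sqr_ge0// ler_wpM2l// -exprM mulnC exprS ler_wpM2r//.
    by rewrite exprn_ge0// addr_ge0.
  lra.
pose c i := sval (cid2 (block i)).
have c0 i : 0 <= c i by rewrite /c; case: cid2.
exists (\sum_(i < H) c i) => [|e]; first exact: sumr_ge0.
rewrite /stationary_loss /power_stack.
under eq_bigr do rewrite mxcolK; under [X in _ - X]eq_bigr do rewrite mxcolK.
rewrite -sumrB (le_trans (ler_norm_sum _ _ _))// 2!mulr_suml.
apply: ler_sum => i _; rewrite /c; case: cid2 => k /= _; exact.
Qed.

End stationary_loss.

(** * The stationary loss in innovations form *)

Section innovations_form.
Variables (R : realType) (dx dy : nat).
Variables (A Bw : 'M[R]_dx) (C : 'M[R]_(dy, dx)) (Dv : 'M[R]_dy).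
Variables (r : R) (S : 'M[R]_dx) (De : 'M[R]_dy).
Hypothesis Ar : forall k, \sum_(i < k) nm (A ^+ i) <= r.
Hypothesis S_riccati : stabilizing_riccati A Bw C Dv S.
Hypothesis De_sqrt : is_psd_sqrt De (innovation_cov C Dv S).
Local Notation K := (kalman_gain A C Dv S).
Local Notation Re := (innovation_cov C Dv S).

Let S_sym : S^T = S. Proof. by case: S_riccati. Qed.

Let De_sqr : De *m De^T = Re.
Proof. by case: De_sqrt => -[-> _]. Qed.

Let Re_sym : Re^T = Re.
Proof. by rewrite -De_sqr trmx_mul trmxK. Qed.

Let KRe : K *m Re = A *m S *m C^T.
Proof. by case: S_riccati => _ Ru _ _; rewrite mulmxKV. Qed.

Let ReK : Re *m K^T = C *m S *m A^T.
Proof. by rewrite -Re_sym -trmx_mul KRe !trmx_mul trmxK S_sym mulmxA. Qed.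

Let riccatiE : S = A *m S *m A^T + (Bw *m Bw^T - K *m Re *m K^T).
Proof.
case: S_riccati => _ _ SE _; rewrite {1}SE addrAC -addrA; congr (_ + (_ - _)).
by rewrite -[RHS]mulmxA ReK /kalman_gain !mulmxA.
Qed.

(** By the Riccati equation [S] solves a Lyapunov equation with source [Bw Bw^T - K Re K^T], while
    [Sigma_xh] has source [K Re K^T]; their sum has source [Bw Bw^T]. *)
Lemma innovations_state_cov Sigma_xh Sigma_x :
  stationary_cov A (K *m De) Sigma_xh -> stationary_cov A Bw Sigma_x ->
  Sigma_x = S + Sigma_xh.
Proof.
move=> xhE xE; apply: (lyapunov_unique Ar xE).
have KDe : K *m De *m (K *m De)^T = K *m Re *m K^T.
  by rewrite trmx_mul -De_sqr !mulmxA.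
rewrite /stationary_cov {1}riccatiE {1}xhE KDe addrACA subrK.
by rewrite mulmxDr mulmxDl.
Qed.

Let mxtrace_sqrB q n (a b : 'M[R]_(q, n)) (Y : 'M[R]_n) : Y^T = Y ->
  \tr ((a - b) *m Y *m (a - b)^T) = \tr (a *m Y *m a^T) - \tr (a *m Y *m b^T)
    - \tr (a *m Y *m b^T) + \tr (b *m Y *m b^T).
Proof.
move=> Ysym; have ba : \tr (b *m Y *m a^T) = \tr (a *m Y *m b^T).
  by rewrite -mxtrace_tr !trmx_mul trmxK Ysym mulmxA.
rewrite linearB/= !mulmxBl !mulmxBr !raddfB/= ba; lra.
Qed.

(** Once [Sigma_xh] is split off only terms in [S] remain. Unrolling the Riccati equation [i + 1]
    times under [C] trades the process noise terms [C A^k Bw] for the innovation terms [C A^k K De];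
    the cross terms with [g] agree because [K Re = A S C^T]. *)
Lemma innovations_block Sigma_xh Sigma_x i (g : 'M[R]_dy) :
  stationary_cov A (K *m De) Sigma_xh -> stationary_cov A Bw Sigma_x ->
  \tr ((C *m A ^+ i.+1 - g *m C) *m Sigma_xh *m (C *m A ^+ i.+1 - g *m C)^T)
  + fsq ((C *m A ^+ i *m K - g) *m De)
  + (fsq De + \sum_(k < i) fsq (C *m A ^+ k *m K *m De)) =
  block_loss A Bw C Dv Sigma_x i g.
Proof.
move=> xhE xE; rewrite (innovations_state_cov xhE xE) /block_loss.
have fDe (q : nat) (a : 'M[R]_(q, dy)) : fsq (a *m De) = \tr (a *m Re *m a^T).
  by rewrite fsq_mxtrace trmx_mul -De_sqr !mulmxA.
have fDe1 : fsq De = \tr (C *m S *m C^T) + fsq Dv.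
  by rewrite 2!fsq_mxtrace De_sqr -mxtraceD.
set Q := C *m A ^+ i.+1 - g *m C.
rewrite (mulmxDr Q S) (mulmxDl _ _ Q^T) mxtraceD fDe fDe1.
set P := C *m A ^+ i.
have PA : C *m A ^+ i.+1 = P *m A by rewrite exprSr -mulmxE mulmxA.
set U := P *m A *m S *m C^T *m g^T.
have trQ : \tr (Q *m S *m Q^T) = \tr (P *m (A *m S *m A^T) *m P^T) - \tr U - \tr U
    + \tr (g *m (C *m S *m C^T) *m g^T).
  rewrite /Q PA mxtrace_sqrB//; congr (_ - _ - _ + _); congr (\tr _).
  - by rewrite trmx_mul !mulmxA.
  - by rewrite trmx_mul !mulmxA.
  - by rewrite trmx_mul !mulmxA.
  - by rewrite trmx_mul !mulmxA.
have trP : \tr ((P *m K - g) *m Re *m (P *m K - g)^T) =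
    \tr (P *m (K *m Re *m K^T) *m P^T) - \tr U - \tr U
    + \tr (g *m (C *m S *m C^T) *m g^T) + fsq (g *m Dv).
  have UE : P *m K *m Re *m g^T = U by rewrite -[P *m K *m Re]mulmxA KRe !mulmxA.
  rewrite mxtrace_sqrB// UE -[RHS]addrA; congr (_ - _ - _ + _).
    by rewrite trmx_mul !mulmxA.
  by rewrite fsq_mxtrace -mxtraceD trmx_mul mulmxDr mulmxDl !mulmxA.
have trS : \tr (C *m S *m C^T) = \tr (P *m (A *m S *m A^T) *m P^T)
    + \sum_(k < i.+1) fsq (C *m A ^+ k *m Bw)
    - \sum_(k < i.+1) fsq (C *m A ^+ k *m K *m De).
  rewrite {1}(lyapunov_iter i.+1 riccatiE) mulmxDr mulmxDl mxtraceD -addrA.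
  congr (_ + _).
    rewrite /P exprSr -mulmxE !trmx_mul !mulmxA; congr (\tr _).
  rewrite mulmx_sumr mulmx_suml raddf_sum -sumrB; apply: eq_bigr => k _ /=.
  rewrite fDe fsq_mxtrace -raddfB/=; congr (\tr _).
  by rewrite !trmx_mul !(mulmxBl, mulmxBr) !mulmxA.
have sumE : \sum_(k < i.+1) fsq (C *m A ^+ k *m K *m De) =
    \sum_(k < i) fsq (C *m A ^+ k *m K *m De) + \tr (P *m (K *m Re *m K^T) *m P^T).
  by rewrite big_ord_recr/= -/P fDe trmx_mul !mulmxA.
rewrite trQ trP trS sumE; lra.
Qed.

Lemma innovations_formula (H : nat) Sigma_xh Sigma_x (F : 'M[R]_dy) :
  stationary_cov A (K *m De) Sigma_xh -> stationary_cov A Bw Sigma_x ->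
  let Phi := Phi_mx A C H K in
  let M := Gstar_mx A C H K - power_stack H F in
  \tr ((Phi + M *m C) *m Sigma_xh *m (Phi + M *m C)^T)
   + \tr (M *m De *m De^T *m M^T)
   + frobenius_norm (Gamma_mx A C H K De) ^+ 2 =
  stationary_loss A Bw C Dv Sigma_x (power_stack H F).
Proof.
move=> xhE xE /=.
have ME : Gstar_mx A C H K - power_stack H F =
    \mxcol_(i < H) (C *m A ^+ i *m K - F ^+ i.+1) by rewrite mxcolB.
(* The terms [C A^i K C] of [Phi] and of [Gstar *m C] cancel. *)
have PhiE : Phi_mx A C H K + (Gstar_mx A C H K - power_stack H F) *m C =
    \mxcol_(i < H) (C *m A ^+ i.+1 - F ^+ i.+1 *m C).
  rewrite ME mxcol_mul -mxcolD; apply: eq_mxcol => i.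
  rewrite mulmxBr mulmxBl (exprSr A) -mulmxE !mulmxA addrA; congr (_ - _).
  by rewrite subrK.
rewrite PhiE ME mxtrace_mxcol frobenius_normE fsq_mxblock.
rewrite -[X in _ + \tr X + _]mulmxA -trmx_mul -fsq_mxtrace mxcol_mul fsq_mxcol.
rewrite -!big_split; apply: eq_bigr => i _ /=.
rewrite /power_stack mxcolK -(innovations_block i (F ^+ i.+1) xhE xE).
congr (_ + _).
(* Row [i] of the innovation matrix has [De] on the diagonal, zeros to its right, and to its left
   the terms [h] of index i - 1 down to 0. *)
pose h j := fsq (C *m A ^+ j *m K *m De).
pose f j := if (j < i)%N then h (i - j - 1)%N else if j == i :> nat then fsq De else 0.
rewrite (eq_bigr (fun j : 'I_H => f j)); last first.
  move=> j _; rewrite /f /h; case: ifP => // _; rewrite -val_eqE/= eq_sym.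
  by case: ifP => // _; rewrite /fsq big1// => a _; rewrite big1// => b _; rewrite mxE expr0n.
rewrite -(big_mkord xpredT f) (big_cat_nat _ (n := i))//=; last exact: ltnW.
rewrite [X in _ + X]big_ltn// {2}/f ltnn eqxx [X in _ + (_ + X)]big_nat_cond.
rewrite [X in _ + (_ + X)]big1 ?addr0 => [|j /andP[/andP[ij _] _]]; last first.
  by rewrite /f ltnNge (ltnW ij) gtn_eqF.
rewrite addrC; congr (_ + _); rewrite -(big_mkord xpredT h) [RHS]big_nat_rev add0n.
rewrite big_nat [RHS]big_nat; apply: eq_bigr => j /andP[_ ji].
by rewrite /f ji -subnDA addn1.
Qed.

End innovations_form.

(** * Exact second moments of a rollout and the limit defining the loss *)

Section system_second_moments.
Context d (T : measurableType d) (R : realType) (P : probability T R).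
Variables (dx dy : nat) (A Bw : 'M[R]_dx) (C : 'M[R]_(dy, dx)) (Dv : 'M[R]_dy).
Variables (w : nat -> T -> 'cV[R]_dx) (v : nat -> T -> 'cV[R]_dy).
Hypothesis wvP : iid_std_gaussian_noises P w v.
Local Notation xi := (noise w v).
Local Notation x := (state A Bw w).
Local Notation y := (output A Bw C Dv w v).

Let xiP : iid_normal P xi := noise_iid_normal wvP.

Lemma measurable_off_w k t i : k != inl (t, i) ->
  measurable_fun [set: off xi k] (fun om : off xi k => w t om i 0).
Proof. by rewrite eq_sym; exact: (@measurable_off _ _ _ _ xi k (inl (t, i))). Qed.

Lemma measurable_off_v k t i : k != inr (t, i) ->
  measurable_fun [set: off xi k] (fun om : off xi k => v t om i 0).
Proof. by rewrite eq_sym; exact: (@measurable_off _ _ _ _ xi k (inr (t, i))). Qed.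

Lemma measurable_mulmx_coord d' (U : measurableType d') n p (M : 'M[R]_(n, p))
    (X : U -> 'cV[R]_p) i :
  (forall j, measurable_fun [set: U] (fun om => X om j 0)) ->
  measurable_fun [set: U] (fun om => (M *m X om) i 0).
Proof.
move=> mX; under eq_fun do rewrite mxE.
by apply: measurable_sum => j; exact: measurable_funM.
Qed.

(* state [x t] only involves [w 0], ..., [w (t - 1)] *)
Definition state_free (k : noise_index dx dy) (t : nat) : bool :=
  if k is inl (s, _) then (t <= s)%N else true.

Lemma measurable_off_state k t i : state_free k t ->
  measurable_fun [set: off xi k] (fun om : off xi k => x t om i 0).
Proof.
elim: t i => [|t IHt] i kt /=; first exact: measurable_cst.
under eq_fun do rewrite mxE.
apply: measurable_funD; apply: measurable_mulmx_coord => j.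
  by apply: IHt; move: kt; case: (k) => // -[s ?] /=; exact: ltnW.
apply: measurable_off_w; apply/eqP => kE.
by move: kt; rewrite kE /= ltnn.
Qed.

Lemma measurable_w t i : measurable_fun [set: T] (fun om => w t om i 0).
Proof. exact: (xiP.1 (inl (t, i))). Qed.

Lemma measurable_v t i : measurable_fun [set: T] (fun om => v t om i 0).
Proof. exact: (xiP.1 (inr (t, i))). Qed.

Lemma measurable_state t i : measurable_fun [set: T] (fun om => x t om i 0).
Proof.
elim: t i => [|t IHt] i /=; first exact: measurable_cst.
under eq_fun do rewrite mxE.
by apply: measurable_funD; apply: measurable_mulmx_coord => j //; exact: measurable_w.
Qed.

Lemma measurable_output t i : measurable_fun [set: T] (fun om => y t om i 0).
Proof.
rewrite /output; under eq_fun do rewrite mxE.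
apply: measurable_funD; apply: measurable_mulmx_coord => j.
  exact: measurable_state.
exact: measurable_v.
Qed.

Lemma integral_sqr_addw t (c : 'rV[R]_dx) (f : T -> R) :
  (forall j, measurable_fun [set: off xi (inl (t, j))] (f : off xi (inl (t, j)) -> R)) ->
  measurable_fun setT f ->
  (\int[P]_om ((f om + (c *m w t om) 0 0) ^+ 2)%:E =
   \int[P]_om (f om ^+ 2)%:E + (fsq c)%:E)%E.
Proof.
move=> mf mfT.
have := @integral_off_sqr_sum _ _ _ _ _ _ xiP _ (enum 'I_dx)
  (fun j => inl (t, j)) (fun j => c 0 j) f (enum_uniq _) _ mf mfT.
rewrite /fsq big_ord1 !big_enum/= => <-; last by move=> ? ? [].
by apply: eq_integral => om _; rewrite mxE big_enum.
Qed.

Lemma integral_sqr_addv t (c : 'rV[R]_dy) (f : T -> R) :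
  (forall j, measurable_fun [set: off xi (inr (t, j))] (f : off xi (inr (t, j)) -> R)) ->
  measurable_fun setT f ->
  (\int[P]_om ((f om + (c *m v t om) 0 0) ^+ 2)%:E =
   \int[P]_om (f om ^+ 2)%:E + (fsq c)%:E)%E.
Proof.
move=> mf mfT.
have := @integral_off_sqr_sum _ _ _ _ _ _ xiP _ (enum 'I_dy)
  (fun j => inr (t, j)) (fun j => c 0 j) f (enum_uniq _) _ mf mfT.
rewrite /fsq big_ord1 !big_enum/= => <-; last by move=> ? ? [].
by apply: eq_integral => om _; rewrite mxE big_enum.
Qed.

Lemma integral_sqr_state t (c : 'rV[R]_dx) :
  (\int[P]_om ((c *m x t om) 0 0 ^+ 2)%:E =
   (\sum_(k < t) fsq (c *m A ^+ k *m Bw))%:E)%E.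
Proof.
elim: t c => [|t IHt] c.
  rewrite big_ord0; under eq_integral do rewrite /= mulmx0 mxE expr0n.
  by rewrite integral0.
under eq_integral do rewrite /= mulmxDr mxE !mulmxA.
rewrite integral_sqr_addw.
- rewrite IHt -EFinD big_ord_recl expr0 mulmx1 addrC; congr (_ + _)%:E.
  by apply: eq_bigr => k _; rewrite lift0 exprS -mulmxE !mulmxA.
- by move=> j; apply: measurable_mulmx_coord => i; apply: measurable_off_state => /=.
- by apply: measurable_mulmx_coord => i; exact: measurable_state.
Qed.

(** Induction on [m] integrates out the last process noise of the forecast window. At [m = 0] the
    two state terms merge, which is the origin of the coefficient [c *m A ^+ m + b]. *)
Lemma integral_sqr_forecast m t (c b : 'rV[R]_dx) (h : 'rV[R]_dy) :
  (\int[P]_om (((c *m x (t + m)%N om) 0 0 + (b *m x t om) 0 0 +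
     (h *m v t om) 0 0) ^+ 2)%:E =
   (\sum_(k < m) fsq (c *m A ^+ k *m Bw) +
    \sum_(k < t) fsq ((c *m A ^+ m + b) *m A ^+ k *m Bw) + fsq h)%:E)%E.
Proof.
elim: m c => [|m IHm] c.
  rewrite addn0 big_ord0 add0r.
  under eq_integral => om _.
    rewrite (_ : (c *m x t om) 0 0 + (b *m x t om) 0 0 = ((c + b) *m x t om) 0 0).
      over.
    by rewrite mulmxDl [RHS]mxE.
  rewrite integral_sqr_addv.
  - by rewrite integral_sqr_state -EFinD expr0 mulmx1.
  - by move=> j; apply: measurable_mulmx_coord => i; apply: measurable_off_state.
  - by apply: measurable_mulmx_coord => i; exact: measurable_state.
rewrite addnS.
under eq_integral => om _.
  rewrite (_ : _ + _ + _ = ((c *m A *m x (t + m)%N om) 0 0 + (b *m x t om) 0 0 +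
    (h *m v t om) 0 0) + (c *m Bw *m w (t + m)%N om) 0 0).
    over.
  rewrite /= mulmxDr !mulmxA [X in X + _ + _]mxE; ring.
rewrite integral_sqr_addw.
- rewrite IHm -EFinD big_ord_recl expr0 mulmx1; congr _%:E.
  have -> : \sum_(k < m) fsq (c *m A ^+ (lift ord0 k) *m Bw) =
      \sum_(k < m) fsq (c *m A *m A ^+ k *m Bw).
    by apply: eq_bigr => k _; rewrite lift0 exprS -mulmxE !mulmxA.
  rewrite exprS -mulmxE mulmxA; ring.
- move=> j; apply: measurable_funD; first apply: measurable_funD.
  + by apply: measurable_mulmx_coord => i; apply: measurable_off_state => /=.
  + by apply: measurable_mulmx_coord => i; apply: measurable_off_state; rewrite /= leq_addr.
  + by apply: measurable_mulmx_coord => i; apply: measurable_off_v.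
- apply: measurable_funD; first apply: measurable_funD.
  + by apply: measurable_mulmx_coord => i; exact: measurable_state.
  + by apply: measurable_mulmx_coord => i; exact: measurable_state.
  + by apply: measurable_mulmx_coord => i; exact: measurable_v.
Qed.

Lemma integral_sqr_block t i (g : 'M[R]_dy) :
  (\int[P]_om (fsq (y (t + i.+1)%N om - g *m y t om))%:E =
   (\sum_(k < i.+1) fsq (C *m A ^+ k *m Bw) +
    \sum_(k < t) fsq ((C *m A ^+ i.+1 - g *m C) *m A ^+ k *m Bw) +
    fsq (g *m Dv) + fsq Dv)%:E)%E.
Proof.
pose c r := row r C; pose b r := - row r (g *m C); pose h r := - row r (g *m Dv).
have rowE (r : 'I_dy) om : (y (t + i.+1)%N om - g *m y t om) r 0 =
    (c r *m x (t + i.+1)%N om) 0 0 + (b r *m x t om) 0 0 + (h r *m v t om) 0 0 +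
    (row r Dv *m v (t + i.+1)%N om) 0 0.
  have rE p (M : 'M[R]_(dy, p)) (X : 'cV[R]_p) : (row r M *m X) 0 0 = (M *m X) r 0 :> R.
    by rewrite -row_mul mxE.
  have NE p (M : 'M[R]_(dy, p)) (X : 'cV[R]_p) : (- row r M *m X) 0 0 = - (M *m X) r 0.
    by rewrite mulNmx mxE rE.
  have DE (X Y : 'cV[R]_dy) : (X + Y) r 0 = X r 0 + Y r 0 by rewrite mxE.
  have BE (X Y : 'cV[R]_dy) : (X - Y) r 0 = X r 0 - Y r 0 by rewrite mxE [X in _ + X]mxE.
  rewrite /c /b /h !NE !rE /output BE mulmxDr !DE !mulmxA; ring.
have mfun r : measurable_fun [set: T] (fun om => (y (t + i.+1)%N om - g *m y t om) r 0).
  under eq_fun do rewrite mxE [X in _ + X]mxE.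
  apply: measurable_funB; first exact: measurable_output.
  by apply: measurable_mulmx_coord => j; exact: measurable_output.
under eq_integral => om _.
  rewrite /fsq; under eq_bigr do rewrite big_ord1.
  rewrite -sumEFin; over.
rewrite ge0_integral_sum//; last 2 first.
- by move=> r; apply/measurable_EFinP; exact: measurable_funX.
- by move=> r om _; rewrite lee_fin sqr_ge0.
rewrite (eq_bigr (fun r => (\sum_(k < i.+1) fsq (row r (C *m A ^+ k *m Bw)) +
    \sum_(k < t) fsq (row r ((C *m A ^+ i.+1 - g *m C) *m A ^+ k *m Bw)) +
    fsq (row r (g *m Dv)) + fsq (row r Dv))%:E)); last first.
  move=> r _; under eq_integral do rewrite rowE.
  rewrite integral_sqr_addv.
  - rewrite integral_sqr_forecast -EFinD /c /b /h; congr (_ + _ + _ + _)%:E.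
    + by apply: eq_bigr => k _; rewrite !row_mul.
    + by apply: eq_bigr => k _; rewrite !row_mul linearB/= !row_mul.
    + by rewrite fsqN.
  - move=> j; apply: measurable_funD; first apply: measurable_funD.
    + by apply: measurable_mulmx_coord => l; apply: measurable_off_state.
    + by apply: measurable_mulmx_coord => l; apply: measurable_off_state.
    + apply: measurable_mulmx_coord => l; apply: measurable_off_v.
      apply/eqP => -[E _]; have : (t < t + i.+1)%N by rewrite addnS ltnS leq_addr.
      by rewrite E ltnn.
  - apply: measurable_funD; first apply: measurable_funD.
    + by apply: measurable_mulmx_coord => l; exact: measurable_state.
    + by apply: measurable_mulmx_coord => l; exact: measurable_state.
    + by apply: measurable_mulmx_coord => l; exact: measurable_v.
rewrite sumEFin; congr _%:E; rewrite !big_split /= !fsq_row_sum.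
congr (_ + _ + _ + _); rewrite exchange_big; apply: eq_bigr => k _ /=;
  exact: fsq_row_sum.
Qed.

(** Started at 0, the state covariance at time t is [X] minus A^t X (A^t)^T, so the mean square
    [l t] differs from its stationary value by a multiple of [nm (A ^+ t) ^+ 2]. These are summable,
    and the averages are within O(1/n) of the limit. *)
Lemma loss_stationary (r : R) H (X : 'M[R]_dx) (G : 'M[R]_(\sum_(i < H) dy, dy)) :
  (forall k, \sum_(i < k) nm (A ^+ i) <= r) -> stationary_cov A Bw X ->
  loss P y G = (stationary_loss A Bw C Dv X G)%:E.
Proof.
move=> Ar XE.
pose l t := \sum_(i < H) (\sum_(k < i.+1) fsq (C *m A ^+ k *m Bw) +
  \sum_(k < t) fsq ((C *m A ^+ i.+1 - submxcol G i *m C) *m A ^+ k *m Bw) +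
  fsq (submxcol G i *m Dv) + fsq Dv).
set L := stationary_loss A Bw C Dv X G.
have sqE t om : euclidean_norm (future y H t om - G *m y t om) ^+ 2 =
    \sum_(i < H) fsq (y (t + i.+1)%N om - submxcol G i *m y t om).
  rewrite /euclidean_norm frobenius_normE /future.
  by rewrite -{1}(submxcolK G) mxcol_mul -mxcolB fsq_mxcol.
have mfun t (i : 'I_H) : measurable_fun [set: T]
    (fun om => (fsq (y (t + i.+1)%N om - submxcol G i *m y t om))%:E).
  apply/measurable_EFinP; rewrite /fsq; apply: measurable_sum => j.
  under eq_fun do rewrite big_ord1.
  apply: measurable_funX; under eq_fun do rewrite mxE [X in _ + X]mxE.
  apply: measurable_funB; first exact: measurable_output.
  by apply: measurable_mulmx_coord => k; exact: measurable_output.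
have f0 t (i : 'I_H) om : (0 <= (fsq (y (t + i.+1)%N om - submxcol G i *m y t om))%:E)%E.
  by rewrite lee_fin fsq_ge0.
have msum t : measurable_fun [set: T] (fun om => (\sum_(i < H)
    (fsq (y (t + i.+1)%N om - submxcol G i *m y t om))%:E)%E).
  exact: emeasurable_sum.
have EE n : 'E_P[fun om => (n%:R^-1 * \sum_(0 <= t < n.+1)
    euclidean_norm (future y H t om - G *m y t om) ^+ 2)%R]%E =
    (n%:R^-1 * \sum_(0 <= t < n.+1) l t)%:E.
  rewrite unlock EFinM -sumEFin.
  transitivity (\int[P]_om (n%:R^-1%:E * \sum_(0 <= t < n.+1) \sum_(i < H)
      (fsq (y (t + i.+1)%N om - submxcol G i *m y t om))%:E))%E.
    apply: eq_integral => om _; rewrite EFinM -sumEFin; congr (_ * _)%E.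
    by apply: eq_bigr => t _; rewrite sqE sumEFin.
  rewrite ge0_integralZl_EFin//; last 2 first.
  - by move=> om _; apply: sume_ge0 => t _; apply: sume_ge0.
  - exact: emeasurable_sum.
  congr (_ * _)%E; rewrite ge0_integral_sum//; last first.
    by move=> t om _; exact: sume_ge0.
  apply: eq_bigr => t _; rewrite ge0_integral_sum// /l -sumEFin.
  by apply: eq_bigr => i _; rewrite integral_sqr_block.
have [c c0 lc] : exists2 c, 0 <= c & forall t, `|l t - L| <= c * nm (A ^+ t) ^+ 2.
  pose Q (i : 'I_H) := C *m A ^+ i.+1 - submxcol G i *m C.
  exists (\sum_(i < H) nm (Q i) * nm X * nm (Q i)) => [|t].
    by apply: sumr_ge0 => i _; rewrite !mulr_ge0 ?nm_ge0.
  have -> : l t - L = - \sum_(i < H) \tr (Q i *m (A ^+ t *m X *m (A ^+ t)^T) *m (Q i)^T).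
    rewrite /L /stationary_loss -sumrB -sumrN; apply: eq_bigr => i _.
    rewrite /block_loss -/(Q i) {1}(lyapunov_iter t XE) (mulmxDr (Q i)).
    rewrite (mulmxDl _ _ (Q i)^T) mxtraceD.
    rewrite mulmx_sumr mulmx_suml raddf_sum /=.
    have -> : \sum_(k < t) \tr (Q i *m (A ^+ k *m (Bw *m Bw^T) *m (A ^+ k)^T) *m (Q i)^T) =
        \sum_(k < t) fsq (Q i *m A ^+ k *m Bw).
      by apply: eq_bigr => k _; rewrite fsq_mxtrace !trmx_mul !mulmxA.
    ring.
  rewrite normrN (le_trans (ler_norm_sum _ _ _))// mulr_suml.
  apply: ler_sum => i _; rewrite (le_trans (ler_mxtrace_nm _))//.
  rewrite (le_trans (ler_nmM _ _))// nm_tr.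
  rewrite (le_trans (ler_wpM2r (nm_ge0 _) (ler_nmM _ _)))//.
  rewrite (le_trans (ler_wpM2r (nm_ge0 _) (ler_wpM2l (nm_ge0 _) (nm_sandwich_le _ _ _))))//.
  by rewrite le_eqVlt; apply/orP; left; apply/eqP; ring.
rewrite /loss; under eq_fun do rewrite EE.
apply/cvg_lim => //; apply/cvg_EFin; first exact: nearW.
apply/cvgrPdist_le => e e0; near=> n.
have n0 : 0 < n%:R :> R by rewrite ltr0n; near: n; exact: nbhs_infty_gt.
rewrite /= -(ler_pM2l n0) -{1}(ger0_norm (ltW n0)) -normrM mulrBr mulVKf ?gt_eqF//.
apply: (@le_trans _ _ (`|L| + c * r ^+ 2)); last first.
  by rewrite -ler_pdivrMr//; near: n; exact: nbhs_infty_ger.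
(* There are [n + 1] terms under the factor [n^-1], hence one extra [L]. *)
have -> : n%:R * L - \sum_(0 <= t < n.+1) l t = - L - \sum_(t < n.+1) (l t - L).
  rewrite big_mkord sumrB sumr_const card_ord -(mulr_natl L) -natr1; ring.
rewrite (le_trans (ler_normB _ _))// normrN lerD2l.
rewrite (le_trans (ler_norm_sum _ _ _))//.
apply: le_trans (ler_wpM2l c0 (sum_nm_power_sqr_le Ar n.+1)).
by rewrite mulr_sumr; exact: ler_sum.
Unshelve. all: by end_near. Qed.

End system_second_moments.

(** * Empirical covariances *)

Section vanishing_averages.
Context d (T : measurableType d) (R : realType) (P : probability T R).
Context (I : choiceType) (xi : I -> T -> R).
Local Notation gam := (@normal_prob R 0 1).
Local Notation mR := (measurableTypeR R).
Local Notation bounded := (moment_bounded P (globally [set: nat])).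
Local Notation vanish := (vanishing P \oo).

Lemma vanishing_le (f g : nat -> T -> R) : (forall n, measurable_fun setT (g n)) ->
  vanish f -> (forall n om, `|g n om| <= `|f n om|) -> vanish g.
Proof.
move=> mg [bf vf] gf; split; first exact: moment_bounded_le bf gf.
move=> e e0; apply: filterS (vf e e0) => n; apply: le_trans.
apply: ge0_le_integral => //.
- by move=> om _; rewrite lee_fin sqr_ge0.
- by apply/measurable_EFinP; exact: measurable_funX.
- by apply/measurable_EFinP; apply: measurable_funX; exact: bf.1.
- move=> om _; rewrite lee_fin -(real_normK (num_real (g n om))).
  by rewrite -(real_normK (num_real (f n om))) lerXn2r// nnegrE.
Qed.

Lemma bounded_average (f : nat -> T -> R) : bounded f ->
  bounded (fun n om => n%:R^-1 * \sum_(t < n) f t om).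
Proof.
move=> bf; rewrite (_ : (fun _ _ => _) =
    fun n om => \sum_(t <- iota 0 n) n%:R^-1 * f t om); last first.
  apply/funext => n; apply/funext => om.
  by rewrite mulr_sumr -(big_mkord xpredT (fun t => n%:R^-1 * f t om)) /index_iota subn0.
apply: (moment_bounded_weighted_sum (S := 1) (a := fun n _ => n%:R^-1)) => // n.
rewrite big_const_seq count_predT size_iota iter_addr_0.
rewrite ger0_norm ?invr_ge0// -(mulr_natr n%:R^-1); case: n => [|n]; first by rewrite mulr0.
by rewrite mulVf.
Qed.

Lemma vanishing_scaled (f : nat -> T -> R) : bounded f ->
  vanish (fun n om => n%:R^-1 * f n om).
Proof.
move=> bf; split.
  apply: moment_boundedM; last exact: uniform_moment_bounded.
  split=> [n|p]; first exact: measurable_cst.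
  exists 1; apply: nearW => n; rewrite integral_cst//= probability_setT mule1 lee_fin.
  rewrite exprn_ile1// ger0_norm ?invr_ge0//; case: n => [|n]; first by rewrite invr0.
  by rewrite invf_le1// ler1n.
move=> e e0; have [c [c0 fc]] := moment_bounded_sqr bf.
near=> n.
have n0 : 0 < n%:R :> R by rewrite ltr0n; near: n; exact: nbhs_infty_gt.
have n1 : 1 <= n%:R :> R by rewrite ler1n -(ltr0n R).
under eq_integral do rewrite exprMn EFinM.
rewrite ge0_integralZl_EFin//; last 2 first.
- by move=> om _; rewrite lee_fin sqr_ge0.
- by apply/measurable_EFinP; apply: measurable_funX; exact: bf.1.
apply: (@le_trans _ _ ((n%:R^-1 ^+ 2)%:E * c%:E)%E).
  by rewrite lee_wpmul2l ?lee_fin ?sqr_ge0//; exact: fc.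
rewrite -EFinM lee_fin exprVn mulrC ler_pdivrMr ?exprn_gt0//.
apply: (@le_trans _ _ (e * n%:R)); last by rewrite ler_wpM2l ?(ltW e0)// expr2 ler_peMl// ltW.
by rewrite mulrC -ler_pdivrMr//; near: n; exact: nbhs_infty_ger.
Unshelve. all: by end_near. Qed.

Hypothesis xiP : iid_normal P xi.

(* the increments [f t * h (xi (k t))] are orthogonal to the past *)
Lemma vanishing_martingale_average (f : nat -> T -> R) (k : nat -> I) (h : R -> R) (s : R) :
  let z t om := f t om * h (xi (k t) om) in
  (forall t, measurable_fun [set: off xi (k t)] (f t : off xi (k t) -> R)) ->
  (forall t u, (u < t)%N -> measurable_fun [set: off xi (k t)] (z u : off xi (k t) -> R)) ->
  measurable_fun setT h ->
  (forall u a, \int[gam]_x ((u + a * h x) ^+ 2)%:E = (u ^+ 2 + a ^+ 2 * s)%:E)%E ->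
  bounded f -> bounded z ->
  vanish (fun n om => n%:R^-1 * \sum_(t < n) z t om).
Proof.
move=> z mf mz mh hs bf bz; split.
  apply: uniform_moment_bounded; exact: bounded_average.
have s0 : 0 <= s.
  have := hs 0 1; rewrite expr0n add0r expr1n mul1r => H; rewrite -lee_fin -H.
  by apply: integral_ge0 => x _; rewrite lee_fin sqr_ge0.
have [c [c0 fc]] := moment_bounded_sqr bf.
have sumle n : (\int[P]_om ((\sum_(t < n) z t om) ^+ 2)%:E <= (n%:R * (c * s))%:E)%E.
  elim: n => [|n IHn].
    under eq_integral do rewrite big_ord0 expr0n.
    by rewrite integral0 mul0r.
  under eq_integral do rewrite big_ord_recr/= /z.
  rewrite (integral_off_sqr xiP (f := fun om => \sum_(t < n) z t om)
    (g := f n) (h := h) (s := s))//; last first.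
    by apply: measurable_sum => t; exact: mz.
  under eq_integral => om _.
    rewrite EFinD (EFinM (f n om ^+ 2)); over.
  have mfn : measurable_fun [set: T] (fun om => (f n om ^+ 2)%:E).
    by apply/measurable_EFinP; apply: measurable_funX; exact: bf.1.
  have fn0 : forall om, setT om -> (0 <= (f n om ^+ 2)%:E)%E.
    by move=> om _; rewrite lee_fin sqr_ge0.
  have mS : measurable_fun [set: T] (fun om => ((\sum_(t < n) z t om) ^+ 2)%:E).
    apply/measurable_EFinP; apply: measurable_funX; apply: measurable_sum => t.
    exact: bz.1.
  have S0 : forall om, setT om -> (0 <= ((\sum_(t < n) z t om) ^+ 2)%:E)%E.
    by move=> om _; rewrite lee_fin sqr_ge0.
  have mfs : measurable_fun [set: T] (fun om => ((f n om ^+ 2)%:E * s%:E)%E).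
    exact: emeasurable_funM.
  have fs0 : forall om, setT om -> (0 <= (f n om ^+ 2)%:E * s%:E)%E.
    by move=> om _; rewrite mule_ge0 ?fn0.
  rewrite ge0_integralD//.
  rewrite ge0_integralZr//.
  rewrite -natr1 mulrDl mul1r EFinD; apply: leeD => //.
  by rewrite EFinM lee_wpmul2r ?lee_fin//; exact: fc.
move=> e e0; near=> n.
have n0 : 0 < n%:R :> R by rewrite ltr0n; near: n; exact: nbhs_infty_gt.
under eq_integral do rewrite exprMn EFinM.
rewrite ge0_integralZl_EFin//; last 2 first.
- by move=> om _; rewrite lee_fin sqr_ge0.
- apply/measurable_EFinP; apply: measurable_funX; apply: measurable_sum => t.
  exact: bz.1.
apply: (@le_trans _ _ ((n%:R^-1 ^+ 2)%:E * (n%:R * (c * s))%:E)%E).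
  by rewrite lee_wpmul2l ?lee_fin ?sqr_ge0.
rewrite -EFinM lee_fin expr2 -mulrA mulKf ?gt_eqF//.
by rewrite mulrC ler_pdivrMr// -ler_pdivrMl//; near: n; exact: nbhs_infty_ger.
Unshelve. all: by end_near. Qed.

(** Freezing with an integrand that ignores the other entries gives the marginal law, so all entries
    share the same absolute moments. *)
Lemma noise_bounded : moment_bounded P (globally [set: I]) xi.
Proof.
split=> [k|p]; first exact: (xiP.1 k).
have /integrableP[mX] := @normal_integrable_exprn R (2 ^ p).
under eq_integral do rewrite abse_EFin normrX.
rewrite -ge0_fin_numE; last by apply: integral_ge0 => x _; rewrite lee_fin exprn_ge0.
set c := (\int[gam]_x _)%E => cfin; exists (fine c) => k _; rewrite fineK//.
pose H (z : off xi k * mR) : \bar R := (`|z.2| ^+ (2 ^ p))%:E.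
rewrite (freezing xiP (h := H)).
- by rewrite /H /= -/c integral_cst//= probability_setT mule1.
- have mh : measurable_fun [set: mR] (fun x : mR => (`|x| ^+ (2 ^ p))%:E).
    apply/measurable_EFinP; apply: measurable_funX; exact: normr_measurable.
  exact: (measurableT_comp mh measurable_snd).
- by move=> z; rewrite lee_fin exprn_ge0.
Qed.

End vanishing_averages.

Section matrix_averages.
Context d (T : measurableType d) (R : realType) (P : probability T R).
Local Notation vanish := (vanishing P \oo).

Definition mvanishing m p (M : nat -> T -> 'M[R]_(m, p)) : Prop :=
  forall i j, vanish (fun n om => M n om i j).

(* averages start at time 1, as the least-squares cost does *)
Definition mavg m p (Z : nat -> T -> 'M[R]_(m, p)) (n : nat) (om : T) : 'M[R]_(m, p) :=
  n%:R^-1 *: \sum_(t < n) Z t.+1 om.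

Lemma mavgE m p (Z : nat -> T -> 'M[R]_(m, p)) n om i j :
  mavg Z n om i j = n%:R^-1 * \sum_(t < n) Z t.+1 om i j.
Proof. by rewrite mxE summxE. Qed.

Lemma mavgD m p (Z Z' : nat -> T -> 'M[R]_(m, p)) n om :
  mavg (fun t om => Z t om + Z' t om) n om = mavg Z n om + mavg Z' n om.
Proof. by rewrite /mavg big_split scalerDr. Qed.

Lemma mavg_mulmx m p q r (L : 'M[R]_(q, m)) (Z : nat -> T -> 'M[R]_(m, p))
    (N : 'M[R]_(p, r)) n om :
  mavg (fun t om => L *m Z t om *m N) n om = L *m mavg Z n om *m N.
Proof.
by rewrite /mavg -scalemxAr -scalemxAl mulmx_sumr mulmx_suml.
Qed.

Lemma mavg_tr m p (Z : nat -> T -> 'M[R]_(m, p)) n om :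
  mavg (fun t om => (Z t om)^T) n om = (mavg Z n om)^T.
Proof.
apply/matrixP => i j; rewrite [RHS]mxE !mavgE; congr (_ * _).
by apply: eq_bigr => t _; rewrite mxE.
Qed.

Lemma mvanishingD m p (M M' : nat -> T -> 'M[R]_(m, p)) :
  mvanishing M -> mvanishing M' -> mvanishing (fun n om => M n om + M' n om).
Proof.
move=> vM vM' i j.
rewrite (_ : (fun _ _ => _) = fun n om => M n om i j + M' n om i j).
  exact: vanishingD.
by apply/funext => n; apply/funext => om; rewrite mxE.
Qed.

Lemma mvanishing_mulmx m p q r (L : 'M[R]_(q, m)) (M : nat -> T -> 'M[R]_(m, p))
    (N : 'M[R]_(p, r)) :
  mvanishing M -> mvanishing (fun n om => L *m M n om *m N).
Proof.
move=> vM i j.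
rewrite (_ : (fun _ _ => _) = fun n om =>
    \sum_k \sum_l M n om l k * (L i l * N k j)).
  apply: vanishing_sum => k; apply: vanishing_sum => l.
  by apply: vanishingM => //; exact: moment_bounded_cst.
apply/funext => n; apply/funext => om; rewrite mxE; apply: eq_bigr => k _.
by rewrite mxE mulr_suml; apply: eq_bigr => l _; ring.
Qed.

Lemma mvanishing_tr m p (M : nat -> T -> 'M[R]_(m, p)) :
  mvanishing M -> mvanishing (fun n om => (M n om)^T).
Proof.
move=> vM i j; rewrite (_ : (fun _ _ => _) = fun n om => M n om j i) //.
by apply/funext => n; apply/funext => om; rewrite mxE.
Qed.

Lemma mvanishing_nm m p (M : nat -> T -> 'M[R]_(m, p)) :
  mvanishing M -> vanish (fun n om => nm (M n om)).
Proof.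
move=> vM; apply: vanishing_sum => i; apply: vanishing_sum => j.
exact: vanishing_norm.
Qed.

End matrix_averages.

Section data_moments.
Context d (T : measurableType d) (R : realType) (P : probability T R).
Variables (dx dy : nat) (A Bw : 'M[R]_dx) (C : 'M[R]_(dy, dx)) (Dv : 'M[R]_dy).
Variables (w : nat -> T -> 'cV[R]_dx) (v : nat -> T -> 'cV[R]_dy).
Hypothesis wvP : iid_std_gaussian_noises P w v.
Variable r : R.
Hypothesis Ar : forall k, \sum_(i < k) nm (A ^+ i) <= r.
Local Notation xi := (noise w v).
Local Notation x := (state A Bw w).
Local Notation y := (output A Bw C Dv w v).
Local Notation bounded := (moment_bounded P (globally [set: nat])).
Local Notation vanish := (vanishing P \oo).
Local Notation index := (noise_index dx dy).

Let xiP : iid_normal P xi := noise_iid_normal wvP.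

Lemma bounded_noise (k : nat -> index) : bounded (fun t => xi (k t)).
Proof. exact: moment_bounded_reindex (noise_bounded xiP). Qed.

Lemma bounded_w i : bounded (fun t om => w t om i 0).
Proof. exact: (bounded_noise (fun t => inl (t, i))). Qed.

Lemma bounded_v i : bounded (fun t om => v t om i 0).
Proof. exact: (bounded_noise (fun t => inr (t, i))). Qed.

Lemma state_convolution t om :
  x t om = \sum_(s < t) A ^+ (t.-1 - s) *m Bw *m w s om.
Proof.
elim: t => [|t IHt] /=; first by rewrite big_ord0.
rewrite big_ord_recr /= subnn expr0 mul1mx IHt mulmx_sumr; congr (_ + _).
apply: eq_bigr => s _; rewrite !mulmxA mulmxE -exprS.
by case: t s {IHt} => [[]//|t] s /=; rewrite subSn// -ltnS.
Qed.

Lemma bounded_state i : bounded (fun t om => x t om i 0).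
Proof.
rewrite (_ : (fun _ _ => _) = fun t om => \sum_j
    \sum_(s <- iota 0 t) (A ^+ (t.-1 - s) *m Bw) i j * w s om j 0); last first.
  apply/funext => t; apply/funext => om; rewrite state_convolution summxE.
  rewrite [RHS]exchange_big -[in RHS](subn0 t) -/(index_iota 0 t) big_mkord.
  by apply: eq_bigr => s _; rewrite mxE subn0.
apply: moment_bounded_sum => j.
apply: (moment_bounded_weighted_sum (S := r * nm Bw)
  (a := fun t s => (A ^+ (t.-1 - s) *m Bw) i j)); first exact: bounded_w.
move=> t.
apply: (@le_trans _ _ (\sum_(s <- iota 0 t) nm (A ^+ (t.-1 - s)) * nm Bw)).
  by apply: ler_sum => s _; rewrite (le_trans (ler_nm _ _ _))// ler_nmM.
rewrite -mulr_suml ler_wpM2r ?nm_ge0// -{1}[t]subn0 -/(index_iota 0 t).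
rewrite big_nat_rev big_mkord add0n /=.
apply: le_trans (Ar t); rewrite le_eqVlt; apply/orP; left; apply/eqP.
apply: eq_bigr => s _; congr (nm (A ^+ _)).
by case: t s => [[]//|t] s /=; rewrite subSS subKn// -ltnS.
Qed.

Lemma bounded_mulmx_coord m p (M : 'M[R]_(m, p)) (X : nat -> T -> 'cV[R]_p) i :
  (forall j, bounded (fun t om => X t om j 0)) ->
  bounded (fun t om => (M *m X t om) i 0).
Proof.
move=> bX; rewrite (_ : (fun _ _ => _) = fun t om => \sum_j M i j * X t om j 0).
  apply: moment_bounded_sum => j; apply: moment_boundedM => //.
  exact: moment_bounded_cst.
by apply/funext => t; apply/funext => om; rewrite mxE.
Qed.

(** The index [k t j] names the noise entry that is coordinate [j] of [b t]. It is fresh with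
    respect to [a] up to time [t] and to earlier [b], so each matrix entry is an average of
    martingale increments. *)
Lemma mavg_cross_vanishing m p (a : nat -> T -> 'cV[R]_m) (b : nat -> T -> 'cV[R]_p)
    (k : nat -> 'I_p -> index) :
  (forall t om j, b t om j 0 = xi (k t j) om) ->
  (forall t u i j, (u <= t)%N ->
    measurable_fun [set: off xi (k t j)] (fun om : off xi (k t j) => a u om i 0)) ->
  (forall t u j, (u < t)%N -> k u j != k t j) ->
  (forall i, bounded (fun t om => a t om i 0)) ->
  mvanishing P (mavg (fun t om => a t om *m (b t om)^T)).
Proof.
move=> bE ma kk ba i j.
have := @vanishing_martingale_average _ _ _ _ _ _ xiP
  (fun t om => a t.+1 om i 0) (fun t => k t.+1 j) id 1.
rewrite /= (_ : (fun _ _ => mavg _ _ _ _ _) = fun n om => n%:R^-1 *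
    \sum_(t < n) a t.+1 om i 0 * xi (k t.+1 j) om); last first.
  apply/funext => n; apply/funext => om; rewrite mavgE; congr (_ * _).
  by apply: eq_bigr => t _; rewrite mxE big_ord1 mxE bE.
apply.
- by move=> t; exact: ma.
- move=> t u ut; apply: measurable_funM; first by apply: ma; exact: ltnW.
  by apply: measurable_off; exact: kk.
- by [].
- by move=> u c; rewrite mulr1 integral_normal_sqr_affine.
- exact: (moment_bounded_reindex succn (ba i)).
- apply: moment_boundedM; first exact: (moment_bounded_reindex succn (ba i)).
  exact: (bounded_noise (fun t => k t.+1 j)).
Qed.

Lemma mavg_noise_cov_vanishing p (b : nat -> T -> 'cV[R]_p) (k : nat -> 'I_p -> index) :
  (forall t om j, b t om j 0 = xi (k t j) om) ->
  (forall t u i j, (u, i) != (t, j) -> k u i != k t j) ->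
  mvanishing P (mavg (fun t om => b t om *m (b t om)^T - 1%:M)).
Proof.
move=> bE kk i j; have [->|ij] := eqVneq i j.
  have [s hs] := @normal_centred_sqr R.
  have := @vanishing_martingale_average _ _ _ _ _ _ xiP
    (fun=> cst 1) (fun t => k t.+1 j) (fun x => x ^+ 2 - 1) s.
  rewrite /= (_ : (fun _ _ => mavg _ _ _ _ _) = fun n om => n%:R^-1 *
      \sum_(t < n) 1 * (xi (k t.+1 j) om ^+ 2 - 1)); last first.
    apply/funext => n; apply/funext => om; rewrite mavgE; congr (_ * _).
    apply: eq_bigr => t _; rewrite mxE [X in X + _]mxE big_ord1 mxE bE -expr2 mul1r.
    by rewrite !mxE eqxx.
  apply => //.
  - move=> t u ut; apply: measurable_funM => //; apply: measurable_funB => //.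
    apply: measurable_funX; apply: measurable_off; apply: kk.
    by rewrite xpair_eqE eqSS ltn_eqF.
  - by apply: measurable_funB => //; exact: exprn_measurable.
  - exact: moment_bounded_cst.
  - apply: moment_boundedM; first exact: moment_bounded_cst.
    apply: moment_boundedD; last exact: moment_bounded_cst.
    by apply: moment_boundedX; exact: (bounded_noise (fun t => k t.+1 j)).
have := @vanishing_martingale_average _ _ _ _ _ _ xiP
  (fun t => xi (k t.+1 i)) (fun t => k t.+1 j) id 1.
rewrite /= (_ : (fun _ _ => mavg _ _ _ _ _) = fun n om => n%:R^-1 *
    \sum_(t < n) xi (k t.+1 i) om * xi (k t.+1 j) om); last first.
  apply/funext => n; apply/funext => om; rewrite mavgE; congr (_ * _).
  apply: eq_bigr => t _; rewrite mxE [X in X + _]mxE big_ord1 mxE !bE.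
  by rewrite !mxE (negPf ij) subr0.
apply => //.
- by move=> t; apply: measurable_off; apply: kk; rewrite xpair_eqE eqxx (negPf ij).
- move=> t u ut; apply: measurable_funM; apply: measurable_off; apply: kk;
    by rewrite xpair_eqE eqSS ltn_eqF.
- by move=> u c; rewrite mulr1 integral_normal_sqr_affine.
- exact: (bounded_noise (fun t => k t.+1 i)).
- by apply: moment_boundedM; [exact: (bounded_noise (fun t => k t.+1 i)) |
    exact: (bounded_noise (fun t => k t.+1 j))].
Qed.

End data_moments.

Section empirical_covariances.
Context d (T : measurableType d) (R : realType) (P : probability T R).
Variables (dx dy : nat) (A Bw : 'M[R]_dx) (C : 'M[R]_(dy, dx)) (Dv : 'M[R]_dy).
Variables (w : nat -> T -> 'cV[R]_dx) (v : nat -> T -> 'cV[R]_dy).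
Hypothesis wvP : iid_std_gaussian_noises P w v.
Variable r : R.
Hypothesis Ar : forall k, \sum_(i < k) nm (A ^+ i) <= r.
Variable X : 'M[R]_dx.
Hypothesis XE : stationary_cov A Bw X.
Local Notation xi := (noise w v).
Local Notation x := (state A Bw w).
Local Notation y := (output A Bw C Dv w v).
Local Notation mvan := (mvanishing P).

Let xw_van : mvan (mavg (fun t om => x t om *m (w t om)^T)).
Proof.
apply: (mavg_cross_vanishing wvP (k := fun t j => inl (t, j))) => //.
- by move=> t u i j ut; apply: measurable_off_state => //.
- by move=> t u j ut; apply/eqP => -[E]; rewrite E ltnn in ut.
- exact: (bounded_state Bw wvP Ar).
Qed.

Let xv_van : mvan (mavg (fun t om => x t om *m (v t om)^T)).
Proof.
apply: (mavg_cross_vanishing wvP (k := fun t j => inr (t, j))) => //.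
- by move=> t u i j ut; apply: measurable_off_state => //.
- by move=> t u j ut; apply/eqP => -[E]; rewrite E ltnn in ut.
- exact: (bounded_state Bw wvP Ar).
Qed.

Let xv1_van : mvan (mavg (fun t om => x t om *m (v t.+1 om)^T)).
Proof.
apply: (mavg_cross_vanishing wvP (k := fun t j => inr (t.+1, j))) => //.
- by move=> t u i j ut; apply: measurable_off_state => //.
- by move=> t u j ut; apply/eqP => -[E]; rewrite E ltnn in ut.
- exact: (bounded_state Bw wvP Ar).
Qed.

Let wv_van : mvan (mavg (fun t om => w t om *m (v t om)^T)).
Proof.
apply: (mavg_cross_vanishing wvP (k := fun t j => inr (t, j))) => //.
- by move=> t u i j ut; apply: measurable_off_w.
- by move=> t u j ut; apply/eqP => -[E]; rewrite E ltnn in ut.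
- exact: (bounded_w wvP).
Qed.

Let vv1_van : mvan (mavg (fun t om => v t om *m (v t.+1 om)^T)).
Proof.
apply: (mavg_cross_vanishing wvP (k := fun t j => inr (t.+1, j))) => //.
- move=> t u i j ut; apply: measurable_off_v; apply/eqP => -[E _].
  by rewrite -E ltnn in ut.
- by move=> t u j ut; apply/eqP => -[E]; rewrite E ltnn in ut.
- exact: (bounded_v wvP).
Qed.

Let ww_van : mvan (mavg (fun t om => w t om *m (w t om)^T - 1%:M)).
Proof.
apply: (mavg_noise_cov_vanishing wvP (k := fun t j => inl (t, j))) => //.
Qed.

Let vv_van : mvan (mavg (fun t om => v t om *m (v t om)^T - 1%:M)).
Proof.
apply: (mavg_noise_cov_vanishing wvP (k := fun t j => inr (t, j))) => //.
Qed.

Let V n om := mavg (fun t om => x t om *m (x t om)^T - X) n om.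

Let boundary n om := - (n%:R^-1 *:
  (x n.+1 om *m (x n.+1 om)^T - x 1 om *m (x 1 om)^T)).

Let eps n om :=
  A *m mavg (fun t om => x t om *m (w t om)^T) n om *m Bw^T +
  Bw *m (mavg (fun t om => x t om *m (w t om)^T) n om)^T *m A^T +
  Bw *m mavg (fun t om => w t om *m (w t om)^T - 1%:M) n om *m Bw^T +
  boundary n om.

Let boundary_van : mvan boundary.
Proof.
move=> i j; rewrite (_ : (fun _ _ => _) = fun n om => n%:R^-1 *
   (x 1 om i 0 * x 1 om j 0 + (-1) * (x n.+1 om i 0 * x n.+1 om j 0))); last first.
  apply/funext => n; apply/funext => om; rewrite /boundary.
  by rewrite !mxE !big_ord1 !mxE; ring.
have bx (k : nat -> nat) i' : moment_bounded P (globally [set: nat])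
    (fun t om => x (k t) om i' 0).
  exact: (moment_bounded_reindex k (bounded_state Bw wvP Ar i')).
apply: vanishing_scaled; apply: moment_boundedD.
  by apply: moment_boundedM; exact: (bx (fun=> 1%N)).
apply: moment_boundedM; first exact: moment_bounded_cst.
by apply: moment_boundedM; exact: (bx succn).
Qed.

Let eps_van : mvan eps.
Proof.
apply: mvanishingD => //; apply: mvanishingD; last exact: mvanishing_mulmx.
apply: mvanishingD; first exact: mvanishing_mulmx.
by apply: mvanishing_mulmx; exact: mvanishing_tr.
Qed.

(** Averaging the recursion of [x t *m (x t)^T - X] gives its Lyapunov equation with an error: the
    noise averages, and the [boundary] term that pays for shifting the window by one step. *)
Let VE n om : V n om = A *m V n om *m A^T + eps n om.
Proof.
have step t o : x t.+1 o *m (x t.+1 o)^T - X =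
    A *m (x t o *m (x t o)^T - X) *m A^T + A *m (x t o *m (w t o)^T) *m Bw^T +
    Bw *m (x t o *m (w t o)^T)^T *m A^T + Bw *m (w t o *m (w t o)^T - 1%:M) *m Bw^T.
  rewrite {1}XE /= linearD/= !trmx_mul !trmxK.
  rewrite !(mulmxDl, mulmxDr, mulmxN, mulNmx) !mulmx1 !mulmxA.
  move: (A *m x t o *m _ *m A^T) (A *m x t o *m _ *m Bw^T)
    (Bw *m w t o *m _ *m A^T) (Bw *m w t o *m _ *m Bw^T) (A *m X *m A^T)
    (Bw *m Bw^T) => M1 M2 M3 M4 M5 M6.
  by apply/matrixP => i j; rewrite !mxE; ring.
rewrite /eps -mavg_tr -!mavg_mulmx addrA addrA addrA -!mavgD /V.
pose Z t om' := x t om' *m (x t om')^T - X.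
transitivity (mavg (fun t => Z t.+1) n om + boundary n om); last first.
  congr (_ + _); congr (mavg _ n om).
  by apply/funext => t; apply/funext => o; rewrite /Z step.
rewrite /mavg /boundary -scalerN -scalerDr; congr (_ *: _).
have := big_ord_recl n (fun t : 'I_n.+1 => Z t.+1 om) => tele.
have tele2 : \sum_(t < n) Z t.+1 om + Z n.+1 om = Z 1 om + \sum_(t < n) Z t.+2 om.
  by rewrite -(big_ord_recr n (fun t => Z t.+1 om)) big_ord_recl.
have -> : x n.+1 om *m (x n.+1 om)^T - x 1 om *m (x 1 om)^T = Z n.+1 om - Z 1 om.
  by rewrite /Z opprB addrA subrK.
rewrite opprB addrA [X in _ = X - _]addrC -tele2 addrK.
by [].
Qed.

(** The perturbation bound for the Lyapunov equation is applied for each outcome, so smallness of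
    [eps] passes directly to the covariance. *)
Lemma state_cov_vanishing : mvan (mavg (fun t om => x t om *m (x t om)^T - X)).
Proof.
move=> i j; apply: (@vanishing_le _ _ _ _ (fun n om => 2 * r ^+ 2 * nm (eps n om))).
- move=> n; rewrite (_ : (fun _ => _) = fun om => n%:R^-1 *
     \sum_(t < n) (x t.+1 om i 0 * x t.+1 om j 0 - X i j)); last first.
    apply/funext => om; rewrite mavgE; congr (_ * _); apply: eq_bigr => t _.
    by rewrite mxE [X in X + _]mxE big_ord1 [_^T _ _]mxE [X in _ + X]mxE.
  apply: measurable_funM => //; apply: measurable_sum => t.
  apply: measurable_funB => //; apply: measurable_funM; exact: (measurable_state _ _ wvP).
- rewrite (_ : (fun _ _ => _) = fun n om => nm (eps n om) * (2 * r ^+ 2)).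
    by apply: vanishingM; [exact: mvanishing_nm | exact: moment_bounded_cst].
  by apply/funext => n; apply/funext => om; rewrite mulrC.
- move=> n om; rewrite (le_trans (ler_nm _ _ _))//.
  by rewrite (le_trans (lyapunov_nm_le Ar (VE n om)))// ler_norm.
Qed.

(** The equation for [F] says [W X C^T = F Dv Dv^T], which cancels the constants produced by
    centring the state and noise covariances. Eight averages remain, each vanishing. *)
Lemma residual_cov_vanishing (F : 'M[R]_dy) :
  F *m (C *m X *m C^T + Dv *m Dv^T) = C *m A *m X *m C^T ->
  mvan (mavg (fun t om => (y t.+1 om - F *m y t om) *m (y t om)^T)).
Proof.
move=> FE; pose W := C *m A - F *m C.
pose XX t om := x t om *m (x t om)^T - X.
pose XV t om := x t om *m (v t om)^T.
pose XW t om := x t om *m (w t om)^T.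
pose WV t om := w t om *m (v t om)^T.
pose XV1 t om := x t om *m (v t.+1 om)^T.
pose VV1 t om := v t om *m (v t.+1 om)^T.
pose VV t om := v t om *m (v t om)^T - 1%:M.
have termE t om : (y t.+1 om - F *m y t om) *m (y t om)^T =
   W *m XX t om *m C^T + W *m XV t om *m Dv^T +
   C *m Bw *m (XW t om)^T *m C^T + C *m Bw *m WV t om *m Dv^T +
   Dv *m (XV1 t om)^T *m C^T + Dv *m (VV1 t om)^T *m Dv^T +
   (- (F *m Dv)) *m (XV t om)^T *m C^T + (- (F *m Dv)) *m VV t om *m Dv^T.
  rewrite /W /XX /XV /XW /WV /XV1 /VV1 /VV /output /= linearD/= !trmx_mul !trmxK.
  have -> : (C *m x t om + Dv *m v t om)^T = (C *m x t om)^T + (Dv *m v t om)^T.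
    by rewrite linearD.
  rewrite !trmx_mul.
  move: FE; rewrite !(mulmxDl, mulmxDr, mulmxN, mulNmx) !mulmx1 !mulmxA.
  move=> FE.
  have {}FE : C *m A *m X *m C^T = F *m C *m X *m C^T + F *m Dv *m Dv^T by rewrite FE.
  rewrite FE.
  set a := x t om; set b := w t om; set c := v t om; set c1 := v t.+1 om.
  move: (C *m A *m a *m a^T *m C^T) (C *m A *m a *m c^T *m Dv^T)
    (C *m Bw *m b *m a^T *m C^T) (C *m Bw *m b *m c^T *m Dv^T)
    (Dv *m c1 *m a^T *m C^T) (Dv *m c1 *m c^T *m Dv^T)
    (F *m C *m a *m a^T *m C^T) (F *m C *m a *m c^T *m Dv^T)
    (F *m Dv *m c *m a^T *m C^T) (F *m Dv *m c *m c^T *m Dv^T)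
    (F *m C *m X *m C^T) (F *m Dv *m Dv^T)
    => M1 M2 M3 M4 M5 M6 M7 M8 M9 M10 M11 M12.
  by apply/matrixP => i j; rewrite !mxE; ring.
rewrite (_ : mavg _ = fun n om =>
   W *m mavg XX n om *m C^T + W *m mavg XV n om *m Dv^T +
   C *m Bw *m (mavg XW n om)^T *m C^T + C *m Bw *m mavg WV n om *m Dv^T +
   Dv *m (mavg XV1 n om)^T *m C^T + Dv *m (mavg VV1 n om)^T *m Dv^T +
   (- (F *m Dv)) *m (mavg XV n om)^T *m C^T + (- (F *m Dv)) *m mavg VV n om *m Dv^T).
  do 7? [apply: mvanishingD; last by apply: mvanishing_mulmx => //; exact: mvanishing_tr].
  by apply: mvanishing_mulmx; exact: state_cov_vanishing.
apply/funext => n; apply/funext => om; rewrite -!mavg_tr -!mavg_mulmx -!mavgD.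
by congr (mavg _ n om); apply/funext => t; apply/funext => om'.
Qed.

End empirical_covariances.

(** * Inverse moments of the empirical Gram matrix *)

Section determinants.

(** The determinant is affine in its corner entry, with the smaller leading minor as slope. Choosing
    [z] as the part of that entry without its own noise makes the second determinant free of this
    noise. *)
Lemma det_last_entry (R : comNzRingType) n (M : 'M[R]_n.+1) (z : R) :
  \det M = (M ord_max ord_max - z) * \det (row' ord_max (col' ord_max M)) +
    \det (\matrix_(i, j) if (i == ord_max) && (j == ord_max) then z else M i j).
Proof.
set N := \matrix_(i, j) _.
have cofE j : cofactor N ord_max j = cofactor M ord_max j.
  congr (_ * \det _); apply/matrixP => a b; rewrite !mxE.
  by rewrite eq_sym (negPf (neq_lift _ _)).
have restE : \sum_(j | j != ord_max) N ord_max j * cofactor N ord_max j =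
    \sum_(j | j != ord_max) M ord_max j * cofactor M ord_max j.
  by apply: eq_bigr => j jm; rewrite cofE mxE (negPf jm) andbF.
rewrite (expand_det_row M ord_max) (expand_det_row N ord_max).
rewrite (bigD1 ord_max)//= [in RHS](bigD1 ord_max)//= restE cofE.
rewrite [N _ _]mxE eqxx /= addrA; congr (_ + _).
rewrite /cofactor -signr_odd oddD addbb expr0; ring.
Qed.

Lemma measurable_det d (U : measurableType d) (R : realType) n (M : U -> 'M[R]_n) :
  (forall i j, measurable_fun [set: U] (fun u => M u i j)) ->
  measurable_fun [set: U] (fun u => \det (M u)).
Proof.
move=> mM; rewrite /determinant; apply: measurable_sum => s.
by apply: measurable_funM => //; apply: measurable_prod => i _; exact: mM.
Qed.

Lemma emeasurable_prod d (U : measurableType d) (R : realType) (K : Type) (s : seq K)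
    (f : K -> U -> \bar R) : (forall k, measurable_fun [set: U] (f k)) ->
  measurable_fun [set: U] (fun u => (\prod_(k <- s) f k u)%E).
Proof.
move=> mf; elim: s => [|k s IHs].
  by under eq_fun do rewrite big_nil; exact: measurable_cst.
by under eq_fun do rewrite big_cons; exact: emeasurable_funM.
Qed.

End determinants.

Section determinant_negative_moment.
Context d (T : measurableType d) (R : realType) (P : probability T R).
Variables (dx dy : nat) (A Bw : 'M[R]_dx) (C : 'M[R]_(dy, dx)) (Dv : 'M[R]_dy).
Variables (w : nat -> T -> 'cV[R]_dx) (v : nat -> T -> 'cV[R]_dy).
Hypothesis wvP : iid_std_gaussian_noises P w v.
Local Notation xi := (noise w v).
Local Notation x := (state A Bw w).

Let xiP : iid_normal P xi := noise_iid_normal wvP.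

(* the output whitened by [Dv^-1], so that its noise is [v t] itself *)
Definition whitened (t : nat) (om : T) : 'cV[R]_dy :=
  invmx Dv *m C *m x t om + v t om.

(** Coordinates are natural numbers, with value 0 out of range, so that minors of all orders are
    written without casts between ordinals. *)
Definition cv_entry (X : 'cV[R]_dy) (a : nat) : R :=
  if insub a is Some i then X i 0 else 0.

(** A leading principal minor of the matrix whose columns are consecutive whitened outputs from time
    [t] on. *)
Definition minor (t j : nat) (om : T) : R :=
  \det (\matrix_(a < j, b < j) cv_entry (whitened (t + b) om) a).

Lemma cv_entryE X (a : 'I_dy) : cv_entry X a = X a 0.
Proof. by rewrite /cv_entry valK. Qed.

Lemma measurable_whitened t i : measurable_fun [set: T] (fun om => whitened t om i 0).
Proof.
rewrite /whitened; under eq_fun do rewrite mxE.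
apply: measurable_funD; last exact: (measurable_v wvP).
by apply: measurable_mulmx_coord => j; exact: (measurable_state _ _ wvP).
Qed.

Lemma measurable_minor t j : measurable_fun [set: T] (minor t j).
Proof.
apply: measurable_det => a b; under eq_fun do rewrite mxE.
rewrite /cv_entry; case: insubP => [i _ _|_]; last exact: measurable_cst.
exact: measurable_whitened.
Qed.

Lemma measurable_off_coord t s (j : 'I_dy) a : (s, a) != (t, j : nat) ->
  measurable_fun [set: off xi (inr (t, j))]
    (fun om : off xi (inr (t, j)) => cv_entry (whitened s om) a).
Proof.
move=> sa; rewrite /cv_entry; case: insubP => [i _ ia|_]; last exact: measurable_cst.
rewrite /whitened; under eq_fun do rewrite mxE.
apply: measurable_funD; last first.
  apply: measurable_off_v; apply: contra sa => /eqP[-> ->]; rewrite ia.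
  by rewrite eqxx.
by apply: measurable_mulmx_coord => k; apply: measurable_off_state.
Qed.

Lemma measurable_off_minor t s (j : 'I_dy) k :
  (forall a b, (a < k)%N -> (b < k)%N -> (s + b, a)%N != (t, j : nat)) ->
  measurable_fun [set: off xi (inr (t, j))] (minor s k : off xi (inr (t, j)) -> R).
Proof.
move=> H; apply: measurable_det => a b; under eq_fun do rewrite mxE.
by apply: measurable_off_coord; exact: H.
Qed.

Lemma minor_affine t (j : 'I_dy) om : minor t j.+1 om =
  minor t j om * xi (inr ((t + j)%N, j)) om +
  \det (\matrix_(a < j.+1, b < j.+1) if (a == ord_max) && (b == ord_max)
     then (invmx Dv *m C *m x (t + j)%N om) j 0 else cv_entry (whitened (t + b) om) a).
Proof.
rewrite /minor (det_last_entry _ ((invmx Dv *m C *m x (t + j)%N om) j 0)).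
congr (_ + _).
  rewrite mxE /= cv_entryE /whitened [X in X - _]mxE addrAC subrr add0r mulrC.
  congr (\det _ * _); apply/matrixP => a b; rewrite 4!mxE !lift_max.
  exact: erefl.
congr (\det _); apply/matrixP => a b; rewrite [LHS]mxE [RHS]mxE.
by case: ifP => // _; rewrite mxE.
Qed.

Lemma integral_minor_step t (j : 'I_dy) (F : T -> \bar R) :
  measurable_fun [set: off xi (inr ((t + j)%N, j))]
    (F : off xi (inr ((t + j)%N, j)) -> \bar R) ->
  (forall om, 0 <= F om)%E ->
  (\int[P]_om (F om * invsqrt (minor t j.+1 om)) <=
   (1 + 8 * normal_peak 1)%:E * \int[P]_om (F om * invsqrt (minor t j om)))%E.
Proof.
move=> mF F0; under eq_integral do rewrite minor_affine.
apply: (integral_off_invsqrt xiP) => //.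
- apply: measurable_off_minor => a b aj _; rewrite xpair_eqE negb_and.
  by rewrite orbC (ltn_eqF aj).
- apply: measurable_det => a b; under eq_fun do rewrite mxE.
  have [_|ab] := boolP ((a == ord_max) && (b == ord_max)).
    by apply: measurable_mulmx_coord => k; apply: measurable_off_state.
  apply: measurable_off_coord; apply: contra ab; rewrite xpair_eqE eqn_add2l.
  by rewrite -!val_eqE /= andbC.
Qed.

Definition block_det (l : nat) (om : T) : R := minor (l * dy).+1 dy om.

(** The last block is peeled down its diagonal: integrating out the corner noise lowers the order of
    its minor by one and costs one factor [c]. Earlier blocks contain only earlier [v] and states,
    which are free of [v], so they stay frozen. *)
Lemma integral_prod_invsqrt_det L :
  (\int[P]_om (\prod_(l < L) invsqrt (block_det l om)) <=
   ((1 + 8 * normal_peak 1) ^+ (dy * L))%:E)%E.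
Proof.
set c := 1 + 8 * normal_peak 1.
have c0 : 0 <= c by rewrite addr_ge0// mulr_ge0// normal_peak_ge0.
elim: L => [|L IHL].
  under eq_integral do rewrite big_ord0.
  by rewrite integral_cst//= probability_setT mule1 muln0 expr0.
have F0 om : (0 <= \prod_(l < L) invsqrt (block_det l om))%E.
  by apply: prode_ge0 => l _; exact: invsqrt_ge0.
suff H j : (j <= dy)%N -> (\int[P]_om (\prod_(l < L) invsqrt (block_det l om) *
    invsqrt (minor (L * dy).+1 j om)) <= (c ^+ (dy * L + j))%:E)%E.
  under eq_integral do rewrite big_ord_recr/=.
  by rewrite mulnS addnC; exact: H.
elim: j => [|j IHj] jdy.
  under eq_integral do rewrite /minor det_mx00 invsqrt1 mule1.
  by rewrite addn0.
pose j' := Ordinal jdy.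
apply: le_trans (integral_minor_step (j := j') _ F0) _.
  apply: emeasurable_prod => l.
  apply: (measurableT_comp measurable_invsqrt); apply: measurable_off_minor => a b _ bdy.
  rewrite xpair_eqE negb_and ltn_eqF//.
  rewrite !addSn ltnS (leq_trans (n := (l * dy + dy)%N)) ?ltn_add2l//.
  by rewrite addnC -mulSn (leq_trans _ (leq_addr _ _))// leq_mul2r ltn_ord orbT.
rewrite addnS exprS EFinM lee_wpmul2l ?lee_fin//.
exact: IHj (ltnW jdy).
Qed.

End determinant_negative_moment.

Section gram_lower_bound.
Variable R : realType.

(** Cauchy-Schwarz over the entries; the successor keeps the total weight positive for empty
    matrices. *)
Lemma nm_sqr_le_fsq m n (M : 'M[R]_(m, n)) : nm M ^+ 2 <= (m * n).+1%:R * fsq M.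
Proof.
rewrite /nm /fsq !pair_bigA /=.
rewrite (eq_bigr (fun p : 'I_m * 'I_n => 1 * `|M p.1 p.2|)) => [|p _]; last first.
  by rewrite mul1r.
rewrite [X in _ <= _ * X](eq_bigr (fun p : 'I_m * 'I_n => 1 * `|M p.1 p.2| ^+ 2)).
  apply: sqr_weighted_sum_le => //.
  by rewrite sumr_const card_prod !card_ord ler_nat leqnSn.
by move=> p _; rewrite mul1r real_normK ?num_real.
Qed.

(** Up to a dimension constant, the squared size of the adjugate. Since [Y^-1 = \adj Y / \det Y],
    the squared determinant over it bounds the smallest squared singular value from below, and both
    are polynomial in the data; [1 +] in [block_weight] keeps the denominator positive. *)
Definition block_defect n (Y : 'M[R]_n) : R := (n * n).+1%:R * nm (\adj Y) ^+ 2.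

Lemma block_defect_ge0 n (Y : 'M[R]_n) : 0 <= block_defect Y.
Proof. by rewrite mulr_ge0// sqr_ge0. Qed.

Definition block_weight n (Y : 'M[R]_n) : R := \det Y ^+ 2 / (1 + block_defect Y).

Lemma block_weight_ge0 n (Y : 'M[R]_n) : 0 <= block_weight Y.
Proof. by rewrite divr_ge0 ?sqr_ge0// addr_ge0 ?block_defect_ge0. Qed.

(* [M * det Y = M Y adj(Y)] *)
Lemma block_weight_le n (M Y : 'M[R]_n) :
  nm M ^+ 2 * block_weight Y <= fsq (M *m Y).
Proof.
rewrite /block_weight mulrA ler_pdivrMr; last first.
  by rewrite ltr_pwDl// block_defect_ge0.
apply: (@le_trans _ _ (fsq (M *m Y) * block_defect Y)); last first.
  by rewrite ler_wpM2l ?fsq_ge0// lerDr.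
have dE : \det Y *: M = M *m Y *m \adj Y.
  by rewrite -mulmxA mul_mx_adj mul_mx_scalar.
rewrite -(real_normK (num_real (\det Y))) -exprMn [nm M * _]mulrC -nmZ dE.
apply: (@le_trans _ _ ((nm (M *m Y) * nm (\adj Y)) ^+ 2)).
  by rewrite lerXn2r ?nnegrE ?mulr_ge0 ?nm_ge0 ?ler_nmM.
rewrite exprMn /block_defect [leRHS]mulrA ler_wpM2r ?sqr_ge0// mulrC.
exact: nm_sqr_le_fsq.
Qed.

End gram_lower_bound.

Section inverse_moments_real.
Variable R : realType.

(* AM-GM for the weights, with all exponents kept integral *)
Lemma average_weight_inverse_le (L k : nat) (a q m : R) (p e : 'I_L -> R) :
  (0 < L)%N -> (8 * k <= L)%N -> 1 <= m ->
  (forall l, 0 < p l) -> (forall l, 0 <= e l) ->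
  q = L%:R^-1 * \sum_l (p l ^- 4 / (1 + e l)) ->
  a = L%:R^-1 * \sum_l (1 + e l) ->
  q^-1 ^+ k <= (m ^+ 4 * a) ^+ (2 * k) + (1 + (\prod_l p l) / m ^+ L).
Proof.
move=> L0 kL m1 p0 e0 qE aE; have m0 : 0 < m by exact: (lt_le_trans ltr01 m1).
(* For [p l] the inverse square root of the l-th block determinant and [m = c ^+ dy], this [X] has
   expectation at most 1. *)
set X := (\prod_l p l) / m ^+ L.
have X0 : 0 <= X.
  by rewrite divr_ge0 ?exprn_ge0 ?(ltW m0)//; apply: prodr_ge0 => l _; exact: ltW.
have e1 l : 0 < 1 + e l by rewrite ltr_pwDl.
have t0 l : 0 < p l ^- 4 / (1 + e l) by rewrite divr_gt0// invr_gt0 exprn_gt0.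
have Lr : 0 < L%:R :> R by rewrite ltr0n.
have a0 : 0 <= a by rewrite aE mulr_ge0 ?invr_ge0// sumr_ge0// => l _; rewrite ltW.
have q0 : 0 < q.
  rewrite qE mulr_gt0 ?invr_gt0//; apply: (lt_le_trans (t0 (Ordinal L0))).
  by rewrite (bigD1 (Ordinal L0))//= lerDl sumr_ge0// => l _; rewrite ltW.
have agm (g : 'I_L -> R) : (forall l, 0 <= g l) ->
    \prod_l g l <= (L%:R^-1 * \sum_l g l) ^+ L.
  move=> g0; have := @leif_AGM R 'I_L predT g (fun l _ => g0 l).
  by rewrite cardT size_enum_ord mulrC => -[].
have qL : q^-1 ^+ L <= (m ^+ 4 * a) ^+ L * X ^+ 4.
  rewrite exprVn; apply: (@le_trans _ _ (\prod_l (p l ^- 4 / (1 + e l)))^-1).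
    rewrite lef_pV2 ?posrE ?exprn_gt0 ?prodr_gt0//.
    by rewrite qE; apply: agm => l; rewrite ltW.
  rewrite -prodfV (eq_bigr (fun l => p l ^+ 4 * (1 + e l))); last first.
    by move=> l _; rewrite invfM !invrK.
  rewrite big_split/= prodrXl.
  have -> : (m ^+ 4 * a) ^+ L * X ^+ 4 = (\prod_l p l) ^+ 4 * a ^+ L.
    rewrite /X exprMn expr_div_n -!exprM [(4 * L)%N]mulnC; field.
    by rewrite expf_neq0// gt_eqF.
  rewrite ler_wpM2l ?exprn_ge0 ?prodr_ge0// => [l _|]; first exact: ltW.
  by rewrite aE; apply: agm => l; rewrite ltW.
have b0 : 0 <= m ^+ 4 * a by rewrite mulr_ge0// exprn_ge0// ltW.
have qi0 : 0 <= q^-1 by rewrite invr_ge0 ltW.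
(* A root of order [L] is avoided by comparing L-th powers; then Y^(8k) <= (1 + Y)^(8k) <= (1 + Y)^L
   because 8k <= L. *)
have key (u b Y : R) : 0 <= u -> 0 <= b -> 0 <= Y -> u ^+ L <= b ^+ L * Y ^+ 4 ->
    u ^+ (2 * k) <= b ^+ (2 * k) * (1 + Y).
  move=> u0 bb0 Y0 ubY.
  rewrite -(@ler_pXn2r _ L)// ?nnegrE ?mulr_ge0 ?exprn_ge0 ?addr_ge0//.
  rewrite -exprM mulnC exprM; apply: le_trans (lerXn2r _ _ _ ubY) _.
  - by rewrite nnegrE exprn_ge0.
  - by rewrite nnegrE mulr_ge0 ?exprn_ge0.
  rewrite exprMn [leRHS]exprMn -!exprM [((2 * k) * L)%N]mulnC.
  rewrite ler_wpM2l ?exprn_ge0//.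
  apply: (@le_trans _ _ ((1 + Y) ^+ (4 * (2 * k)))).
    by rewrite lerXn2r ?nnegrE ?addr_ge0// lerDr.
  by rewrite ler_weXn2l ?lerDl// mulnA.
(* Turns the product bound into a sum, whose terms can be integrated separately. *)
have sqr_le (u s t : R) : 0 <= u -> 0 <= s -> 0 <= t -> u ^+ 2 <= s * t -> u <= s + t.
  move=> u0 s0 t0' ust; rewrite -(@ler_pXn2r _ 2)// ?nnegrE ?addr_ge0//; nra.
apply: sqr_le; rewrite ?exprn_ge0 ?addr_ge0//.
by rewrite -exprM mulnC; exact: key.
Qed.

End inverse_moments_real.

Section moment_closure.
Context d (T : measurableType d) (R : realType) (P : probability T R).

Lemma measurable_invr_ge0 (f : T -> R) : measurable_fun setT f ->
  (forall om, 0 <= f om) -> measurable_fun setT (fun om => (f om)^-1).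
Proof.
move=> mf f0; rewrite (_ : (fun _ => _) = (@powR R) ^~ (- 1) \o f).
  by apply: measurableT_comp => //; exact: measurable_powR.
by apply/funext => om; rewrite /= powRN powRr1.
Qed.

Lemma moment_bounded_prod (J : Type) (F : set_system J) (FF : Filter F) (K : Type)
    (s : seq K) (f : K -> J -> T -> R) :
  (forall k, moment_bounded P F (f k)) ->
  moment_bounded P F (fun j om => \prod_(k <- s) f k j om).
Proof.
move=> bf; elim: s => [|k s IHs].
  rewrite (_ : (fun _ _ => _) = fun=> cst 1); first exact: moment_bounded_cst.
  by apply/funext => j; apply/funext => om; rewrite big_nil.
rewrite (_ : (fun _ _ => _) = fun j om => f k j om * \prod_(i <- s) f i j om).
  exact: moment_boundedM.
by apply/funext => j; apply/funext => om; rewrite big_cons.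
Qed.

Lemma moment_bounded_det (J : Type) (F : set_system J) (FF : Filter F) n
    (M : J -> T -> 'M[R]_n) :
  (forall a b, moment_bounded P F (fun j om => M j om a b)) ->
  moment_bounded P F (fun j om => \det (M j om)).
Proof.
move=> bM; apply: moment_bounded_sum => s; apply: moment_boundedM.
  exact: moment_bounded_cst.
exact: moment_bounded_prod.
Qed.

Lemma moment_bounded_along (J K : Type) (F : set_system J) (G : set_system K)
    (f : K -> T -> R) (k : J -> K) : k @ F --> G ->
  moment_bounded P G f -> moment_bounded P F (fun j => f (k j)).
Proof.
move=> kFG [mf bf]; split=> // p; have [c fc] := bf p; exists c.
exact: kFG fc.
Qed.

Lemma moment_bounded_block_defect (J : Type) (F : set_system J) (FF : Filter F) n
    (M : J -> T -> 'M[R]_n) :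
  (forall a b, moment_bounded P F (fun j om => M j om a b)) ->
  moment_bounded P F (fun j om => block_defect (M j om)).
Proof.
move=> bM; apply: moment_boundedM; first exact: moment_bounded_cst.
apply: moment_boundedX; apply: moment_bounded_sum => a; apply: moment_bounded_sum => b.
apply: moment_bounded_norm.
rewrite (_ : (fun _ _ => _) = fun j om => (-1) ^+ (b + a) *
    \det (row' b (col' a (M j om)))); last first.
  by apply/funext => j; apply/funext => om; rewrite mxE.
apply: moment_boundedM; first exact: moment_bounded_cst.
apply: moment_bounded_det => i k.
rewrite (_ : (fun _ _ => _) = fun j om => M j om (lift b i) (lift a k)) //.
by apply/funext => j; apply/funext => om; rewrite !mxE.
Qed.

End moment_closure.

Section inverse_square_root_product.
Variable R : realType.

Lemma invsqrt_gt0 (u : R) : (0 < invsqrt u)%E.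
Proof.
rewrite /invsqrt; have [//|u0] := eqVneq u 0.
by rewrite lte_fin invr_gt0 sqrtr_gt0 normr_gt0.
Qed.

Lemma prod_invsqrt_eqy (K : eqType) (s : seq K) (u : K -> R) k : k \in s -> u k = 0 ->
  (\prod_(i <- s) invsqrt (u i) = +oo)%E.
Proof.
move=> ks uk; elim: s ks => // i s IHs; rewrite inE big_cons.
have [<- _|ik /= ks] := eqVneq k i.
  rewrite {1}/invsqrt uk eqxx gt0_mulye//; elim: s {IHs} => [|j s IHs].
    by rewrite big_nil.
  by rewrite big_cons mule_gt0// invsqrt_gt0.
by rewrite IHs// gt0_muley// invsqrt_gt0.
Qed.

End inverse_square_root_product.

Section inverse_weight.
Context d (T : measurableType d) (R : realType) (P : probability T R).
Variables (dx dy : nat) (A Bw : 'M[R]_dx) (C : 'M[R]_(dy, dx)) (Dv : 'M[R]_dy).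
Variables (w : nat -> T -> 'cV[R]_dx) (v : nat -> T -> 'cV[R]_dy).
Hypothesis wvP : iid_std_gaussian_noises P w v.
Variable r : R.
Hypothesis Ar : forall k, \sum_(i < k) nm (A ^+ i) <= r.
Local Notation u := (whitened A Bw C Dv w v).
Local Notation bdet := (block_det A Bw C Dv w v).
Local Notation bounded := (moment_bounded P (globally [set: nat])).

Definition wblock (l : nat) (om : T) : 'M[R]_dy :=
  \matrix_(a, b) cv_entry (u ((l * dy).+1 + b) om) a.

(** The lower bound for the empirical Gram matrix of the whitened outputs, up to constants. *)
Definition mean_weight (L : nat) (om : T) : R :=
  L%:R^-1 * \sum_(l < L) block_weight (wblock l om).

Lemma mean_weight_ge0 L om : 0 <= mean_weight L om.
Proof.
by rewrite mulr_ge0 ?invr_ge0// sumr_ge0// => l _; exact: block_weight_ge0.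
Qed.

Lemma bounded_wblock a b : bounded (fun l om => wblock l om a b).
Proof.
rewrite (_ : (fun _ _ => _) = fun l om =>
    (invmx Dv *m C *m state A Bw w ((l * dy).+1 + b) om) a 0 +
    v ((l * dy).+1 + b) om a 0); last first.
  by apply/funext => l; apply/funext => om; rewrite mxE cv_entryE mxE.
apply: moment_boundedD.
  apply: bounded_mulmx_coord => j.
  exact: (moment_bounded_reindex (fun l => (l * dy).+1 + b)%N (bounded_state Bw wvP Ar j)).
exact: (moment_bounded_reindex (fun l => (l * dy).+1 + b)%N (bounded_v wvP a)).
Qed.

Lemma measurable_mean_weight L : measurable_fun [set: T] (mean_weight L).
Proof.
apply: measurable_funM => //; apply: measurable_sum => l; apply: measurable_funM.
  apply: measurable_funX; have [+ _] := moment_bounded_det _ bounded_wblock; exact.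
apply: measurable_invr_ge0 => [|om]; last by rewrite addr_ge0// block_defect_ge0.
apply: measurable_funD => //.
have [+ _] := moment_bounded_block_defect _ bounded_wblock; exact.
Qed.

Let c := 1 + 8 * normal_peak 1 : R.

Let c_ge1 : 1 <= c.
Proof. by rewrite lerDl mulr_ge0// normal_peak_ge0. Qed.

Let defect L om := L%:R^-1 * \sum_(l < L) (1 + block_defect (wblock l om)).

(** If some block determinant vanishes the right-hand side is infinite. Otherwise [p l] is the
    inverse square root of its modulus, so that [p l ^- 4] is the squared determinant in the
    weight. *)
Lemma mean_weight_inv_le k L om : (0 < L)%N -> (8 * k <= L)%N ->
  (((mean_weight L om)^-1 ^+ k)%:E <=
   (((c ^+ dy) ^+ 4 * defect L om) ^+ (2 * k) + 1)%:E +
   ((c ^+ dy) ^- L)%:E * \prod_(l < L) invsqrt (bdet l om))%E.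
Proof.
move=> L0 kL; have m1 : 1 <= c ^+ dy by rewrite exprn_ege1.
have m0 : 0 < c ^+ dy by exact: (lt_le_trans ltr01 m1).
have [[l dl]|dn] := pselect (exists l : 'I_L, bdet l om = 0).
  rewrite (prod_invsqrt_eqy (k := l)) ?mem_index_enum// gt0_muley.
    by rewrite addey// leey.
  by rewrite lte_fin invr_gt0 exprn_gt0.
have d0 (l : 'I_L) : bdet l om != 0 by apply/eqP => dl; apply: dn; exists l.
pose p (l : 'I_L) := (Num.sqrt `|bdet l om|)^-1.
rewrite (eq_bigr (fun l : 'I_L => (p l)%:E)) => [|l _]; last first.
  by rewrite /invsqrt (negPf (d0 l)).
rewrite prodEFin -EFinM -EFinD lee_fin -addrA [_^-1 * _]mulrC.
apply: (average_weight_inverse_le (p := p) (e := fun l => block_defect (wblock l om))) => //.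
- by move=> l; rewrite invr_gt0 sqrtr_gt0 normr_gt0.
- by move=> l; exact: block_defect_ge0.
- congr (_ * _); apply: eq_bigr => l _; congr (_ / _).
  rewrite /p exprVn invrK -[4%N]/(2 * 2)%N exprM sqr_sqrtr// real_normK ?num_real//.
Qed.

Lemma bounded_mean_weight_inv : moment_bounded P \oo (fun L om => (mean_weight L om)^-1).
Proof.
have minv L : measurable_fun [set: T] (fun om => (mean_weight L om)^-1).
  apply: measurable_invr_ge0; first exact: measurable_mean_weight.
  exact: mean_weight_ge0.
split=> // p.
have m0 : 0 < c ^+ dy by rewrite exprn_gt0// (lt_le_trans ltr01 c_ge1).
have [mD bD] : bounded (fun L om => (c ^+ dy) ^+ 4 * defect L om).
  apply: moment_boundedM; first exact: moment_bounded_cst.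
  apply: (bounded_average (f := fun l om => 1 + block_defect (wblock l om))).
  apply: moment_boundedD; first exact: moment_bounded_cst.
  apply: moment_bounded_block_defect; exact: bounded_wblock.
have [b bb] := bD p.+1.
(* [b] bounds the moment of the averaged defects, the first 1 is the additive constant, the second
   bounds the normalised product. The order [2 ^ p] is reached only for [L >= 8 * 2 ^ p], so the
   bound is asymptotic in [L]. *)
exists (b + 1 + 1); near=> L.
have L0 : (0 < L)%N by near: L; exact: nbhs_infty_gt.
have L8 : (8 * 2 ^ p <= L)%N by near: L; exact: nbhs_infty_ge.
pose g om := (`|(c ^+ dy) ^+ 4 * defect L om| ^+ (2 ^ p.+1))%:E.
have mg : measurable_fun setT g.
  by apply/measurable_EFinP; apply: measurable_funX; apply: measurableT_comp.
have g0 om : setT om -> (0 <= g om)%E by move=> _; rewrite lee_fin exprn_ge0.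
pose h om := (\prod_(l < L) invsqrt (bdet l om))%E.
have mh : measurable_fun setT h.
  apply: emeasurable_prod => l; apply: (measurableT_comp measurable_invsqrt).
  exact: (measurable_minor A Bw C Dv wvP).
have h0 om : setT om -> (0 <= h om)%E.
  by move=> _; apply: prode_ge0 => l _; exact: invsqrt_ge0.
have k0 : (0 <= (c ^+ dy) ^- L)%R by rewrite invr_ge0 exprn_ge0// ltW.
have kh0 om : setT om -> (0 <= ((c ^+ dy) ^- L)%:E * h om)%E.
  by move=> _; rewrite mule_ge0 ?lee_fin ?h0.
have mkh : measurable_fun setT (fun om => ((c ^+ dy) ^- L)%:E * h om)%E.
  exact: emeasurable_funM.
have g1 om : setT om -> (0 <= g om + 1)%E by move=> _; rewrite adde_ge0 ?g0.
have mg1 : measurable_fun setT (fun om => g om + 1)%E by exact: emeasurable_funD.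
apply: (@le_trans _ _ (\int[P]_om ((g om + 1) + ((c ^+ dy) ^- L)%:E * h om))%E).
  apply: ge0_le_integral.
  - exact: measurableT.
  - by move=> om _; rewrite lee_fin exprn_ge0.
  - by apply/measurable_EFinP; apply: measurable_funX; exact: measurableT_comp.
  - exact: emeasurable_funD.
  - move=> om _; rewrite ger0_norm ?invr_ge0 ?mean_weight_ge0//.
    rewrite (le_trans (mean_weight_inv_le om L0 L8))// leeD2r// EFinD leeD2r// lee_fin.
    by rewrite expnS (le_trans (ler_norm _))// normrX.
rewrite ge0_integralD// ge0_integralD// ge0_integralZl_EFin//.
rewrite integral_cst//= probability_setT mule1 !EFinD; apply: leeD.
  by rewrite leeD2r// bb.
apply: le_trans (lee_wpmul2l _ (integral_prod_invsqrt_det A Bw C Dv wvP L)) _.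
  by rewrite lee_fin.
by rewrite -EFinM lee_fin exprM mulVf// expf_neq0// gt_eqF.
Unshelve. all: by end_near. Qed.

(** The integral of [invsqrt] of the first block determinant is finite, so this determinant is
    almost surely nonzero; one nonsingular block suffices. *)
Lemma mean_weight_gt0 L : (0 < L)%N -> {ae P, forall om, 0 < mean_weight L om}.
Proof.
move=> L0.
have mf : measurable_fun [set: T] (fun om => invsqrt (bdet 0 om)).
  apply: (measurableT_comp measurable_invsqrt); exact: (measurable_minor A Bw C Dv wvP).
have fint : P.-integrable setT (fun om => invsqrt (bdet 0 om)).
  apply/integrableP; split=> //.
  under eq_integral do rewrite gee0_abs ?invsqrt_ge0//.
  have := integral_prod_invsqrt_det A Bw C Dv wvP 1.
  under [in X in X -> _]eq_integral do rewrite big_ord1.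
  by move=> /le_lt_trans; apply; exact: ltry.
apply: filterS (integrable_ae measurableT fint) => om /(_ I).
rewrite /invsqrt; have [//|d0 _] := eqVneq (bdet 0 om) 0.
rewrite mulr_gt0 ?invr_gt0 ?ltr0n// (bigD1 (Ordinal L0))//=.
rewrite ltr_pwDl//; last by rewrite sumr_ge0// => l _; exact: block_weight_ge0.
rewrite divr_gt0//; last by rewrite ltr_pwDl// block_defect_ge0.
by rewrite lt_def sqr_ge0 sqrf_eq0 d0.
Qed.

End inverse_weight.

(** * Consistency of least squares *)

Section least_squares_error.
Variable R : realType.

Lemma fsq_col_sum m n (M : 'M[R]_(m, n)) : \sum_j fsq (col j M) = fsq M.
Proof.
rewrite /fsq exchange_big; apply: eq_bigr => j _; apply: eq_bigr => i _.
by rewrite big_ord1 mxE.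
Qed.

Lemma sum_ord_blocks (f : nat -> R) (L n : nat) :
  \sum_(t < L * n) f t = \sum_(l < L) \sum_(b < n) f (l * n + b)%N.
Proof.
elim: L => [|L IHL]; first by rewrite !big_ord0.
by rewrite mulSnr big_split_ord/= IHL [RHS]big_ord_recr.
Qed.

Lemma fsq_sub_mulmx n (e z : 'cV[R]_n) (M : 'M[R]_n) :
  fsq (e - M *m z) = fsq e - 2 * \tr (M *m (e *m z^T)^T) + fsq (M *m z).
Proof.
rewrite !fsq_mxtrace linearB/= mulmxBl !mulmxBr !linearB/= !trmx_mul !trmxK.
have -> : \tr (M *m z *m e^T) = \tr (M *m (z *m e^T)) by rewrite mulmxA.
have -> : \tr (e *m (z^T *m M^T)) = \tr (M *m (z *m e^T)).
  by rewrite -mxtrace_tr !trmx_mul !trmxK mulmxA.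
ring.
Qed.

(** The basic inequality of least squares: compare the costs of [Fh] and [F] and cancel the residual
    energy of [F]. From [m + 1] outputs there are [m] transitions. *)
Lemma lsq_minimizer_excess n m (y : nat -> 'cV[R]_n) (Fh F : 'M[R]_n) :
  lsq_minimizer y m.+1 Fh ->
  \sum_(t < m) fsq ((Fh - F) *m y t.+1) <=
  2 * (nm (Fh - F) * nm (\sum_(t < m) (y t.+2 - F *m y t.+1) *m (y t.+1)^T)).
Proof.
move=> /(_ F); rewrite /lsq_cost !big_add1 /= !big_mkord.
set D := Fh - F; pose e (t : nat) := y t.+2 - F *m y t.+1.
have -> : \sum_(t < m) euclidean_norm (y t.+2 - Fh *m y t.+1) ^+ 2 =
    \sum_(t < m) fsq (e t) - 2 * \tr (D *m (\sum_(t < m) e t *m (y t.+1)^T)^T) +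
    \sum_(t < m) fsq (D *m y t.+1).
  rewrite linear_sum/= mulmx_sumr linear_sum mulr_sumr -sumrB -big_split.
  apply: eq_bigr => t _ /=; rewrite /euclidean_norm frobenius_normE -fsq_sub_mulmx.
  by rewrite /e /D mulmxBl opprB addrA subrK.
rewrite [X in _ <= X](eq_bigr (fun t : 'I_m => fsq (e t))) => [|t _]; last first.
  by rewrite /euclidean_norm frobenius_normE.
move=> le; have {le} : \sum_(t < m) fsq (D *m y t.+1) <=
    2 * \tr (D *m (\sum_(t < m) e t *m (y t.+1)^T)^T) by lra.
move=> /le_trans; apply; rewrite ler_wpM2l// (le_trans (ler_norm _))//.
by rewrite (le_trans (ler_mxtrace_nm _))// (le_trans (ler_nmM _ _))// nm_tr.
Qed.

End least_squares_error.

Section least_squares_consistency.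
Context d (T : measurableType d) (R : realType) (P : probability T R).
Variables (dx dy : nat) (A Bw : 'M[R]_dx) (C : 'M[R]_(dy, dx)) (Dv : 'M[R]_dy).
Variables (w : nat -> T -> 'cV[R]_dx) (v : nat -> T -> 'cV[R]_dy).
Local Notation y := (output A Bw C Dv w v).
Local Notation mw := (mean_weight A Bw C Dv w v).
Hypothesis Dv_unit : Dv \in unitmx.

Lemma outputE t om : y t om = Dv *m whitened A Bw C Dv w v t om.
Proof. by rewrite /output /whitened mulmxDr -mulmxA mulKVmx. Qed.

Lemma col_wblock l om (b : 'I_dy) :
  col b (wblock A Bw C Dv w v l om) = whitened A Bw C Dv w v ((l * dy).+1 + b) om.
Proof. by apply/colP => a; rewrite mxE [LHS]mxE cv_entryE. Qed.

(** The columns of [Dv *m wblock l] are outputs; outputs outside the [L] blocks are dropped from the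
    energy. *)
Lemma data_energy_ge (L m : nat) om (D : 'M[R]_dy) : (L * dy <= m)%N ->
  nm (D *m Dv) ^+ 2 * (L%:R * mw L om) <= \sum_(t < m) fsq (D *m y t.+1 om).
Proof.
move=> Lm; apply: (@le_trans _ _ (\sum_(t < L * dy) fsq (D *m y t.+1 om))).
  rewrite (sum_ord_blocks (fun t => fsq (D *m y t.+1 om))).
  rewrite /mean_weight; case: L {Lm} => [|L]; first by rewrite !big_ord0 !mulr0.
  rewrite mulVKf// mulr_sumr; apply: ler_sum => l _.
  rewrite (le_trans (block_weight_le _ _))// -fsq_col_sum le_eqVlt.
  apply/orP; left; apply/eqP/eq_bigr => b _.
  by rewrite colE -mulmxA -colE col_wblock outputE mulmxA addSn.
rewrite -(subnKC Lm) big_split_ord/= lerDl sumr_ge0// => t _; exact: fsq_ge0.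
Qed.

Definition residual_avg (F : 'M[R]_dy) : nat -> T -> 'M[R]_dy :=
  mavg (fun t om => (y t.+1 om - F *m y t om) *m (y t om)^T).

(** The constant collects 2 from the basic inequality, [2 * dy.+1] from [m <= 2 * dy.+1 * L], and
    [nm (invmx Dv) ^+ 2] from undoing the whitening. Dividing by [dy.+1] keeps [L * dy <= m] and
    makes sense for [dy = 0]. *)
Definition lsq_error_bound (F : 'M[R]_dy) (m : nat) (om : T) : R :=
  nm (residual_avg F m om) * ((mw (m %/ dy.+1) om)^-1 *
    (4 * dy.+1%:R * nm (invmx Dv) ^+ 2)).

Lemma lsq_error_le (Fh F : 'M[R]_dy) m om : (0 < m %/ dy.+1)%N ->
  0 < mw (m %/ dy.+1) om -> lsq_minimizer (fun t => y t om) m.+1 Fh ->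
  nm (Fh - F) <= lsq_error_bound F m om.
Proof.
set L := (m %/ dy.+1)%N => L0 l0 /(lsq_minimizer_excess F); rewrite /lsq_error_bound -/L.
set D := Fh - F; set E := \sum_(t < m) _ *m _.
have m0 : (0 < m)%N by case: (m) @L L0 {l0 E} => //; rewrite div0n.
have LE : nm E = m%:R * nm (residual_avg F m om).
  rewrite /residual_avg /mavg nmZ ger0_norm ?invr_ge0// mulVKf//.
  by rewrite pnatr_eq0 -lt0n.
have Lm : (L * dy <= m)%N.
  by apply: leq_trans (leq_trunc_div m dy.+1); rewrite leq_mul2l leqnSn orbT.
have mL : m%:R <= 2 * dy.+1%:R * L%:R :> R.
  rewrite -!natrM ler_nat; apply: leq_trans (ltnW (ltn_ceil m (ltn0Sn dy))) _.
  by rewrite -/L mulnAC leq_mul2r mul2n -addnn orbC -{1}[L]addn0 ltn_add2l L0.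
move=> /(le_trans (data_energy_ge om D Lm)); rewrite LE.
have DE : nm D <= nm (D *m Dv) * nm (invmx Dv).
  by rewrite -{1}(mulmxK Dv_unit D) ler_nmM.
move: DE; have := nm_ge0 D; have := nm_ge0 (D *m Dv); have := nm_ge0 (residual_avg F m om).
have := nm_ge0 (invmx Dv).
move: (nm D) (nm (D *m Dv)) (nm (residual_avg F m om)) (nm (invmx Dv)) => x z e k.
move=> k0 e0 z0 x0 xzk.
set l := mw L om in l0 *.
have Lr : 0 < L%:R :> R by rewrite ltr0n.
move=> H; have [->|xn] := eqVneq x 0.
  by rewrite mulr_ge0// !mulr_ge0// ?invr_ge0 ?ltW// exprn_ge0.
have xp : 0 < x by rewrite lt_def xn.
have x2 : x ^+ 2 <= z ^+ 2 * k ^+ 2 by rewrite -exprMn lerXn2r ?nnegrE ?mulr_ge0.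
rewrite mulrCA mulrC ler_pdivlMr// -(ler_pM2r Lr) -(ler_pM2l xp).
apply: (@le_trans _ _ (k ^+ 2 * (2 * (x * (m%:R * e))))).
  apply: (@le_trans _ _ (k ^+ 2 * (z ^+ 2 * (L%:R * l)))).
    rewrite (_ : x * _ = x ^+ 2 * (L%:R * l)); last by ring.
    by rewrite mulrA [k ^+ 2 * _]mulrC ler_wpM2r// mulr_ge0 ?ltW.
  by rewrite ler_wpM2l// exprn_ge0.
rewrite (_ : k ^+ 2 * _ = m%:R * (2 * k ^+ 2 * x * e)); last by ring.
rewrite (_ : x * _ = (2 * dy.+1%:R * L%:R) * (2 * k ^+ 2 * x * e)); last by ring.
by rewrite ler_wpM2r// !mulr_ge0// exprn_ge0.
Qed.

Hypothesis wvP : iid_std_gaussian_noises P w v.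
Variable r : R.
Hypothesis Ar : forall k, \sum_(i < k) nm (A ^+ i) <= r.

Lemma divn_cvg_infty k : (fun n => n %/ k.+1)%N @ \oo --> \oo.
Proof.
move=> S [N _ NS]; exists (N * k.+1)%N => // n /= Nn; apply: NS => /=.
by rewrite leq_divRL.
Qed.

Lemma lsq_error_bound_vanishing (X : 'M[R]_dx) (F : 'M[R]_dy) :
  stationary_cov A Bw X ->
  F *m (C *m X *m C^T + Dv *m Dv^T) = C *m A *m X *m C^T ->
  vanishing P \oo (lsq_error_bound F).
Proof.
move=> XE FE; apply: vanishingM.
  by apply: mvanishing_nm; exact: (residual_cov_vanishing wvP Ar XE FE).
apply: moment_boundedM; last exact: moment_bounded_cst.
apply: (moment_bounded_along (f := fun L om => (mw L om)^-1) (@divn_cvg_infty dy)).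
exact: (bounded_mean_weight_inv Bw C Dv wvP Ar).
Qed.

End least_squares_consistency.

(** * Limits of integrals of possibly non-measurable functions *)

Section sandwich.
Context d (T : measurableType d) (R : realType) (P : probability T R).

(** The integral of a nonnegative function is a supremum over the simple functions below it, hence
    monotone whether or not the integrands are measurable. *)
Lemma nonneg_integral_le (f1 f2 : T -> \bar R) : (forall om, 0 <= f1 om)%E ->
  (forall om, f1 om <= f2 om)%E -> (\int[P]_om f1 om <= \int[P]_om f2 om)%E.
Proof.
move=> f10 f12; have f20 om : (0 <= f2 om)%E by exact: le_trans (f12 om).
rewrite !ge0_integralTE//; apply: le_ereal_sup => _ [h hf <-].
by exists h => // om; exact: le_trans (f12 om).
Qed.

(* [f] need not be measurable, so the monotonicity of the integral is the only
   property of it that is used *)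
Lemma integral_sandwich_cvg (f g : nat -> T -> R) (b : R) :
  0 <= b -> (forall n om, 0 <= f n om) -> vanishing P \oo g ->
  (\forall n \near \oo, {ae P, forall om, `|f n om - b| <= g n om}) ->
  (\int[P]_om (f n om)%:E)%E @[n --> \oo] --> b%:E.
Proof.
move=> b0 f0 vg fg.
have mg n : measurable_fun setT (fun om => (`|g n om|)%:E).
  by apply/measurable_EFinP; apply: measurableT_comp => //; exact: vg.1.1.
have g0 n om : setT om -> (0 <= (`|g n om|)%:E)%E by rewrite lee_fin.
have H e : 0 < e -> \forall n \near \oo,
    (b%:E <= \int[P]_om (f n om)%:E + e%:E)%E /\
    (\int[P]_om (f n om)%:E <= b%:E + e%:E)%E.
  move=> e0; near=> n.
  have ge : (\int[P]_om (`|g n om|)%:E <= e%:E)%E.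
    by near: n; exact: vanishing_integral.
  have [N [mN PN fN]] : {ae P, forall om, `|f n om - b| <= g n om} by near: n.
  have {}fN om : ~ N om -> `|f n om - b| <= g n om.
    by move=> nN; apply: contrapT => nf; apply: nN; exact: fN.
  (* Infinite on the exceptional null set, with integral 0: adding it makes the almost sure bounds
     hold at every outcome. *)
  pose iN : T -> \bar R := cst +oo%E \_ N.
  have miN : measurable_fun setT iN.
    by apply/(measurable_restrictT _ mN); exact: measurable_cst.
  have iN0 om : setT om -> (0 <= iN om)%E by move=> _; apply: erestrict_ge0 => ? _; exact: le0y.
  have IiN : (\int[P]_om iN om = 0)%E.
    by rewrite -integral_mkcond integral_cst//= [P N]PN mule0.
  have iNy om : N om -> iN om = +oo%E by move=> Nom; rewrite /iN patchT ?inE.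
  have iNn om : ~ N om -> iN om = 0%E.
    by move=> nN; rewrite /iN patchN// notin_setE.
  have mgi : measurable_fun setT (fun om => (`|g n om|)%:E + iN om)%E.
    exact: emeasurable_funD.
  have gi0 om : setT om -> (0 <= (`|g n om|)%:E + iN om)%E.
    by move=> ?; rewrite adde_ge0 ?g0 ?iN0.
  have Igi : (\int[P]_om ((`|g n om|)%:E + iN om) <= e%:E)%E.
    by rewrite ge0_integralD// IiN adde0.
  split.
  (* A measurable minorant of [f n]. Additivity is then used only on [h], [g n] and [iN], whose sum
     dominates [b]. *)
  - pose h : T -> \bar R := (fun om => (Num.max 0 (b - `|g n om|))%:E) \_ (~` N).
    have mh : measurable_fun setT h.
      apply/(measurable_restrictT _ (measurableC mN)); apply: measurable_funTS.
      apply/measurable_EFinP; apply: measurable_maxr => //.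
      by apply: measurable_funB => //; apply/measurable_EFinP; exact: mg.
    have h0 om : setT om -> (0 <= h om)%E.
      by move=> _; apply: erestrict_ge0 => ? _; rewrite lee_fin le_max lexx.
    have hf : (\int[P]_om h om <= \int[P]_om (f n om)%:E)%E.
      apply: nonneg_integral_le => om; first exact: h0.
      have [Nom|nN] := pselect (N om).
        by rewrite /h patchN ?lee_fin// notin_setE => /(_ Nom).
      rewrite /h patchT ?inE// lee_fin ge_max f0/=.
      by have := fN om nN; have := ler_norm (g n om); rewrite ler_norml; lra.
    apply: (@le_trans _ _ (\int[P]_om (h om + ((`|g n om|)%:E + iN om)))%E).
      have -> : b%:E = (\int[P]_om (cst b%:E om))%E.
        by rewrite integral_cst//= probability_setT mule1.
      apply: nonneg_integral_le => om; first by rewrite lee_fin.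
      have [Nom|nN] := pselect (N om).
        by rewrite iNy// addey ?leey// gt_eqF// (lt_le_trans _ (h0 om I)).
      rewrite iNn// adde0 /h patchT ?inE// -EFinD lee_fin.
      by rewrite -lerBlDr le_max lexx orbT.
    by rewrite ge0_integralD//; apply: leeD.
  - apply: (@le_trans _ _ (\int[P]_om (b%:E + ((`|g n om|)%:E + iN om)))%E).
      apply: nonneg_integral_le => om; first by rewrite lee_fin.
      have [Nom|nN] := pselect (N om).
        by rewrite iNy// addey ?leey.
      rewrite iNn// adde0 -EFinD lee_fin.
      by have := fN om nN; have := ler_norm (g n om); rewrite ler_norml; lra.
    rewrite ge0_integralD//.
    by rewrite integral_cst//= probability_setT mule1 leeD2l.
apply/fine_cvgP; split.
  have := H 1 ltr01; apply: filterS => n [_ le].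
  rewrite ge0_fin_numE; first by rewrite (le_lt_trans le)// -EFinD ltry.
  by apply: integral_ge0 => om _; rewrite lee_fin.
apply/cvgrPdist_le => e e0; have := H e e0; apply: filterS => n [] /=.
have : (0 <= \int[P]_om (f n om)%:E)%E.
  by apply: integral_ge0 => om _; rewrite lee_fin.
case: (integral _ _ _) => [x| |]//=; rewrite -!EFinD !lee_fin => x0 H1 H2.
by rewrite ler_norml; lra.
Unshelve. all: by end_near. Qed.

End sandwich.

Lemma definite_unitmx (R : realType) n (M : 'M[R]_n) :
  (forall x : 'cV[R]_n, x != 0 -> 0 < (x^T *m M *m x) 0 0) -> M \in unitmx.
Proof.
move=> Mpd; rewrite -row_free_unit -kermx_eq0; apply: contraT => /rowV0Pn[x].
move=> /sub_kermxP xM x0; have := Mpd x^T.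
by rewrite trmxK xM mul0mx mxE ltxx trmx_eq0 => /(_ x0).
Qed.

Lemma stationary_loss_ge0 (R : realType) dx dy (A Bw : 'M[R]_dx) (C : 'M[R]_(dy, dx))
    (Dv : 'M[R]_dy) (r : R) (X : 'M[R]_dx) H (G : 'M[R]_(\sum_(i < H) dy, dy)) :
  (forall k, \sum_(i < k) nm (A ^+ i) <= r) -> stationary_cov A Bw X ->
  0 <= stationary_loss A Bw C Dv X G.
Proof.
move=> Ar XE; apply: sumr_ge0 => i _; rewrite /block_loss.
rewrite !addr_ge0 ?fsq_ge0 ?sumr_ge0// => [k _|j _]; first exact: fsq_ge0.
have := stationary_cov_psd Ar (row j (C *m A ^+ i.+1 - submxcol G i *m C)) XE.
rewrite tr_row -row_mul; set Y := _ *m X; set Z := _^T.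
suff -> : (row j Y *m col j Z) 0 0 = (Y *m Z) j j by [].
by rewrite !mxE; apply: eq_bigr => k _; rewrite [row _ _ _ _]mxE [col _ _ _ _]mxE.
Qed.

Theorem proposition4 (R : realType) (dx dy H : nat)
  (A Bw : 'M[R]_dx) (C : 'M[R]_(dy, dx)) (Dv : 'M[R]_dy)
  (H_gt0 : (0 < H)%N)
  (A_stable : spectral_radius A < 1)
  (AC_obs : observable A C)
  (AB_ctrl : controllable A Bw)
  (DvDv_pd : posdef (Dv *m Dv^T))
  (* innovations form and stationary covariances *)
  (S : 'M[R]_dx) (S_riccati : stabilizing_riccati A Bw C Dv S)
  (De : 'M[R]_dy) (De_sqrt : is_psd_sqrt De (innovation_cov C Dv S))
  (Sigma_xh : 'M[R]_dx)
  (Sigma_xhE : stationary_cov A (kalman_gain A C Dv S *m De) Sigma_xh)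
  (Sigma_x : 'M[R]_dx) (Sigma_xE : stationary_cov A Bw Sigma_x)
  (* dataset rollout *)
  (d : measure_display) (T : measurableType d) (P : probability T R)
  (w : nat -> T -> 'cV[R]_dx) (v : nat -> T -> 'cV[R]_dy)
  (wv_noise : iid_std_gaussian_noises P w v)
  (* evaluation rollout, on its own probability space *)
  (d' : measure_display) (T' : measurableType d') (P' : probability T' R)
  (w' : nat -> T' -> 'cV[R]_dx) (v' : nat -> T' -> 'cV[R]_dy)
  (wv'_noise : iid_std_gaussian_noises P' w' v')
  (* single-step least-squares model computed from y_1, ..., y_N *)
  (Ghat : nat -> T -> 'M[R]_dy)
  (Ghat_lsq : \forall N \near \oo, {ae P, forall om,
     lsq_minimizer (fun t => output A Bw C Dv w v t om) N (Ghat N om)}) :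
  let K := kalman_gain A C Dv S in
  let Phi := Phi_mx A C H K in
  let Gstar := Gstar_mx A C H K in
  let Gamma_e := Gamma_mx A C H K De in
  let Sigma_y := C *m Sigma_x *m C^T + Dv *m Dv^T in
  let M := Gstar
           - power_stack H (C *m A *m Sigma_x *m C^T *m invmx Sigma_y) in
  (\int[P]_om
     loss P' (output A Bw C Dv w' v') (power_stack H (Ghat N om)))%E
    @[N --> \oo] -->
  (\tr ((Phi + M *m C) *m Sigma_xh *m (Phi + M *m C)^T)
   + \tr (M *m De *m De^T *m M^T)
   + frobenius_norm Gamma_e ^+ 2)%:E.

Proof.
move=> K Phi Gstar Gamma_e Sigma_y M.
have [r Ar] := spectral_radius_power_bound A_stable.
have DvDv_unit : Dv *m Dv^T \in unitmx by exact: definite_unitmx DvDv_pd.2.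
have Dv_unit : Dv \in unitmx by move: DvDv_unit; rewrite unitmx_mul => /andP[].
have Sy_unit : Sigma_y \in unitmx.
  apply: definite_unitmx => x x0.
  have := stationary_cov_psd Ar (x^T *m C) Sigma_xE.
  have := DvDv_pd.2 x x0.
  rewrite /Sigma_y mulmxDr mulmxDl trmx_mul trmxK !mulmxA [in X in _ -> _ -> X]mxE.
  by move=> ? ?; rewrite ltr_wpDl.
pose F := C *m A *m Sigma_x *m C^T *m invmx Sigma_y.
have FE : F *m Sigma_y = C *m A *m Sigma_x *m C^T by rewrite mulmxKV.
rewrite /Phi /M /Gamma_e /Gstar (innovations_formula Ar S_riccati De_sqrt H F Sigma_xhE Sigma_xE).
pose loss_of G := stationary_loss A Bw C Dv Sigma_x (power_stack H G).
(* The evaluation rollout has its own probability space, so the loss is a deterministic function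
   evaluated at the realised matrix. *)
have lossE N om : loss P' (output A Bw C Dv w' v') (power_stack H (Ghat N om)) =
    (loss_of (Ghat N om))%:E by exact: (loss_stationary C Dv wv'_noise _ Ar Sigma_xE).
have -> : (fun N => \int[P]_om
      loss P' (output A Bw C Dv w' v') (power_stack H (Ghat N om)))%E =
    (fun N => \int[P]_om (loss_of (Ghat N om))%:E)%E.
  by apply/funext => N; apply: eq_integral => om _; exact: lossE.
have [c c0 cP] := stationary_loss_perturb A Bw C Dv Sigma_x H F.
have vdelta := lsq_error_bound_vanishing wv_noise Ar Sigma_xE FE.
pose delta := lsq_error_bound A Bw C Dv w v F.
(* With [N = n + 1] outputs the index [n] counts the transitions. *)
rewrite -(cvg_shiftS (fun N => (\int[P]_om (loss_of (Ghat N om))%:E)%E)).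
apply: (integral_sandwich_cvg (f := fun n om => loss_of (Ghat n.+1 om))
  (g := fun n om => delta n om * (c * (1 + delta n om) ^+ (2 * H).+1))).
- exact: stationary_loss_ge0 Ar Sigma_xE.
- by move=> n om; exact: stationary_loss_ge0 Ar Sigma_xE.
- apply: vanishingM => //; apply: moment_boundedM; first exact: moment_bounded_cst.
  apply: moment_boundedX; apply: moment_boundedD; first exact: moment_bounded_cst.
  exact: vdelta.1.
case: Ghat_lsq => N _ GN; near=> n.
have L0 : (0 < n %/ dy.+1)%N by rewrite divn_gt0//; near: n; exact: nbhs_infty_gt.
have Nn : (N <= n.+1)%N by rewrite leqW//; near: n; exact: nbhs_infty_ge.
apply: filterS2 (GN n.+1 Nn) (mean_weight_gt0 A Bw C Dv wv_noise L0) => om Gom mw0.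
have := lsq_error_le Dv_unit F L0 mw0 Gom; rewrite -/delta => e_le.
have := cP (Ghat n.+1 om - F); rewrite [F + _]addrC subrK => /le_trans; apply.
have e0 := nm_ge0 (Ghat n.+1 om - F).
rewrite -mulrA mulrCA; apply: ler_pM => //.
  by rewrite mulr_ge0// exprn_ge0// addr_ge0.
rewrite ler_wpM2l// lerXn2r ?nnegrE ?lerD2l// addr_ge0// (le_trans e0)//.
Unshelve. all: by end_near. Qed.
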